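(* Let $G=\mathbb R^{d\times d}\times\mathbb R^d$ and let $\{\mu_x: x\in\mathbb R^d\}$ be a family of Borel probability measures on $G$ such that $$\alpha:=\sup_{x\in\mathbb R^d}\int_G\|m\|\,d\mu_x(m,q)<1,\qquad c:=\sup_{x\in\mathbb R^d}\int_G|q|\,d\mu_x(m,q)<\infty .$$ Assume moreover that the map $x\mapsto\mu_x$, $x\in\mathbb R^d$, is Hölder continuous in the total variation norm (i.e. there exist $l>0$ and $\nu\in(0,1]$ with $\|\mu_x-\mu_y\|\le l|x-y|^\nu$ for all $x,y\in\mathbb R^d$), and that there exists $\delta>0$ such that $$(\mu_x\wedge\mu_y)(\{(m,q)\in G:\|m\|\le\alpha\})>\delta\qquad\text{for all }x,y\in\mathbb R^d.$$ Then the operator $P:B_b(\mathbb R^d)\to B_b(\mathbb R^d)$ given by $$Pf(x)=\int_G f(mx+q)\,d\mu_x(m,q)$$ possesses a unique invariant measure $\mu_*\in\mathcal M_1^1(\mathbb R^d)$, which is attractive in $\mathcal M_1(\mathbb R^d)$. Moreover, there exist $r\in(0,1)$ and $C>0$ such that $$\|P^{*n}\mu-\mu_*\|_{FM}\le r^nC\Big(1+\int_{\mathbb R^d}|x|\,\mu(dx)\Big)\qquad\text{for }\mu\in\mathcal M_1^1(\mathbb R^d),\ n\in\mathbb N.$$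
   Context: $|\cdot|$ is the Euclidean norm on $\mathbb R^d$ and $\|m\|=\sup\{|mx|: x\in\mathbb R^d,|x|=1\}$ for $m\in\mathbb R^{d\times d}$; for signed measures $\|\cdot\|$ is the total variation norm. $\mu_x\wedge\mu_y$ is the greatest lower bound of $\mu_x,\mu_y$ in the lattice of finite measures on $G$. $B_b(\mathbb R^d)$ is the space of bounded Borel measurable real functions, $C_b(\mathbb R^d)$ the subspace of bounded continuous functions, $\mathcal M_1(\mathbb R^d)$ the set of Borel probability measures, and $\mathcal M_1^1(\mathbb R^d)=\{\mu\in\mathcal M_1(\mathbb R^d):\int|x|\,\mu(dx)<\infty\}$. The dual operator is $P^*\mu(A)=\int_{\mathbb R^d}P\mathbf 1_A(x)\,\mu(dx)$ for finite Borel measures $\mu$ and Borel $A$. A measure $\mu_*\in\mathcal M_1(\mathbb R^d)$ is invariant for $P$ if $P^*\mu_*=\mu_*$. It is attractive in $\mathcal M_1(\mathbb R^d)$ if $\lim_{n\to\infty}\int P^nf\,d\mu=\int f\,d\mu_*$ for all $f\in C_b(\mathbb R^d)$ and $\mu\in\mathcal M_1(\mathbb R^d)$. Fortet–Mourier metric: $\|\mu_1-\mu_2\|_{FM}=\sup\{|\int f\,d(\mu_1-\mu_2)|: f\in\mathcal F\}$, where $\mathcal F=\{f\in C_b(\mathbb R^d): |f(x)-f(y)|\le|x-y|\text{ and }|f(x)|\le1\text{ for all }x,y\}$. *)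

(* Defs.v *)
From HB Require Import structures.
From mathcomp Require Import all_boot all_order all_algebra.
From mathcomp Require Import all_classical all_reals all_analysis.

Set Implicit Arguments.
Unset Strict Implicit.
Unset Printing Implicit Defensive.

Import Order.TTheory GRing.Theory Num.Theory.
Import numFieldNormedType.Exports.

Local Open Scope classical_set_scope.
Local Open Scope ring_scope.

(* Type synonyms: [borelRd R d] is convertible to ['cV[R]_d], and [borelG R d]
   to ['M[R]_d * 'cV[R]_d], but they carry the Borel sigma-algebra of the
   (product) topology. *)
Notation borelRd R d := (g_sigma_algebraType (@open 'cV[R]_d)).
Notation borelG R d := (g_sigma_algebraType (@open ('M[R]_d * 'cV[R]_d)%type)).

(* The library norm [`|x|] on matrices is the max norm, hence the following. *)
Definition eucl (R : realType) (d : nat) (x : 'cV[R]_d) : R :=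
  Num.sqrt (\sum_(i < d) x i ord0 ^+ 2).

Definition opnorm (R : realType) (d : nat) (m : 'M[R]_d) : R :=
  sup [set eucl (m *m x) | x in [set x : 'cV[R]_d | eucl x = 1]].

Section measures.
Context {disp : measure_display} {T : measurableType disp} {R : realType}.
Local Open Scope ereal_scope.

(* Total variation norm |nu|(T); it does not depend on the Hahn decomposition
   chosen. *)
Definition tv_norm (nu : {charge set T -> \bar R}) : \bar R :=
  let: exist P exN := cid (Hahn_decomposition nu) in
  let: exist N PN := cid exN in
  charge_variation PN setT.

Definition measure_diff (mu nu : {finite_measure set T -> \bar R}) :
    {charge set T -> \bar R} :=
  cadd (charge_of_finite_measure mu) (copp (charge_of_finite_measure nu)).

Definition measure_le (mu nu : {finite_measure set T -> \bar R}) : Prop :=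
  forall A, measurable A -> mu A <= nu A.

Definition is_meet (mu nu kappa : {finite_measure set T -> \bar R}) : Prop :=
  [/\ measure_le kappa mu, measure_le kappa nu &
      forall lambda : {finite_measure set T -> \bar R},
        measure_le lambda mu -> measure_le lambda nu ->
        measure_le lambda kappa].

End measures.

Section operators.
Context {R : realType} {d : nat}.
Local Open Scope ereal_scope.

Definition Bb (f : borelRd R d -> R) : Prop :=
  measurable_fun setT f /\ bounded_fun f.

Definition Cb (f : 'cV[R]_d -> R) : Prop :=
  continuous f /\ bounded_fun f.

Definition first_moment (mu : set (borelRd R d) -> \bar R) : \bar R :=
  \int[mu]_x (eucl x)%:E.

Definition random_affine_op (mu : 'cV[R]_d -> probability (borelG R d) R)
    (f : borelRd R d -> R) (x : borelRd R d) : R :=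
  Rintegral (mu x) setT (fun z => f (z.1 *m x + z.2)%R).

(* Defined on bare set functions so that it can be iterated without first
   proving that [dual_op P nu] is again a measure. *)
Definition dual_op (P : (borelRd R d -> R) -> (borelRd R d -> R))
    (nu : set (borelRd R d) -> \bar R) : set (borelRd R d) -> \bar R :=
  fun A => \int[nu]_x (P (\1_A) x)%:E.

Definition invariant_measure (P : (borelRd R d -> R) -> (borelRd R d -> R))
    (nu : probability (borelRd R d) R) : Prop :=
  forall A, measurable A -> dual_op P nu A = nu A.

Definition attractive (P : (borelRd R d -> R) -> (borelRd R d -> R))
    (mustar : probability (borelRd R d) R) : Prop :=
  forall (f : borelRd R d -> R) (mu : probability (borelRd R d) R), Cb f ->
    (fun n : nat => \int[mu]_x (iter n P f x)%:E) @ \oo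
      --> \int[mustar]_x (f x)%:E.

Definition FM_class : set (borelRd R d -> R) :=
  [set f | [/\ Cb f,
               (forall x y : 'cV[R]_d, `|f x - f y| <= eucl (x - y))%R &
               (forall x : 'cV[R]_d, `|f x| <= 1)%R]].

Definition FM_dist (mu1 mu2 : set (borelRd R d) -> \bar R) : \bar R :=
  ereal_sup [set `|\int[mu1]_x (f x)%:E - \int[mu2]_x (f x)%:E|
            | f in FM_class].

End operators.

(* Main.v *)
(* P contracts a Wasserstein-type distance.  Write V(x) = |x|^(1/2) and
   s(x,y) = N |x-y|^p with p = nu/2, and let D(x,y) be the product of a saturated
   distance phi(s) (linear for s <= 1, then 1 - (1+s)^-q) and of the weight
   1 + beta (V(x) + V(y)).  Couple mu_x and mu_y along their meet kappa, using the
   same (m,q) at both points.  By Jensen s decreases on average by the factor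
   a^p, where a = max(alpha, 1/2); Hoelder continuity bounds the mass lying
   outside kappa by l |x-y|^nu = l (s/N)^2.  By Young's inequality first moments
   control the integral of V over that mass by a multiple of its square root,
   hence of s/N (this is why the weight is |x|^(1/2) and not |x|), so D contracts
   when s <= 1 for large N.  When s > 1, either V(x) + V(y) is large and its drift
   (factor a^(1/2)) wins, or it is bounded and with probability delta the step
   brings s down to a^p s, where phi is smaller by a definite amount.

   No coupling measure is built: centring f so that |f - c_f| <= 1/2 + beta V
   turns the contribution of the mass outside kappa into an excess
   \int . d mu_x - \int . d kappa.  Functions that are D-Lipschitz with constant M
   are thus mapped to D-Lipschitz functions with constant r M.

   Bounded Lipschitz functions are D-Lipschitz, so P^n f(x) converges
   geometrically to a constant L f.  L is a positive normalised functional on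
   bounded Lipschitz functions, tight because alpha < 1, and Daniell's
   construction represents it by a probability measure mu_*. *)

From HB Require Import structures.
Require Import Defs.
From mathcomp Require Import all_boot all_order all_algebra.
From mathcomp Require Import all_classical all_reals all_analysis.
From mathcomp Require Import measurable_realfun giry ring lra.

Import Order.TTheory GRing.Theory Num.Theory.
Import numFieldNormedType.Exports.

Set Implicit Arguments.
Unset Strict Implicit.
Unset Printing Implicit Defensive.

Local Open Scope classical_set_scope.
Local Open Scope ring_scope.

(** * Euclidean and operator norms *)

(** Only the first moments of [||m||] and [|q|] are controlled, so every dominating function has to
    become affine in these two quantities: concave powers are replaced by tangent lines, square
    roots by Young's inequality. Along the meet, new distance times new weight contains
    [||m||^p ||m||^(1/2)], and [p <= 1/2] keeps the total exponent at most 1. Taking [p] to be half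
    the Hoelder exponent makes the square root of the residual mass proportional to [s] itself, so
    that a large [N] absorbs it. The constants are chosen in the order [q], [N], [beta].

    [D] need not be a metric. Only four properties are used: the bound by the weight, smallness near
    the diagonal, domination of the increments of bounded Lipschitz functions, and contraction.

    For Lipschitz [f] the contraction makes [P f] continuous but not visibly Lipschitz. Attraction
    is therefore extended to all bounded continuous test functions before invariance is proved, and
    the measurability of the transition kernel is itself deduced from this continuity. *)

Section euclidean_norm.
Context {R : realType} {d : nat}.
Implicit Types (x y : 'cV[R]_d) (m : 'M[R]_d).

Lemma eucl_ge0 x : 0 <= eucl x.
Proof. exact: sqrtr_ge0. Qed.

Lemma sqr_eucl x : eucl x ^+ 2 = \sum_(i < d) x i ord0 ^+ 2.
Proof. by rewrite sqr_sqrtr// sumr_ge0// => i _; rewrite sqr_ge0. Qed.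

Lemma eucl0 : eucl (0 : 'cV[R]_d) = 0.
Proof. by rewrite /eucl big1 ?sqrtr0// => i _; rewrite mxE expr0n. Qed.

Lemma eucl_eq0 x : eucl x = 0 -> x = 0.
Proof.
move=> x0; have /eqP := sqr_eucl x; rewrite x0 expr0n/= eq_sym psumr_eq0.
  move=> /allP h; apply/matrixP => i j; rewrite ord1 mxE.
  by have := h i; rewrite mem_index_enum sqrf_eq0 => /(_ isT)/eqP.
by move=> i _; rewrite sqr_ge0.
Qed.

Lemma euclZ (k : R) x : eucl (k *: x) = `|k| * eucl x.
Proof.
rewrite /eucl -sqrtr_sqr -sqrtrM ?sqr_ge0// mulr_sumr.
by congr (Num.sqrt _); apply: eq_bigr => i _; rewrite mxE exprMn.
Qed.

Lemma euclN x : eucl (- x) = eucl x.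
Proof. by rewrite -scaleN1r euclZ normrN1 mul1r. Qed.

Lemma eucl_distC x y : eucl (x - y) = eucl (y - x).
Proof. by rewrite -euclN opprB. Qed.

Lemma eucl_cauchy_schwarz x y :
  \sum_(i < d) x i ord0 * y i ord0 <= eucl x * eucl y.
Proof.
have [x0|x0] := eqVneq (eucl x) 0.
  rewrite x0 mul0r big1// => i _; by rewrite (eucl_eq0 x0) mxE mul0r.
have [y0|y0] := eqVneq (eucl y) 0.
  rewrite y0 mulr0 big1// => i _; by rewrite (eucl_eq0 y0) mxE mulr0.
have xp : 0 < eucl x by rewrite lt_neqAle eq_sym x0 eucl_ge0.
have yp : 0 < eucl y by rewrite lt_neqAle eq_sym y0 eucl_ge0.
rewrite -[leRHS]mulr1 -ler_pdivrMl ?mulr_gt0//.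
rewrite invfM mulr_sumr.
apply: (@le_trans _ _ (\sum_(i < d) ((eucl x)^-2 * x i ord0 ^+ 2 / 2
   + (eucl y)^-2 * y i ord0 ^+ 2 / 2))).
  apply: ler_sum => i _.
  set a := x i ord0; set b := y i ord0; set u := (eucl x)^-1.
  set v := (eucl y)^-1.
  rewrite -!exprVn -/u -/v; have := sqr_ge0 (u * a - v * b); nra.
rewrite big_split/= -!mulr_suml -!mulr_sumr -!sqr_eucl.
rewrite !mulVf ?expf_neq0//; lra.
Qed.

Lemma ler_euclD x y : eucl (x + y) <= eucl x + eucl y.
Proof.
rewrite -(@ler_pXn2r _ 2)// ?nnegrE ?addr_ge0 ?eucl_ge0// sqr_eucl.
rewrite sqrrD !sqr_eucl.
have -> : \sum_(i < d) (x + y) i ord0 ^+ 2 = \sum_(i < d) x i ord0 ^+ 2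
    + (\sum_(i < d) x i ord0 * y i ord0) *+ 2 + \sum_(i < d) y i ord0 ^+ 2.
  rewrite -sumrMnl -!big_split/=; apply: eq_bigr => i _.
  by rewrite mxE sqrrD.
by rewrite lerD2r lerD2l lerMn2r eucl_cauchy_schwarz orbT.
Qed.

Lemma ler_eucl_distD (z x y : 'cV[R]_d) :
  eucl (x - y) <= eucl (x - z) + eucl (z - y).
Proof. by rewrite (le_trans _ (ler_euclD _ _))// addrA subrK. Qed.

Lemma ler_euclB x y : eucl (x - y) <= eucl x + eucl y.
Proof. by rewrite (le_trans (ler_euclD _ _))// euclN. Qed.

Lemma eucl_dist_dist x y : `|eucl x - eucl y| <= eucl (x - y).
Proof.
have h (u v : 'cV[R]_d) : eucl u <= eucl (u - v) + eucl v.
  by have := ler_euclD (u - v) v; rewrite subrK.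
by have := h x y; have := h y x; rewrite (eucl_distC y x) ler_norml; lra.
Qed.

Lemma coord_le_eucl x i : `|x i ord0| <= eucl x.
Proof.
rewrite -sqrtr_sqr ler_wsqrtr// (bigD1 i)//= lerDl sumr_ge0// => j _.
exact: sqr_ge0.
Qed.

Lemma eucl_le_sum x : eucl x <= \sum_(i < d) `|x i ord0|.
Proof.
have s0 : 0 <= \sum_(i < d) `|x i ord0| by exact: sumr_ge0.
rewrite -(@ler_pXn2r _ 2)// ?nnegrE ?eucl_ge0// sqr_eucl expr2 mulr_suml.
apply: ler_sum => i _; rewrite -[leLHS]ger0_norm ?sqr_ge0// normrX expr2.
by rewrite ler_wpM2l// (bigD1 i)//= lerDl sumr_ge0.
Qed.

Lemma norm_coord_le p q (m : 'M[R]_(p, q)) i j : `|m i j| <= `|m|.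
Proof.
rewrite [leRHS]/Num.Def.normr /= mx_normrE.
by apply/bigmax_geP; right => /=; exists (i, j).
Qed.

Lemma mx_norm_le p q (m : 'M[R]_(p, q)) (e : R) : 0 <= e ->
  (forall i j, `|m i j| <= e) -> `|m| <= e.
Proof.
move=> e0 h; rewrite [leLHS]/Num.Def.normr /= mx_normrE.
by apply/bigmax_leP; split => // -[i j] _; exact: h.
Qed.

Lemma norm_le_eucl x : `|x| <= eucl x.
Proof.
by apply: mx_norm_le => [|i j]; rewrite ?eucl_ge0// ord1 coord_le_eucl.
Qed.

Lemma eucl_le_norm x : eucl x <= d%:R * `|x|.
Proof.
rewrite (le_trans (eucl_le_sum x))//.
apply: (@le_trans _ _ (\sum_(i < d) `|x|)).
  by apply: ler_sum => i _; exact: norm_coord_le.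
by rewrite sumr_const card_ord mulr_natl.
Qed.

Lemma eucl_mul_le_sum m x :
  eucl (m *m x) <= (\sum_(i < d) \sum_(j < d) `|m i j|) * eucl x.
Proof.
rewrite (le_trans (eucl_le_sum _))// mulr_suml; apply: ler_sum => i _.
rewrite mxE (le_trans (ler_norm_sum _ _ _))// mulr_suml; apply: ler_sum => j _.
by rewrite normrM ler_wpM2l// coord_le_eucl.
Qed.

Lemma opnorm_has_ubound m :
  has_ubound [set eucl (m *m x) | x in [set x : 'cV[R]_d | eucl x = 1]].
Proof.
exists (\sum_(i < d) \sum_(j < d) `|m i j|) => _ [x /= x1 <-].
by rewrite (le_trans (eucl_mul_le_sum _ _))// x1 mulr1.
Qed.

Lemma eucl_mul m x : eucl (m *m x) <= opnorm m * eucl x.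
Proof.
have [x0|x0] := eqVneq (eucl x) 0.
  by rewrite x0 mulr0 (eucl_eq0 x0) mulmx0 eucl0.
have xp : 0 < eucl x by rewrite lt_neqAle eq_sym x0 eucl_ge0.
rewrite -ler_pdivrMr// mulrC -[X in X * _]gtr0_norm ?invr_gt0//.
rewrite -euclZ scalemxAr; apply: ub_le_sup; first exact: opnorm_has_ubound.
by exists ((eucl x)^-1 *: x) => //=; rewrite euclZ gtr0_norm ?invr_gt0// mulVf.
Qed.

Lemma opnorm_ge0 m : 0 <= opnorm m.
Proof.
have [[x x1]|] := pselect (exists x : 'cV[R]_d, eucl x = 1).
  rewrite (le_trans (eucl_ge0 (m *m x)))// (le_trans (eucl_mul m x))//.
  by rewrite x1 mulr1.
(* A unit vector is missing only for [d = 0]; the supremum of the empty set is then 0. *)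
move=> nx; rewrite /opnorm (_ : [set eucl (m *m x) | x in [set x : 'cV[R]_d | eucl x = 1]] = set0)
  ?sup0//.
by apply/seteqP; split => // y [x x1 _]; apply: nx; exists x.
Qed.

Lemma opnorm_le m (K : R) : 0 <= K ->
  (forall x, eucl (m *m x) <= K * eucl x) -> opnorm m <= K.
Proof.
move=> K0 h; have [[x x1]|nx] := pselect (exists x : 'cV[R]_d, eucl x = 1).
  apply: ge_sup; first by exists (eucl (m *m x)), x.
  by move=> _ [y /= y1 <-]; rewrite (le_trans (h y))// y1 mulr1.
rewrite /opnorm (_ : [set eucl (m *m x) | x in [set x : 'cV[R]_d | eucl x = 1]] = set0)
  ?sup0//.
by apply/seteqP; split => // y [x x1 _]; apply: nx; exists x.
Qed.

Lemma opnorm_le_norm m : opnorm m <= (d * d)%:R * `|m|.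
Proof.
rewrite (@le_trans _ _ (\sum_(i < d) \sum_(j < d) `|m i j|))//.
  apply: opnorm_le; last exact: eucl_mul_le_sum.
  by apply: sumr_ge0 => i _; apply: sumr_ge0.
apply: (@le_trans _ _ (\sum_(i < d) \sum_(j < d) `|m|)).
  by apply: ler_sum => i _; apply: ler_sum => j _; exact: norm_coord_le.
by rewrite !sumr_const card_ord -mulrnA mulr_natl.
Qed.

Lemma opnormD m m' : opnorm (m + m') <= opnorm m + opnorm m'.
Proof.
apply: opnorm_le => [|x]; first by rewrite addr_ge0 ?opnorm_ge0.
by rewrite mulmxDl (le_trans (ler_euclD _ _))// mulrDl lerD ?eucl_mul.
Qed.

Lemma opnormN m : opnorm (- m) = opnorm m.
Proof.
suff h (m' : 'M[R]_d) : opnorm (- m') <= opnorm m'.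
  by apply/eqP; rewrite eq_le h -{1}(opprK m) h.
by apply: opnorm_le => [|x]; rewrite ?opnorm_ge0// mulNmx euclN eucl_mul.
Qed.

Lemma opnorm_dist_dist m m' : `|opnorm m - opnorm m'| <= opnorm (m - m').
Proof.
have h (u v : 'M[R]_d) : opnorm u <= opnorm (u - v) + opnorm v.
  by have := opnormD (u - v) v; rewrite subrK.
have := h m m'; have := h m' m; rewrite -(opnormN (m' - m)) opprB ler_norml.
by lra.
Qed.

End euclidean_norm.

Lemma le_norm_continuous {R : realType} {V W : normedModType R} (f : V -> W)
    (K : R) : (forall x y, `|f x - f y| <= K * `|x - y|) -> continuous f.
Proof.
move=> h x; apply/cvgrPdist_lt => e e0.
have K1 : 0 < `|K| + 1 by rewrite ltr_wpDl.
near=> y.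
rewrite (le_lt_trans (h x y))//.
rewrite (@le_lt_trans _ _ ((`|K| + 1) * `|x - y|))//.
  by rewrite ler_wpM2r// (le_trans (ler_norm _))// lerDl.
rewrite -ltr_pdivlMl//.
near: y.
apply: cvgr_dist_lt; first exact: cvg_id.
by rewrite mulr_gt0// invr_gt0.
Unshelve. all: by end_near. Qed.

(** * Borel measurability of the norms and of the affine maps *)

Section borel.
Context {R : realType}.

(* Stated with a bare family [O] of open sets because products carry no
   [ptopologicalType] structure. *)
Lemma g_sigma_measurable_real (T : pointedType) (O : set (set T)) (f : T -> R) :
  (forall B, open B -> O (f @^-1` B)) ->
  measurable_fun [set: g_sigma_algebraType O] f.
Proof.
move=> cf; apply: (measurability _ (RGenOpens.measurableE R)).
move=> _ [_ [a [b ->]] <-]; rewrite setTI.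
by apply: sub_sigma_algebra; apply: cf; exact: interval_open.
Qed.

Lemma g_sigma_measurable_borel (T : pointedType) (O : set (set T))
    (T' : ptopologicalType) (f : T -> T') :
  (forall B, open B -> O (f @^-1` B)) ->
  measurable_fun [set: g_sigma_algebraType O]
    (f : _ -> g_sigma_algebraType (@open T')).
Proof.
move=> cf; apply: (@measurability _ _ (g_sigma_algebraType O)
  (g_sigma_algebraType (@open T')) setT f (@open T')) => //.
move=> _ [B oB <-]; rewrite setTI.
by apply: sub_sigma_algebra; exact: cf.
Qed.

Context {d : nat}.

Definition affine_map (x : 'cV[R]_d) (z : borelG R d) : borelRd R d :=
  z.1 *m x + z.2.

Lemma eucl_continuous : continuous (@eucl R d).
Proof.
apply: (@le_norm_continuous _ _ _ _ d%:R) => x y.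
exact: (le_trans (eucl_dist_dist _ _) (eucl_le_norm _)).
Qed.

Lemma measurable_eucl : measurable_fun [set: borelRd R d] (@eucl R d).
Proof.
by apply: g_sigma_measurable_real; move/continuousP : eucl_continuous.
Qed.

Lemma measurable_eucl_snd :
  measurable_fun [set: borelG R d] (fun z => eucl z.2).
Proof.
apply: g_sigma_measurable_real; apply/continuousP => z.
apply: (@continuous_comp _ _ _ snd (@eucl R d)); first exact: cvg_snd.
exact: eucl_continuous.
Qed.

Lemma measurable_opnorm_fst :
  measurable_fun [set: borelG R d] (fun z => opnorm z.1).
Proof.
apply: g_sigma_measurable_real; apply/continuousP => z.
apply: (@continuous_comp _ _ _ fst (@opnorm R d)); first exact: cvg_fst.
apply: (@le_norm_continuous _ _ _ _ (d * d)%:R) => x y.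
exact: (le_trans (opnorm_dist_dist _ _) (opnorm_le_norm _)).
Qed.

Lemma measurable_affine_map x : measurable_fun setT (affine_map x).
Proof.
apply: g_sigma_measurable_borel; apply/continuousP.
apply: (@le_norm_continuous R ('M[R]_d * 'cV[R]_d)%type 'cV[R]_d
  (fun z => z.1 *m x + z.2) ((d * d)%:R * eucl x + 1)) => y z /=.
rewrite opprD addrACA -mulmxBl (le_trans (ler_normD _ _))// mulrDl mul1r lerD//.
  rewrite (le_trans (norm_le_eucl _))// (le_trans (eucl_mul _ _))//.
  rewrite mulrAC ler_wpM2r ?eucl_ge0// (le_trans (opnorm_le_norm _))//.
  by rewrite ler_wpM2l// [leRHS]/Num.Def.normr/= le_max lexx.
by rewrite [leRHS]/Num.Def.normr/= le_max lexx orbT.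
Qed.

Lemma eucl_affine_map x z :
  eucl (affine_map x z) <= opnorm z.1 * eucl x + eucl z.2.
Proof. by rewrite (le_trans (ler_euclD _ _))// lerD2r eucl_mul. Qed.

Lemma eucl_affine_mapB x y z :
  eucl (affine_map x z - affine_map y z) <= opnorm z.1 * eucl (x - y).
Proof.
by rewrite /affine_map opprD addrACA subrr addr0 -mulmxBr eucl_mul.
Qed.

End borel.

(** * Meets of probability measures *)

Section meet_of_measures.
Context {disp : measure_display} {T : measurableType disp} {R : realType}.
Local Open Scope ereal_scope.

Section finite_copy.
Variables (m : {measure set T -> \bar R}) (mfin : fin_num_fun m).

(** An alias indexed by the finiteness proof, to which the bundled structure can be attached: the
    maximality clause of [is_meet] quantifies over bundled finite measures. *)
Definition finite_copy of fin_num_fun m : set T -> \bar R := m.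

Local Notation m' := (finite_copy mfin).

HB.instance Definition _ := Measure.on m'.

HB.instance Definition _ := Measure_isFinite.Build _ _ _ m' mfin.

End finite_copy.

(* [nu] on the positive part and [mu] on the negative part of a Hahn
   decomposition of [mu - nu] is a common lower bound. *)
Lemma is_meet_mass (mu nu : probability T R)
    (kappa : {finite_measure set T -> \bar R}) :
  is_meet mu nu kappa ->
  1 - kappa setT <= tv_norm (measure_diff mu nu).
Proof.
move=> [_ _ kmax]; rewrite /tv_norm.
case: cid => P exN; case: cid => N PN.
have [[mP posP] [mN negN] PNT PN0] := PN.
pose lam := measure_add (mrestr nu mP) (mrestr mu mN).
have lamE A : lam A = nu (A `&` P) + mu (A `&` N).
  by rewrite /lam /= measure_addE.
have lamfin : fin_num_fun lam.
  move=> A mA; rewrite lamE fin_numD.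
  by rewrite !fin_num_measure//; exact: measurableI.
have splitE (m : probability T R) A : measurable A ->
    m A = m (A `&` P) + m (A `&` N).
  move=> mA; rewrite -{1}(setIT A) -PNT setIUr measureU//.
  - exact: measurableI.
  - exact: measurableI.
  - by rewrite setIACA PN0 setI0.
have leP A : measurable A -> nu (A `&` P) <= mu (A `&` P).
  move=> mA; have mAP := measurableI _ _ mA mP.
  have := posP _ mAP (@subIsetr _ _ _).
  rewrite /measure_diff /cadd/= /copp/= /charge_of_finite_measure.
  by rewrite sube_ge0// fin_num_measure.
have leN A : measurable A -> mu (A `&` N) <= nu (A `&` N).
  move=> mA; have mAN := measurableI _ _ mA mN.
  have := negN _ mAN (@subIsetr _ _ _).
  rewrite /measure_diff /cadd/= /copp/= /charge_of_finite_measure.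
  by rewrite sube_le0// fin_num_measure.
have lek : nu P + mu N <= kappa setT.
  have := kmax (finite_copy lamfin) _ _ setT measurableT.
  rewrite -[X in _ -> _ -> X <= _]/(lam setT) lamE !setTI; apply => A mA.
  - rewrite -[leLHS]/(lam A) lamE -[leRHS]/(mu A) (splitE mu A mA).
    by apply: leeD => //; exact: leP.
  - rewrite -[leLHS]/(lam A) lamE -[leRHS]/(nu A) (splitE nu A mA).
    by apply: leeD => //; exact: leN.
apply: (@le_trans _ _ (mu P - nu P)).
  have mP' : mu P + mu N = 1.
    by have := splitE mu setT measurableT; rewrite probability_setT !setTI.
  (* Since [mu P + mu N = 1], the total mass splits as [1 = (mu P - nu P) + (nu P + mu N)]; the last
     sum is the mass of [lam], hence at most that of [kappa]. *)
  rewrite leeBlDr ?fin_num_measure// (@le_trans _ _ ((mu P - nu P) + (nu P + mu N)))//.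
    by rewrite addeA subeK ?fin_num_measure// mP'.
  by rewrite leeD2l.
have -> : mu P - nu P = `|measure_diff mu nu P|.
  by rewrite gee0_abs//; exact: posP.
apply: (le_trans (abse_charge_variation PN mP)).
by apply: le_measure; rewrite ?inE.
Qed.

End meet_of_measures.

(** * The saturated distance *)

Section saturated_distance.
Context {R : realType}.
Implicit Types (s t : R) (q : nat).

(** A concave power lies below its tangent at [a]; the proof is Young's inequality with exponents
    [1/s] and [1/(1-s)]. The bound is affine in [u], so integrating it plays the role of Jensen's
    inequality, even against the sub-probability [kappa]. *)
Lemma powR_le_tangent (a u s : R) : 0 < a -> 0 <= u -> 0 <= s <= 1 ->
  u `^ s <= a `^ s * (1 - s + s * (u / a)).
Proof.
move=> a0 u0 /andP[s0 s1].
have -> : u = a * (u / a) by rewrite mulrC divfK// gt_eqF.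
have v0 : 0 <= u / a by rewrite divr_ge0// ltW.
move: (u / a) v0 => v v0; rewrite mulrAC divff ?gt_eqF// mul1r.
rewrite powRM ?(ltW a0)// ler_wpM2l ?powR_ge0//.
have [->|sN0] := eqVneq s 0; first by rewrite powRr0; lra.
have [->|sN1] := eqVneq s 1; first by rewrite powRr1//; lra.
have sp : 0 < s by rewrite lt_neqAle eq_sym sN0.
have s1p : 0 < 1 - s by rewrite subr_gt0 lt_neqAle sN1.
have := @conjugate_powR R (v `^ s) 1 s^-1 (1 - s)^-1 (powR_ge0 _ _) ler01.
rewrite !invr_gt0 !invrK -powRrM mulfV// powRr1// powR1 mulr1 mul1r.
move=> /(_ sp s1p); rewrite addrCA subrr addr0 => /(_ erefl); lra.
Qed.

(** On [[0, 1]] this is the chord of the concave profile [1 - (1 + s)^-q]. Linearity there makes the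
    estimate near the diagonal homogeneous in [s]; the polynomial tail makes shrinking [s] by a
    fixed factor change [1 - satur] by a factor bounded away from 1. *)
Definition satur q s : R :=
  if s <= 1 then (1 - 2^-1 ^+ q) * s else 1 - (1 + s)^-1 ^+ q.

Lemma half_expn_le1 q : (2^-1 : R) ^+ q <= 1.
Proof. by rewrite exprn_ile1// invf_le1 ?ler1n. Qed.

Lemma inv1D_expn_le1 q s : 0 <= s -> (1 + s)^-1 ^+ q <= 1.
Proof.
by move=> s0; rewrite exprn_ile1 ?invr_ge0 ?addr_ge0// invf_le1 ?lerDl// ltr_pwDl.
Qed.

(** Convexity of [(1 + s)^-q], by induction on [q]: the product of the chords for [q] and for 1 lies
    below the chord for [q + 1]. *)
Lemma inv1D_expn_le_chord q s : 0 <= s <= 1 ->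
  (1 + s)^-1 ^+ q <= 1 - (1 - 2^-1 ^+ q) * s.
Proof.
move=> /andP[s0 s1]; have h1 : (1 + s)^-1 <= 1 - s / 2.
  by rewrite -[leLHS]mul1r ler_pdivrMr ?ltr_pwDl//; nra.
elim: q => [|q ih]; first by rewrite !expr0; lra.
rewrite exprSr (le_trans (ler_pM _ _ ih h1)) ?exprn_ge0 ?invr_ge0 ?addr_ge0//.
have := half_expn_le1 q; rewrite exprS.
set h := 2^-1 ^+ q => h_le1.
have : 0 <= (1 - h) * (s * (1 - s)) by rewrite !mulr_ge0 ?subr_ge0.
nra.
Qed.

Lemma satur_le_inv1D q s : 0 <= s -> satur q s <= 1 - (1 + s)^-1 ^+ q.
Proof.
move=> s0; rewrite /satur; case: ifPn => // s1.
by have := @inv1D_expn_le_chord q s; rewrite s0 s1 => /(_ isT); lra.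
Qed.

Lemma satur_ge0 q s : 0 <= s -> 0 <= satur q s.
Proof.
move=> s0; rewrite /satur; case: ifPn => s1.
  by rewrite mulr_ge0// subr_ge0 half_expn_le1.
by rewrite subr_ge0 inv1D_expn_le1.
Qed.

Lemma satur_le1 q s : 0 <= s -> satur q s <= 1.
Proof.
move=> s0; rewrite (le_trans (satur_le_inv1D _ s0))// gerBl exprn_ge0//.
by rewrite invr_ge0 addr_ge0.
Qed.

Lemma satur_le_id q s : 0 <= s -> satur q s <= s.
Proof.
move=> s0; rewrite /satur; case: ifPn => s1.
  by rewrite ler_piMl// gerBl exprn_ge0.
rewrite -ltNge in s1; rewrite (le_trans _ (ltW s1))// gerBl exprn_ge0//.
by rewrite invr_ge0 addr_ge0.
Qed.

Lemma satur_ge_far q s : 1 <= s -> 1 - 2^-1 ^+ q <= satur q s.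
Proof.
move=> s1; rewrite /satur; case: ifPn => s1'.
  by rewrite ler_peMr// subr_ge0 half_expn_le1.
rewrite lerD2l lerN2 lerXn2r// ?nnegrE ?invr_ge0//; first by lra.
by rewrite lef_pV2 ?posrE; lra.
Qed.

Lemma le_satur q s t : 0 <= s -> s <= t -> satur q s <= satur q t.
Proof.
move=> s0 st; have [t1|t1] := leP t 1.
  rewrite /satur t1 (le_trans st t1) ler_wpM2l// subr_ge0.
  exact: half_expn_le1.
have [s1|s1] := leP s 1.
  rewrite (le_trans _ (satur_ge_far _ (ltW t1)))// /satur s1.
  by rewrite ler_piMr// subr_ge0 half_expn_le1.
rewrite /satur [s <= 1]leNgt s1 [t <= 1]leNgt t1/= lerD2l lerN2 lerXn2r// ?nnegrE ?invr_ge0//;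
  [lra|lra|].
by rewrite lef_pV2 ?posrE; lra.
Qed.

Lemma exists_expn_lt (k e : R) : 0 <= k < 1 -> 0 < e ->
  exists q : nat, k ^+ q <= e.
Proof.
move=> /andP[k0 k1] e0.
have /cvgrPdist_le /(_ _ e0) [q _ /(_ q (leqnn q))] : k ^+ n @[n --> \oo] --> 0.
  by apply: cvg_expr; rewrite ger0_norm.
by rewrite sub0r normrN ger0_norm ?exprn_ge0// => h; exists q.
Qed.

(** The quotient [(1 + rho s) / (1 + s)] decreases in [s], so its value at [s = 1] is the worst
    one. *)
Lemma inv1D_expn_ratio (rho s : R) q : 0 <= rho <= 1 -> 1 <= s ->
  (1 + s)^-1 ^+ q <= ((1 + rho) / 2) ^+ q * (1 + rho * s)^-1 ^+ q.
Proof.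
move=> /andP[rho0 rho1] s1; have rs : 0 < 1 + rho * s by nra.
rewrite -exprMn lerXn2r// ?nnegrE.
- by rewrite invr_ge0; lra.
- by rewrite divr_ge0 ?divr_ge0 ?(ltW rs)//; lra.
rewrite ler_pdivlMr// mulrC ler_pdivrMr; last by lra.
by nra.
Qed.

(** The drift wins: for [S >= S0] the constant [1 + c] is at most half of [(1 - gam) S], so the
    drift factor is at most [(1 + gam) / 2]. The factor [g] is slightly larger, to pay for
    [1 - e >= (3 + gam) / 4]. The ratio [(1 + g t) / (1 + t)] decreases in [t], so [t = beta S0] is
    the worst case. *)
Lemma far_contraction_large (e gam c beta S0 g r S : R) :
  0 < e -> e <= (1 - gam) / 4 -> 0 < gam < 1 ->
  0 < beta -> 0 < S0 -> 2 * (1 + c) <= (1 - gam) * S0 ->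
  0 < g < 1 -> g * (3 + gam) = 2 * (1 + gam) ->
  (1 + g * (beta * S0)) / (1 + beta * S0) <= r -> S0 <= S ->
  1 - 2 * e + beta * (gam * S + (1 + c)) <= r * ((1 - e) * (1 + beta * S)).
Proof.
move=> e0 eg /andP[gam0 gam1] b0 S00 S0E /andP[g0 g1] gE r2r SS0.
have bS0 : 0 < beta * S0 by exact: mulr_gt0.
have bS : beta * S0 <= beta * S by rewrite ler_pM2l.
apply: (@le_trans _ _ ((1 - e) * (1 + g * (beta * S)))).
  have : beta * (gam * S + (1 + c)) <= (1 - e) * (g * (beta * S)).
    rewrite [leRHS](_ : _ = beta * (S * ((1 - e) * g))); last by ring.
    rewrite ler_pM2l//.
    have ge : (1 + gam) / 2 <= (1 - e) * g.
      have : (3 + gam) / 4 * g <= (1 - e) * g by rewrite ler_wpM2r ?(ltW g0)//; lra.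
      lra.
    apply: (@le_trans _ _ (S * ((1 + gam) / 2))).
      have : (1 - gam) * S0 <= (1 - gam) * S by rewrite ler_wpM2l//; lra.
      lra.
    by rewrite ler_wpM2l// ltW// (lt_le_trans S00).
  lra.
rewrite [leRHS]mulrCA ler_wpM2l//; first by lra.
apply: (@le_trans _ _ ((1 + g * (beta * S0)) / (1 + beta * S0) * (1 + beta * S))).
  rewrite mulrAC ler_pdivlMr; last by lra.
  clear -bS bS0 g0 g1; nra.
by rewrite ler_wpM2r//; lra.
Qed.

(** The overlap wins: passing from [1 - e] to [1 - 2 e] gains at least [e1], while a small [beta]
    keeps the whole weight term below [e1 / 4]. *)
Lemma far_contraction_small (e e1 gam c beta S0 r S : R) :
  0 < e1 -> e1 <= e -> e <= 1 -> 0 < gam < 1 -> 0 < beta ->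
  beta * (S0 + (1 + c)) <= e1 / 4 -> e <= 2^-1 ->
  1 - e1 / 2 <= r -> 0 <= S -> S <= S0 ->
  1 - 2 * e + beta * (gam * S + (1 + c)) <= r * ((1 - e) * (1 + beta * S)).
Proof.
move=> e10 e1e e_1 /andP[gam0 gam1] b0 bS e2 e1r S_0 SS0.
have bSS : beta * (gam * S + (1 + c)) <= e1 / 4.
  apply: le_trans bS; rewrite ler_pM2l// lerD2r.
  by rewrite (le_trans _ SS0)// ler_piMl// ltW.
apply: (@le_trans _ _ ((1 - e1 / 2) * (1 - e))).
  clear -e10 e1e bSS e2 e_1; nra.
have bS0 : 0 <= beta * S by rewrite mulr_ge0// ltW.
rewrite ler_pM//; [lra|lra|].
by rewrite ler_peMr//; lra.
Qed.

(* [q] makes the saturated profile nearly flat beyond [s = 1] and makes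
   [(1 + s)^-q] drop by the factor [delta / 2] between [rho s] and [s]; then [N]
   is chosen large and [beta] small. *)
Lemma contraction_constants (rho gam delta c sl p : R) :
  0 < rho < 1 -> 0 < gam < 1 -> 0 < delta <= 1 -> 0 <= c -> 0 <= sl -> 0 <= p ->
  exists q (N beta r : R), [/\ 1 <= N, 0 < beta <= 1, 0 < r < 1 & [/\
    2^-1 ^+ q < (1 : R),
    rho + 2 * beta * (1 + c) + 3 * (1 + c) * sl / N <= r * (1 - 2^-1 ^+ q) &
    forall s S : R, 1 < s -> 0 <= S -> s <= N * (S ^+ 2) `^ p ->
      1 - delta * (1 + rho * s)^-1 ^+ q + beta * (gam * S + (1 + c)) <=
      r * (satur q s * (1 + beta * S))]].
Proof.
move=> rho01 gam01 /andP[delta0 delta1] c0 sl0 p0.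
have /andP[rho0 rho1] := rho01; have /andP[gam0 gam1] := gam01.
(* The three bounds serve, in this order, the drop beyond [s = 1], the slack in the case of a large
   weight, and the slack near the diagonal. *)
have [q [qd qg qr]] : exists q : nat, [/\ ((1 + rho) / 2) ^+ q <= delta / 2,
    2^-1 ^+ q <= (1 - gam) / 4 & 2^-1 ^+ q <= (1 - rho) / 4].
  pose m := Num.min (delta / 2) (Num.min ((1 - gam) / 4) ((1 - rho) / 4)).
  have m0 : 0 < m by rewrite !lt_min !divr_gt0 ?subr_gt0.
  have [q qm] : exists q : nat, ((1 + rho) / 2) ^+ q <= m.
    by apply: exists_expn_lt => //; lra.
  have hq : 2^-1 ^+ q <= ((1 + rho) / 2) ^+ q.
    by rewrite lerXn2r// ?nnegrE//; lra.
  exists q; split; rewrite ?(le_trans qm) ?(le_trans (le_trans hq qm))// /m.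
  - by rewrite ge_min lexx.
  - by rewrite !ge_min lexx orbT.
  - by rewrite !ge_min lexx !orbT.
have h0 : 0 < (2^-1 : R) ^+ q by rewrite exprn_gt0.
(* Near the diagonal the slack [1 - rho] is shared out: at most an eighth each for the terms with
   [N] and with [beta], at most a quarter each for [1 - r] and for [2^-q]. *)
have [N N1 Nb] : exists2 N, 1 <= N & 3 * (1 + c) * sl / N <= (1 - rho) / 8.
  have N1 : 1 <= 24 * (1 + c) * sl / (1 - rho) + 1.
    by rewrite lerDr divr_ge0 ?subr_ge0 ?(ltW rho1)// !mulr_ge0// addr_ge0.
  exists (24 * (1 + c) * sl / (1 - rho) + 1) => //.
  rewrite ler_pdivrMr; last exact: lt_le_trans N1.
  rewrite [leRHS](_ : _ = 3 * (1 + c) * sl + (1 - rho) / 8).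
    by rewrite lerDl; lra.
  by field; rewrite subr_eq0 gt_eqF.
have N0 : 0 < N by exact: lt_le_trans N1.
have [S0 S00 S0E] : exists2 S0, 0 < S0 & 2 * (1 + c) <= (1 - gam) * S0.
  exists (2 * (1 + c) / (1 - gam) + 1).
    by rewrite ltr_wpDl// divr_ge0 ?subr_ge0 ?(ltW gam1)// mulr_ge0// addr_ge0.
  rewrite [leRHS](_ : _ = 2 * (1 + c) + (1 - gam)); first by lra.
  by field; rewrite subr_eq0 gt_eqF.
have sm0 : 0 <= N * (S0 ^+ 2) `^ p by rewrite mulr_ge0 ?powR_ge0// ltW.
(* While [S <= S0], the constraint [s <= N (S^2)^p] bounds [s], so [e1] is a lower bound for
   [(1 + s)^-q]. It depends on [q] and [N] but not on [beta], which may therefore be chosen small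
   compared with it. *)
have [e1 e1E] : exists e1, e1 = (1 + N * (S0 ^+ 2) `^ p)^-1 ^+ q by eexists.
have e10 : 0 < e1 by rewrite e1E exprn_gt0// invr_gt0; lra.
have e11 : e1 <= 1 by rewrite e1E; exact: inv1D_expn_le1.
have [beta [b0 b1 bS bc]] : exists beta, [/\ 0 < beta, beta <= 1,
    beta * (S0 + (1 + c)) <= e1 / 4 & 2 * beta * (1 + c) <= (1 - rho) / 8].
  pose k := Num.min e1 (1 - rho).
  have k0 : 0 < k by rewrite lt_min e10 subr_gt0.
  have ke : k <= e1 by rewrite ge_min lexx.
  have kr : k <= 1 - rho by rewrite ge_min lexx orbT.
  clearbody k; clear - k0 ke kr c0 S00 e11.
  (* The weight 17 is 1 + 16: one [1 + c] for the bound involving [S0], sixteen for the bound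
     [(1 - rho) / 8]. *)
  have M0 : 0 < S0 + 17 * (1 + c) by lra.
  have bM : k / (4 * (S0 + 17 * (1 + c))) * (S0 + 17 * (1 + c)) = k / 4.
    by field; rewrite gt_eqF.
  have b0 : 0 < k / (4 * (S0 + 17 * (1 + c))) by rewrite divr_gt0// mulr_gt0.
  have b1 : k / (4 * (S0 + 17 * (1 + c))) <= 1.
    by rewrite ler_pdivrMr ?mulr_gt0//; lra.
  set b := k / (4 * (S0 + 17 * (1 + c))) in bM b0 b1.
  exists b; clearbody b.
  have bc : 0 <= b * c := mulr_ge0 (ltW b0) c0.
  have bS : 0 <= b * S0 := mulr_ge0 (ltW b0) (ltW S00).
  by split => //; lra.
have [g g01 gE] : exists2 g, 0 < g < 1 & g * (3 + gam) = 2 * (1 + gam).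
  exists (2 * (1 + gam) / (3 + gam)); last by rewrite divfK// gt_eqF//; lra.
  by rewrite divr_gt0 ?ltr_pdivrMr//; lra.
pose r2 := (1 + g * (beta * S0)) / (1 + beta * S0).
have bS0 : 0 < beta * S0 by rewrite mulr_gt0.
have [r20 r21] : 0 < r2 /\ r2 < 1.
  move/andP : g01 => [g0 g1]; rewrite /r2 ltr_pdivrMr; last by lra.
  rewrite mul1r ltrD2l gtr_pMl//; split => //.
  by rewrite divr_gt0// ltr_wpDl// ?mulr_gt0// ltW.
(* The three rates belong to the regimes [s <= 1], [s > 1] with [S <= S0], and [s > 1] with
   [S >= S0]. *)
pose r := Num.max (1 - (1 - rho) / 4) (Num.max (1 - e1 / 2) r2).
have r_1 : 1 - (1 - rho) / 4 <= r by rewrite le_max lexx.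
have r_2 : 1 - e1 / 2 <= r by rewrite !le_max lexx orbT.
have r_3 : r2 <= r by rewrite !le_max lexx !orbT.
have r0 : 0 < r by rewrite (lt_le_trans r20).
exists q, N, beta, r; split => //.
- by rewrite b0 b1.
- by rewrite r0 !gt_max r21 !gtrBl !divr_gt0// subr_gt0.
have h1 : (2^-1 : R) ^+ q < 1 by rewrite (le_lt_trans qr)//; lra.
split => //.
  apply: (@le_trans _ _ ((1 - (1 - rho) / 4) * (1 - 2^-1 ^+ q))).
    by clear - bc Nb qr rho0 rho1 h0; nra.
  by rewrite ler_wpM2r// subr_ge0 ltW.
move=> s S s1 S_0 sS.
have -> : satur q s = 1 - (1 + s)^-1 ^+ q by rewrite /satur leNgt s1.
have s0 : 0 < 1 + s by rewrite addr_gt0// (lt_trans _ s1).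
have eh : (1 + s)^-1 ^+ q <= 2^-1 ^+ q.
  rewrite lerXn2r// ?nnegrE ?invr_ge0 ?(ltW s0)//.
  by rewrite lef_pV2 ?posrE// lerD2l ltW.
have e0 : 0 < (1 + s)^-1 ^+ q by rewrite exprn_gt0// invr_gt0.
have ed : 2 * (1 + s)^-1 ^+ q <= delta * (1 + rho * s)^-1 ^+ q.
  have h : (1 + s)^-1 ^+ q <= ((1 + rho) / 2) ^+ q * (1 + rho * s)^-1 ^+ q.
    by apply: inv1D_expn_ratio; [rewrite !ltW|exact: ltW].
  have rs0 : 0 <= (1 + rho * s)^-1 ^+ q.
    rewrite exprn_ge0// invr_ge0 addr_ge0// mulr_ge0 ?(ltW rho0)//.
    by rewrite (le_trans _ (ltW s1)).
  have := ler_wpM2r rs0 qd; lra.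
apply: (@le_trans _ _ (1 - 2 * (1 + s)^-1 ^+ q + beta * (gam * S + (1 + c)))).
  by rewrite lerD2r lerD2l lerN2.
have [SS0|/ltW SS0] := leP S0 S.
  by apply: (@far_contraction_large _ _ _ _ S0 g) => //; exact: le_trans qg.
apply: (@far_contraction_small _ e1 _ _ _ S0) => //.
- rewrite e1E lerXn2r// ?nnegrE ?invr_ge0 ?(ltW s0)//.
    by rewrite addr_ge0.
  rewrite lef_pV2 ?posrE// ?ltr_wpDr// lerD2l (le_trans sS)//.
  rewrite ler_wpM2l ?(ltW N0)// ge0_ler_powR// ?nnegrE ?sqr_ge0//.
  by rewrite lerXn2r ?nnegrE// ltW.
- by rewrite inv1D_expn_le1// (le_trans _ (ltW s1)).
- by rewrite (le_trans eh)// (le_trans qg)//; lra.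
Qed.

End saturated_distance.

(** * Contraction along the meet *)

Section coupling.
Context {disp : measure_display} {T : measurableType disp} {R : realType}.
Implicit Types (f g : T -> R).

Section dominated_measure.
Variables (kappa mu : {finite_measure set T -> \bar R}).
Hypothesis kmu : measure_le kappa mu.

Lemma le_measure_integrable f :
  mu.-integrable setT (EFin \o f) -> kappa.-integrable setT (EFin \o f).
Proof.
move=> /integrableP[mf fi]; apply/integrableP; split => //.
apply: le_lt_trans fi; apply: ge0_le_measure_integral => //.
exact: measurableT_comp.
Qed.

Lemma le_measure_Rintegral f : mu.-integrable setT (EFin \o f) ->
  (forall z, 0 <= f z) ->
  \int[kappa]_z f z <= \int[mu]_z f z.
Proof.
move=> fi f0; have fk := le_measure_integrable fi.
rewrite /Rintegral fine_le//; [exact: integrable_fin_num..|].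
by apply: ge0_le_measure_integral => //; exact: measurable_int fi.
Qed.

(** The excess of [mu] over [kappa] is a positive functional: apply [le_measure_Rintegral] to
    [g - f]. It stands in for integration against the residual measure [mu - kappa]. *)
Lemma le_Rintegral_excess f g :
  mu.-integrable setT (EFin \o f) -> mu.-integrable setT (EFin \o g) ->
  (forall z, f z <= g z) ->
  \int[mu]_z f z - \int[kappa]_z f z <= \int[mu]_z g z - \int[kappa]_z g z.
Proof.
move=> fi gi fg.
have fk := le_measure_integrable fi; have gk := le_measure_integrable gi.
have gfi : mu.-integrable setT (EFin \o (fun z => g z - f z)).
  by rewrite (_ : _ \o _ = ((EFin \o g) \- (EFin \o f))%E)//; exact: integrableB.
have := le_measure_Rintegral gfi.
rewrite !RintegralB// => /(_ _)/wrap[z|]; first by rewrite subr_ge0.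
lra.
Qed.

End dominated_measure.

(** On [kappa] the two integrands are compared pointwise; outside it each is compared with the
    constant [c0]. Both residuals have the same mass, because [mu] and [nu] are probabilities, so
    the contributions of [c0] cancel. *)
Lemma coupling_bound (mu nu : probability T R)
    (kappa : {finite_measure set T -> \bar R}) (f g h a b : T -> R) (c0 : R) :
  measure_le kappa mu -> measure_le kappa nu ->
  mu.-integrable setT (EFin \o f) -> nu.-integrable setT (EFin \o g) ->
  kappa.-integrable setT (EFin \o h) ->
  mu.-integrable setT (EFin \o a) -> nu.-integrable setT (EFin \o b) ->
  (forall z, `|f z - g z| <= h z) ->
  (forall z, `|f z - c0| <= a z) -> (forall z, `|g z - c0| <= b z) ->
  `|\int[mu]_z f z - \int[nu]_z g z| <=
    \int[kappa]_z h z + (\int[mu]_z a z - \int[kappa]_z a z)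
                      + (\int[nu]_z b z - \int[kappa]_z b z).
Proof.
move=> kmu knu fi gi hi ai bi fgh fa gb.
have fk := le_measure_integrable kmu fi.
have gk := le_measure_integrable knu gi.
have fgk : kappa.-integrable setT (EFin \o (fun z => f z - g z)).
  by rewrite (_ : _ \o _ = ((EFin \o f) \- (EFin \o g))%E)//; exact: integrableB.
have cst_int (m : {finite_measure set T -> \bar R}) (c : R) :
    m.-integrable setT (EFin \o cst c).
  by apply: finite_measure_integrable_cst.
have excess_norm (m : probability T R) u v : measure_le kappa m ->
    m.-integrable setT (EFin \o u) -> m.-integrable setT (EFin \o v) ->
    (forall z, `|u z - c0| <= v z) ->
    `|\int[m]_z u z - \int[kappa]_z u z
      - (c0 - \int[kappa]_z (cst c0) z)| <= \int[m]_z v z - \int[kappa]_z v z.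
  move=> km ui vi uv; have uk := le_measure_integrable km ui.
  have vk := le_measure_integrable km vi.
  have uci : m.-integrable setT (EFin \o (fun z => u z - c0)).
    rewrite (_ : _ \o _ = ((EFin \o u) \- (EFin \o cst c0))%E)//.
    by apply: integrableB => //; exact: cst_int.
  have nuci : m.-integrable setT (EFin \o (fun z => - v z)).
    by rewrite (_ : _ \o _ = (\- (EFin \o v))%E)//; exact: integrableN.
  have C1 : \int[m]_z (cst c0 z) = c0.
    have := @Rintegral_cst _ _ _ m setT measurableT c0.
    rewrite [X in _ = _ * fine X](_ : _ = 1%E) ?mulr1//.
    exact: probability_setT.
  have E1 : \int[m]_z (u z - c0) = \int[m]_z u z - c0.
    rewrite -[in RHS]C1.
    by apply: (@RintegralB _ _ _ m setT u (cst c0)) => //; exact: cst_int.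
  have E2 : \int[kappa]_z (u z - c0) = \int[kappa]_z u z - \int[kappa]_z (cst c0) z.
    by apply: (@RintegralB _ _ _ kappa setT u (cst c0)) => //; exact: cst_int.
  have N1 (m' : {finite_measure set T -> \bar R}) :
      m'.-integrable setT (EFin \o v) ->
      \int[m']_z (- v z) = - \int[m']_z v z.
    move=> vi'; under eq_Rintegral do rewrite -mulN1r.
    by rewrite RintegralZl// mulN1r.
  have := le_Rintegral_excess km uci vi (fun z => le_trans (ler_norm _) (uv z)).
  have := le_Rintegral_excess km nuci uci.
  rewrite E1 E2 !N1// => /(_ _)/wrap[z|].
    by have := uv z; rewrite ler_norml => /andP[].
  by move=> h1 h2; rewrite ler_norml; lra.
have := excess_norm _ _ _ kmu fi ai fa.
have := excess_norm _ _ _ knu gi bi gb.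
have : `|\int[kappa]_z (f z - g z)| <= \int[kappa]_z h z.
  rewrite (le_trans (le_normr_Rintegral _ fgk))//.
  by apply: le_Rintegral => //; exact: integrable_norm.
rewrite RintegralB// !ler_norml; lra.
Qed.

End coupling.

(** * Inequalities for the square root weight *)

Section root_weight.
Context {R : realType}.

Lemma ler_sqrtD (a b : R) : 0 <= a -> 0 <= b ->
  Num.sqrt (a + b) <= Num.sqrt a + Num.sqrt b.
Proof.
move=> a0 b0; rewrite -(@ler_pXn2r _ 2)// ?nnegrE ?addr_ge0 ?sqrtr_ge0//.
by rewrite sqrrD !sqr_sqrtr ?addr_ge0// addrAC lerDl mulrn_wge0 ?mulr_ge0.
Qed.

Lemma sqrtr_le_young (lam a : R) : 0 < lam -> 0 <= a ->
  Num.sqrt a <= (lam + a / lam) / 2.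
Proof.
move=> lam0 a0; rewrite -{2}(sqr_sqrtr a0).
have := sqrtr_ge0 a; move: (Num.sqrt a) => v v0.
rewrite ler_pdivlMr// -(ler_pM2r lam0) mulrDl divfK ?gt_eqF//.
by have := sqr_ge0 (lam - v); nra.
Qed.

(** Here [u] stands for [||m||], [w] for [|q|] and [S] for the sum of the two root norms; the left
    side is the new cost in units of [s]. The condition [p <= 1/2] is what allows a tangent for
    [u^p sqrt u = u^(p + 1/2)]. *)
Lemma sync_pointwise_bound (p a beta S u w : R) : 0 < a -> 0 < p <= 2^-1 ->
  0 <= beta -> 0 <= S -> 0 <= u -> 0 <= w ->
  u `^ p * (1 + beta * (Num.sqrt u * S + 2 * Num.sqrt w)) <=
    a `^ p * (1 - p + p * (u / a))
    + beta * S * (a `^ (p + 2^-1) * (1 - (p + 2^-1) + (p + 2^-1) * (u / a)))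
    + beta * (1 + u + w).
Proof.
move=> a0 /andP[p0 p1] b0 S0 u0 w0.
have h1 : u `^ p <= a `^ p * (1 - p + p * (u / a)).
  by apply: powR_le_tangent => //; rewrite (ltW p0); lra.
have h2 : u `^ p * Num.sqrt u <=
    a `^ (p + 2^-1) * (1 - (p + 2^-1) + (p + 2^-1) * (u / a)).
  rewrite -powR12_sqrt// -powRD; last first.
    by apply/implyP => /eqP; lra.
  by apply: powR_le_tangent => //; lra.
have h3 : 2 * (u `^ p * Num.sqrt w) <= 1 + u + w.
  have h : (u `^ p) ^+ 2 <= 1 + u.
    rewrite -powR_mulrn ?powR_ge0// -powRrM.
    have := @powR_le_tangent R 1 u (p * 2) ltr01 u0; rewrite powR1 mul1r divr1.
    by move=> /(_ _)/wrap[|]; first lra; nra.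
  rewrite -{2}(sqr_sqrtr w0); have := sqr_ge0 (u `^ p - Num.sqrt w).
  by move: h; rewrite !expr2; lra.
rewrite (_ : _ * _ = u `^ p + beta * S * (u `^ p * Num.sqrt u)
  + beta * (2 * (u `^ p * Num.sqrt w))); last by ring.
by rewrite !lerD// ler_wpM2l// mulr_ge0.
Qed.

(* The residual part of the coupling, with the Young parameter
   [lam = (1 + v) / tau]. *)
Lemma residual_bound (beta v c a tau m : R) : 0 <= beta -> 0 <= v -> 0 <= c ->
  0 < a < 1 -> 0 < tau -> 0 <= m -> m <= 1 -> m <= tau ^+ 2 ->
  let lam := (1 + v) / tau in
  (2^-1 + beta * lam / 2) * m + beta * v ^+ 2 / (2 * lam) * a
    + beta / (2 * lam) * c <= tau * (2^-1 + beta * (1 + c) * (1 + v)).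
Proof.
move=> b0 v0 c0 /andP[a0 a1] tau0 m0 m1 mtau /=; set lam := (1 + v) / tau.
have lam0 : 0 < lam by rewrite divr_gt0// ltr_pwDl.
have mt : m <= tau.
  have [t1|t1] := leP tau 1; last by rewrite (le_trans m1)// ltW.
  by rewrite (le_trans mtau)// expr2 ler_piMl// ltW.
(* This is where [m <= tau^2] enters: with this [lam] the mass term becomes linear in [tau], and the
   moment terms divided by [lam] are linear in [tau] as well. *)
have lamm : lam * m <= (1 + v) * tau.
  rewrite (le_trans (ler_wpM2l (ltW lam0) mtau))// /lam expr2 mulrA divfK//.
  by rewrite gt_eqF.
have v1 : 0 < 1 + v by rewrite ltr_pwDl.
have li : lam^-1 = tau / (1 + v) by rewrite /lam invf_div.
have e2 : (v ^+ 2 * a + c) / lam <= tau * (1 + c) * (1 + v).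
  rewrite li mulrA mulrAC mulrC [leRHS](_ : _ = tau * ((1 + c) * (1 + v))); last by ring.
  rewrite [leLHS](_ : _ = tau * ((v ^+ 2 * a + c) / (1 + v))); last by ring.
  rewrite ler_pM2l// ler_pdivrMr//.
  have : v ^+ 2 * a <= v ^+ 2 by rewrite ler_piMr ?sqr_ge0// ltW.
  have := mulr_ge0 c0 v0; have := mulr_ge0 c0 (sqr_ge0 v); nra.
have -> : (2^-1 + beta * lam / 2) * m + beta * v ^+ 2 / (2 * lam) * a
    + beta / (2 * lam) * c = m / 2 + beta * (lam * m / 2
    + (v ^+ 2 * a + c) / lam / 2) by field; rewrite gt_eqF.
have : beta * (lam * m / 2 + (v ^+ 2 * a + c) / lam / 2) <=
    beta * ((1 + v) * tau / 2 + tau * (1 + c) * (1 + v) / 2).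
  by rewrite ler_wpM2l//; lra.
have : 0 <= beta * ((1 + v) * tau * c).
  by rewrite !mulr_ge0// ?(ltW v1)// ltW.
lra.
Qed.

End root_weight.

(** * Integrals of affine combinations of the two norms *)

Section contraction.
Context {R : realType} {d : nat}.
Variables (mu : 'cV[R]_d -> probability (borelG R d) R).
Variables (a c l p delta : R).
Hypotheses (a01 : 0 < a < 1) (c0 : 0 <= c) (l0 : 0 < l) (p01 : 0 < p <= 2^-1).
Hypothesis opnorm_mean : forall x, (\int[mu x]_z (opnorm z.1)%:E <= a%:E)%E.
Hypothesis shift_mean : forall x, (\int[mu x]_z (eucl z.2)%:E <= c%:E)%E.

Definition lin_norm (z : borelG R d) : R := opnorm z.1.

Definition shift_norm (z : borelG R d) : R := eucl z.2.

(** The common shape of the dominating functions in the coupling estimates: its integral against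
    [mu x] is controlled by the two means alone. *)
Definition affine_comb (k0 k1 k2 : R) (z : borelG R d) : R :=
  k0 + k1 * lin_norm z + k2 * shift_norm z.

Definition root_norm (x : 'cV[R]_d) : R := Num.sqrt (eucl x).

Lemma root_norm_affine_map x z :
  root_norm (affine_map x z) <=
    Num.sqrt (lin_norm z) * root_norm x + Num.sqrt (shift_norm z).
Proof.
rewrite /root_norm -sqrtrM ?opnorm_ge0//.
apply: le_trans (ler_sqrtD _ _); rewrite ?mulr_ge0 ?eucl_ge0 ?opnorm_ge0//.
by rewrite ler_wsqrtr// eucl_affine_map.
Qed.

Lemma opnorm_integrable x :
  (mu x).-integrable setT (EFin \o lin_norm).
Proof.
apply/integrableP; split.
  by apply/measurable_EFinP; exact: measurable_opnorm_fst.
under eq_integral do rewrite /= ger0_norm ?opnorm_ge0//.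
by rewrite (le_lt_trans (opnorm_mean x))// ltry.
Qed.

Lemma shift_integrable x :
  (mu x).-integrable setT (EFin \o shift_norm).
Proof.
apply/integrableP; split.
  by apply/measurable_EFinP; exact: measurable_eucl_snd.
under eq_integral do rewrite /= ger0_norm ?eucl_ge0//.
by rewrite (le_lt_trans (shift_mean x))// ltry.
Qed.

Lemma affine_comb_integrable x k0 k1 k2 :
  (mu x).-integrable setT (EFin \o affine_comb k0 k1 k2).
Proof.
rewrite (_ : _ \o _ = ((EFin \o cst k0) \+ (fun z => k1%:E * (lin_norm z)%:E)
  \+ (fun z => k2%:E * (shift_norm z)%:E))%E)//.
apply: integrableD => //; last first.
  by apply: integrableZl => //; exact: shift_integrable.
apply: integrableD => //; first exact: finite_measure_integrable_cst.
by apply: integrableZl => //; exact: opnorm_integrable.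
Qed.

Lemma Rintegral_affine_comb (m : {finite_measure set (borelG R d) -> \bar R}) k0 k1 k2 :
  m.-integrable setT (EFin \o lin_norm) ->
  m.-integrable setT (EFin \o shift_norm) ->
  \int[m]_z affine_comb k0 k1 k2 z =
    k0 * fine (m setT) + k1 * \int[m]_z lin_norm z + k2 * \int[m]_z shift_norm z.
Proof.
move=> iu iw.
have i0 : m.-integrable setT (EFin \o cst k0) by exact: finite_measure_integrable_cst.
have i1 : m.-integrable setT (EFin \o (fun z => k1 * lin_norm z)).
  by rewrite (_ : _ \o _ = (fun z => (k1%:E * (lin_norm z)%:E)%E))//; exact: integrableZl.
have i2 : m.-integrable setT (EFin \o (fun z => k2 * shift_norm z)).
  by rewrite (_ : _ \o _ = (fun z => (k2%:E * (shift_norm z)%:E)%E))//; exact: integrableZl.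
have i01 : m.-integrable setT (EFin \o (fun z => k0 + k1 * lin_norm z)).
  exact: (integrableD measurableT i0 i1).
rewrite /affine_comb RintegralD// (@RintegralD _ _ _ m setT (cst k0))//.
by rewrite Rintegral_cst// !RintegralZl.
Qed.

Lemma Rintegral_opnorm_le x : \int[mu x]_z lin_norm z <= a.
Proof.
rewrite -lee_fin fineK ?opnorm_mean//.
exact: integrable_fin_num (opnorm_integrable x).
Qed.

Lemma Rintegral_shift_le x : \int[mu x]_z shift_norm z <= c.
Proof.
rewrite -lee_fin fineK ?shift_mean//.
exact: integrable_fin_num (shift_integrable x).
Qed.

End contraction.

(** The intervals with centre [f u] and radius [A u] meet pairwise, hence have a common point: the
    supremum of their left endpoints. *)
Lemma exists_center {R : realType} {T : Type} (f A : T -> R) (t0 : T) :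
  (forall u v, `|f u - f v| <= A u + A v) ->
  exists c, forall u, `|f u - c| <= A u.
Proof.
move=> h; pose E := range (fun u => f u - A u).
have ub v : ubound E (f v + A v).
  move=> _ [u _ <-]; have := h u v; rewrite ler_norml => /andP[_]; lra.
exists (sup E) => u; rewrite ler_norml; apply/andP; split.
  have : sup E <= f u + A u.
    by apply: ge_sup; [exists (f t0 - A t0), t0|exact: ub].
  lra.
have : f u - A u <= sup E.
  by apply: ub_le_sup; [exists (f t0 + A t0); exact: ub|exists u].
lra.
Qed.

Lemma bounded_funP {R : realType} {T : Type} (f : T -> R) :
  bounded_fun f <-> exists K, forall x, `|f x| <= K.
Proof.
split=> [[M [Mr h]]|[K h]].
  by exists (M + 1) => x; apply: h => //; rewrite ltrDl.
by exists K; split; [exact: num_real|move=> z /ltW Kz x _; exact: le_trans Kz].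
Qed.

Lemma Bb_integrable {R : realType} {d : nat} {disp} {T : measurableType disp}
    (m : {finite_measure set T -> \bar R}) (f : borelRd R d -> R)
    (g : T -> borelRd R d) :
  Bb f -> measurable_fun setT g -> m.-integrable setT (EFin \o (f \o g)).
Proof.
move=> [mf [M [Mr bf]]] mg; apply: measurable_bounded_integrable => //.
- by rewrite -ge0_fin_numE// fin_num_measure.
- exact: measurableT_comp.
- by exists M; split => // y My z _; exact: bf.
Qed.

(** The residual bounds at the two points add up to the left side times [tau]; this is the origin of
    the constant [3 (1 + c)] in the condition on [N]. *)
Lemma sync_residual_constant {R : realType} (beta c S : R) :
  0 <= c -> beta <= 1 -> 0 <= beta * S ->
  1 + beta * (1 + c) * (2 + S) <= 3 * (1 + c) * (1 + beta * S).
Proof.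
move=> c0 b1 bS; have := mulr_ge0 c0 bS.
have : beta * c <= c by rewrite ler_piMl.
lra.
Qed.

(** * One-step contraction of the cost *)

Section contraction_step.
Context {R : realType} {d : nat}.
Variables (mu : 'cV[R]_d -> probability (borelG R d) R).
Variables (a c l p delta : R).
Hypotheses (a01 : 0 < a < 1) (c0 : 0 <= c) (l0 : 0 < l) (p01 : 0 < p <= 2^-1).
Hypothesis opnorm_mean : forall x, (\int[mu x]_z (opnorm z.1)%:E <= a%:E)%E.
Hypothesis shift_mean : forall x, (\int[mu x]_z (eucl z.2)%:E <= c%:E)%E.
Hypothesis overlap : forall x y : 'cV[R]_d,
  exists kappa : {finite_measure set (borelG R d) -> \bar R},
    [/\ measure_le kappa (mu x), measure_le kappa (mu y),
        1 - fine (kappa setT) <= l * eucl (x - y) `^ (p * 2) &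
        delta <= fine (kappa [set z | opnorm z.1 <= a])].
Variables (q : nat) (N beta r : R).
Hypotheses (N0 : 0 < N) (beta01 : 0 < beta <= 1) (r01 : 0 < r < 1).
Hypothesis near_cond :
  a `^ p + 2 * beta * (1 + c) + 3 * (1 + c) * Num.sqrt l / N <=
    r * (1 - 2^-1 ^+ q).
Hypothesis far_cond : forall s S : R, 1 < s -> 0 <= S -> s <= N * (S ^+ 2) `^ p ->
  1 - delta * (1 + a `^ p * s)^-1 ^+ q + beta * (Num.sqrt a * S + (1 + c)) <=
    r * (satur q s * (1 + beta * S)).

Definition cost (x y : 'cV[R]_d) : R :=
  satur q (N * eucl (x - y) `^ p) * (1 + beta * (root_norm x + root_norm y)).

Let a0 : 0 < a. Proof. by have /andP[] := a01. Qed.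
Let p0 : 0 < p. Proof. by have /andP[] := p01. Qed.
Let b0 : 0 < beta. Proof. by have /andP[] := beta01. Qed.

Let root_norm_ge0 (x : 'cV[R]_d) : 0 <= root_norm x.
Proof. exact: sqrtr_ge0. Qed.

Let scale_ge0 (x y : 'cV[R]_d) : 0 <= N * eucl (x - y) `^ p.
Proof. by rewrite mulr_ge0 ?powR_ge0// ltW. Qed.

Let weight_ge1 (x y : 'cV[R]_d) : 1 <= 1 + beta * (root_norm x + root_norm y).
Proof. by rewrite lerDl mulr_ge0 ?addr_ge0// ltW. Qed.

Lemma cost_ge0 x y : 0 <= cost x y.
Proof. by rewrite mulr_ge0 ?satur_ge0// (le_trans _ (weight_ge1 x y)). Qed.

Lemma cost_le x y :
  cost x y <= (2^-1 + beta * root_norm x) + (2^-1 + beta * root_norm y).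
Proof.
apply: (@le_trans _ _ (1 + beta * (root_norm x + root_norm y))); last by lra.
by rewrite ler_piMl ?satur_le1// (le_trans _ (weight_ge1 x y)).
Qed.

Section fixed_pair.
Variables (f : borelRd R d -> R) (x y : 'cV[R]_d) (cf : R).
Variable kappa : {finite_measure set (borelG R d) -> \bar R}.
Hypotheses (kx : measure_le kappa (mu x)) (ky : measure_le kappa (mu y)).
Hypothesis kmass : 1 - fine (kappa setT) <= l * eucl (x - y) `^ (p * 2).
Hypothesis kgood : delta <= fine (kappa [set z | opnorm z.1 <= a]).
Hypothesis bf : Bb f.
Hypothesis fcost : forall u v, `|f u - f v| <= cost u v.
Hypothesis fcf : forall u, `|f u - cf| <= 2^-1 + beta * root_norm u.

Let V := root_norm x.
Let W := root_norm y.
Let V0 : 0 <= V. Proof. exact: root_norm_ge0. Qed.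
Let W0 : 0 <= W. Proof. exact: root_norm_ge0. Qed.

Let kT1 : 0 <= fine (kappa setT) <= 1.
Proof.
rewrite fine_ge0//= -lee_fin fineK ?fin_num_measure//.
have := kx measurableT.
by rewrite [X in (_ <= X)%E](_ : _ = 1%E)//; exact: probability_setT.
Qed.

Let fineP1 w : fine (mu w setT) = 1.
Proof. by rewrite [X in fine X](_ : _ = 1%E)//; exact: probability_setT. Qed.

Let kU : kappa.-integrable setT (EFin \o @lin_norm R d).
Proof. exact: (le_measure_integrable kx (opnorm_integrable opnorm_mean x)). Qed.

Let kW : kappa.-integrable setT (EFin \o @shift_norm R d).
Proof. exact: (le_measure_integrable kx (shift_integrable shift_mean x)). Qed.

Let aff_int w k0 k1 k2 : (mu w).-integrable setT (EFin \o affine_comb k0 k1 k2).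
Proof. exact: (affine_comb_integrable opnorm_mean shift_mean). Qed.

Let Uk0 : 0 <= \int[kappa]_z lin_norm z.
Proof. by apply: Rintegral_ge0 => z _; exact: opnorm_ge0. Qed.

Let Wk0 : 0 <= \int[kappa]_z shift_norm z.
Proof. by apply: Rintegral_ge0 => z _; exact: eucl_ge0. Qed.

Let Uka : \int[kappa]_z lin_norm z <= a.
Proof.
apply: le_trans (Rintegral_opnorm_le opnorm_mean x).
apply: le_measure_Rintegral => //; first exact: (opnorm_integrable opnorm_mean).
by move=> z; exact: opnorm_ge0.
Qed.

Let Wkc : \int[kappa]_z shift_norm z <= c.
Proof.
apply: le_trans (Rintegral_shift_le shift_mean x).
apply: le_measure_Rintegral => //; first exact: (shift_integrable shift_mean).
by move=> z; exact: eucl_ge0.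
Qed.

(** Only the constant term keeps the small residual mass. For the two norms the [kappa] integrals
    are discarded and the full means bounded by [a] and [c], so smallness of these terms has to come
    from their coefficients. *)
Let excess_affine w (k0 k1 k2 : R) : 0 <= k0 -> 0 <= k1 -> 0 <= k2 ->
  \int[mu w]_z affine_comb k0 k1 k2 z - \int[kappa]_z affine_comb k0 k1 k2 z
    <= k0 * (1 - fine (kappa setT)) + k1 * a + k2 * c.
Proof.
move=> k00 k10 k20.
rewrite (Rintegral_affine_comb _ _ _ kU kW).
rewrite (Rintegral_affine_comb (m := mu w)); last 2 first.
- exact: (opnorm_integrable opnorm_mean).
- exact: (shift_integrable shift_mean).
rewrite fineP1.
have := ler_wpM2l k10 (Rintegral_opnorm_le opnorm_mean w).
have := ler_wpM2l k20 (Rintegral_shift_le shift_mean w).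
have := mulr_ge0 k10 Uk0; have := mulr_ge0 k20 Wk0; lra.
Qed.

Let kint_affine (k0 k1 k2 : R) : 0 <= k0 -> 0 <= k1 -> 0 <= k2 ->
  \int[kappa]_z affine_comb k0 k1 k2 z <= k0 + k1 * a + k2 * c.
Proof.
move=> k00 k10 k20; rewrite (Rintegral_affine_comb _ _ _ kU kW).
have /andP[_ kT_1] := kT1.
have := ler_wpM2l k10 Uka; have := ler_wpM2l k20 Wkc.
have := ler_wpM2l k00 kT_1; lra.
Qed.

Let f_int w : (mu w).-integrable setT (EFin \o (f \o affine_map w)).
Proof. by apply: Bb_integrable => //; exact: measurable_affine_map. Qed.

(** Everything is linear in [s]: the new distance is bounded through [satur q s <= s], while the old
    one equals [(1 - 2^-q) s]. The loss [1 - 2^-q] and the residual term, of order [s / N], are what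
    [near_cond] pays for. *)
Lemma contraction_near : 0 < eucl (x - y) -> N * eucl (x - y) `^ p <= 1 ->
  `|random_affine_op mu f x - random_affine_op mu f y| <= r * cost x y.
Proof.
set t := eucl (x - y) => t0 s1; set s := N * t `^ p.
have tp0 : 0 < t `^ p by rewrite powR_gt0.
have s0 : 0 < s by rewrite mulr_gt0.
pose rho := a `^ p; pose rho' := a `^ (p + 2^-1).
have rho0 : 0 <= rho by exact: powR_ge0.
have rho'0 : 0 <= rho' by exact: powR_ge0.
have rho'rho : rho' <= rho.
  rewrite /rho' /rho; apply: ger_powR; first by rewrite a0 ltW//; case/andP : a01.
  by rewrite lerDl.
have S0 : 0 <= V + W by exact: addr_ge0.
pose h := affine_comb
  (s * (rho * (1 - p) + beta * (V + W) * (rho' * (1 - (p + 2^-1))) + beta))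
  (s * (rho * (p / a) + beta * (V + W) * (rho' * ((p + 2^-1) / a)) + beta))
  (s * beta) : borelG R d -> R.
have fh z : `|f (affine_map x z) - f (affine_map y z)| <= h z.
  apply: (le_trans (fcost _ _)); rewrite /cost.
  apply: (@le_trans _ _ (s * (opnorm z.1 `^ p * (1 + beta *
      (Num.sqrt (opnorm z.1) * (V + W) + 2 * Num.sqrt (eucl z.2)))))).
    rewrite mulrA; apply: ler_pM.
    - exact: (satur_ge0 _ (scale_ge0 _ _)).
    - exact: le_trans ler01 (weight_ge1 _ _).
    - apply: (le_trans (satur_le_id _ (scale_ge0 _ _))).
      rewrite /s -mulrA ler_pM2l// mulrC -powRM ?opnorm_ge0 ?eucl_ge0//.
      apply: ge0_ler_powR; rewrite ?nnegrE ?mulr_ge0 ?opnorm_ge0 ?eucl_ge0//.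
        exact: ltW.
      exact: eucl_affine_mapB.
    - rewrite lerD2l ler_pM2l//.
      have := root_norm_affine_map x z; have := root_norm_affine_map y z.
      by rewrite -/V -/W; lra.
  have := @sync_pointwise_bound R p a beta (V + W) (opnorm z.1) (eucl z.2) a0 p01
    (ltW b0) S0 (opnorm_ge0 _) (eucl_ge0 _).
  move=> /(ler_wpM2l (ltW s0)) /le_trans; apply.
  rewrite /h /affine_comb /lin_norm /shift_norm -/rho -/rho' le_eqVlt.
  apply/orP; left; apply/eqP.
  by ring.
(* The square root of the Hoelder bound on the residual mass, thus a fixed multiple of [s / N]. *)
pose tau := Num.sqrt l * t `^ p.
have tau0 : 0 < tau by rewrite mulr_gt0// sqrtr_gt0.
have mtau : 1 - fine (kappa setT) <= tau ^+ 2.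
  rewrite exprMn sqr_sqrtr ?(ltW l0)// -powR_mulrn ?powR_ge0// -powRrM.
  exact: kmass.
(* The bound [1/2 + beta |m w + q|^(1/2)], with the root made affine by Young's inequality. The
   parameter [(1 + root_norm w) / tau] grows as the mass shrinks, so that the terms with full means
   get coefficients of order [tau]. *)
pose res (w : 'cV[R]_d) := affine_comb (2^-1 + beta * ((1 + root_norm w) / tau) / 2)
  (beta * root_norm w ^+ 2 / (2 * ((1 + root_norm w) / tau)))
  (beta / (2 * ((1 + root_norm w) / tau))) : borelG R d -> R.
have lam0 (w : 'cV[R]_d) : 0 < (1 + root_norm w) / tau.
  by rewrite divr_gt0// ltr_pwDl.
have resP w z : `|f (affine_map w z) - cf| <= res w z.
  rewrite (le_trans (fcf _))// /res /affine_comb -!addrA lerD2l.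
  apply: (@le_trans _ _ (beta * (((1 + root_norm w) / tau
    + (opnorm z.1 * eucl w + eucl z.2) / ((1 + root_norm w) / tau)) / 2))).
    rewrite ler_pM2l// (le_trans (sqrtr_le_young (lam0 w) (eucl_ge0 _)))//.
    by rewrite ler_pM2r// lerD2l ler_pM2r ?invr_gt0// eucl_affine_map.
  rewrite /lin_norm /shift_norm sqr_sqrtr ?eucl_ge0//.
  move: (_ / tau) (lam0 w) => lam lamp.
  by rewrite le_eqVlt; apply/orP; left; apply/eqP; field; rewrite gt_eqF.
have m0 : 0 <= 1 - fine (kappa setT) by case/andP : kT1 => ? ?; rewrite subr_ge0.
have m1 : 1 - fine (kappa setT) <= 1 by case/andP : kT1 => ? ?; rewrite gerBl.
have resB w : \int[mu w]_z res w z - \int[kappa]_z res w z <=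
    tau * (2^-1 + beta * (1 + c) * (1 + root_norm w)).
  apply: (le_trans (excess_affine _ _ _ _)).
  - apply: addr_ge0; first by [].
    apply: divr_ge0 => //; exact: (mulr_ge0 (ltW b0) (ltW (lam0 w))).
  - apply: divr_ge0; first exact: (mulr_ge0 (ltW b0) (sqr_ge0 _)).
    exact: (mulr_ge0 _ (ltW (lam0 w))).
  - apply: divr_ge0; first exact: ltW.
    exact: (mulr_ge0 _ (ltW (lam0 w))).
  exact: (residual_bound (ltW b0) (root_norm_ge0 w) c0 a01 tau0 m0 m1 mtau).
apply: (le_trans (@coupling_bound _ _ _ (mu x) (mu y) kappa
  (f \o affine_map x) (f \o affine_map y) h (res x) (res y) cf kx ky
  (f_int x) (f_int y) _ (aff_int _ _ _ _) (aff_int _ _ _ _) fh (resP x) (resP y))).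
  exact: (le_measure_integrable kx (aff_int _ _ _ _)).
have [p_ge0 p_le] := andP p01.
have hB : \int[kappa]_z h z <=
    s * (rho * (1 + beta * (V + W)) + 2 * beta * (1 + c)).
  apply: (le_trans (kint_affine _ _ _)).
  - apply: (mulr_ge0 (ltW s0)); apply: addr_ge0; last exact: ltW.
    have p1 : 0 <= 1 - p by lra.
    have p2 : 0 <= 1 - (p + 2^-1) by lra.
    exact: (addr_ge0 (mulr_ge0 rho0 p1)
      (mulr_ge0 (mulr_ge0 (ltW b0) S0) (mulr_ge0 rho'0 p2))).
  - apply: (mulr_ge0 (ltW s0)); apply: addr_ge0; last exact: ltW.
    have p2 : 0 <= p + 2^-1 by lra.
    exact: (addr_ge0 (mulr_ge0 rho0 (divr_ge0 (ltW p0) (ltW a0)))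
      (mulr_ge0 (mulr_ge0 (ltW b0) S0) (mulr_ge0 rho'0 (divr_ge0 p2 (ltW a0))))).
  - exact: (mulr_ge0 (ltW s0) (ltW b0)).
  (* The tangents were taken at [a], the bound on the mean of [||m||], where they take the values
     [a^p] and [a^(p + 1/2)]. *)
  have -> : s * (rho * (1 - p) + beta * (V + W) * (rho' * (1 - (p + 2^-1))) + beta)
    + s * (rho * (p / a) + beta * (V + W) * (rho' * ((p + 2^-1) / a)) + beta) * a
    + s * beta * c = s * (rho + beta * (V + W) * rho' + beta * (1 + a + c)).
    by field; rewrite gt_eqF.
  rewrite ler_pM2l//.
  have : beta * (V + W) * rho' <= beta * (V + W) * rho.
    by rewrite ler_wpM2l// mulr_ge0// ltW.
  have : beta * a <= beta * 1 by rewrite ler_pM2l//; case/andP : a01 => _ /ltW.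
  have := mulr_ge0 (ltW b0) c0; lra.
have := resB x; have := resB y; rewrite -/V -/W.
have tauE : tau = Num.sqrt l / N * s.
  by rewrite /tau /s mulrA divfK// gt_eqF.
rewrite /cost -/t -/V -/W -/s.
have -> : satur q s = (1 - 2^-1 ^+ q) * s by rewrite /satur s1.
have bS : 0 <= beta * (V + W) by rewrite mulr_ge0// ltW.
have Wt : 1 <= 1 + beta * (V + W) by rewrite lerDl.
(* Multiplied by [s (1 + beta (V + W))], the right side of [near_cond] becomes [r] times the cost,
   [satur] being linear here. *)
have := ler_wpM2r (mulr_ge0 (ltW s0) (le_trans ler01 Wt)) near_cond.
rewrite -/rho.
have -> : (rho + 2 * beta * (1 + c) + 3 * (1 + c) * Num.sqrt l / N) *
    (s * (1 + beta * (V + W))) = s * rho * (1 + beta * (V + W))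
    + s * (2 * beta * (1 + c)) * (1 + beta * (V + W))
    + 3 * (1 + c) * tau * (1 + beta * (V + W)).
  by rewrite tauE; field; rewrite gt_eqF.
have h1 : s * (2 * beta * (1 + c)) <= s * (2 * beta * (1 + c)) * (1 + beta * (V + W)).
  apply: ler_peMr => //; apply: (mulr_ge0 (ltW s0)).
  by apply: mulr_ge0; [exact: (mulr_ge0 _ (ltW b0))|exact: (addr_ge0 ler01 c0)].
have h2 : tau * (1 + beta * (1 + c) * (2 + (V + W))) <=
    3 * (1 + c) * tau * (1 + beta * (V + W)).
  rewrite (_ : 3 * _ * _ * _ = tau * (3 * (1 + c) * (1 + beta * (V + W)))); last by ring.
  rewrite ler_pM2l//.
  have /andP[_ b1] := beta01.
  exact: sync_residual_constant.
move: (\int[kappa]_z h z) hB h1 h2 => H hB h1 h2; lra.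
Qed.

Let good := [set z : borelG R d | opnorm z.1 <= a].

Let measurable_good : measurable good.
Proof.
rewrite -[good]setTI; apply: (measurable_fun_le measurableT) => //.
exact: measurable_opnorm_fst.
Qed.

(** The residual mass need not be small here, so distances are bounded by 1 except on the set
    [||m|| <= a] under [kappa], where the distance drops to [a^p s] and at least
    [delta (1 + a^p s)^-q] is gained. The rest is the drift of the weight, with factor [sqrt a]. *)
Lemma contraction_far : 1 < N * eucl (x - y) `^ p ->
  `|random_affine_op mu f x - random_affine_op mu f y| <= r * cost x y.
Proof.
set t := eucl (x - y); set s := N * t `^ p => s1.
pose S := V + W.
have S0 : 0 <= S by exact: addr_ge0.
pose rho := a `^ p; pose gam := Num.sqrt a.
have rho0 : 0 <= rho by exact: powR_ge0.
have gam0 : 0 < gam by rewrite sqrtr_gt0.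
have gamE : a = gam * gam by rewrite -expr2 sqr_sqrtr// ltW.
pose k := (1 + rho * s)^-1 ^+ q.
have rs0 : 0 <= rho * s by exact: mulr_ge0 rho0 (scale_ge0 _ _).
have ke0 : 0 <= k by rewrite exprn_ge0// invr_ge0 addr_ge0.
pose res (w : 'cV[R]_d) := affine_comb
  (2^-1 + beta * (gam * root_norm w / 2 + 2^-1))
  (beta * root_norm w / (2 * gam)) (beta / 2) : borelG R d -> R.
(* [h0] is the sum of [res x] and [res y], so that its [kappa] integral cancels the ones subtracted
   in the two excesses, whatever the mass of [kappa]. *)
pose h0 := affine_comb (1 + beta * (gam * S / 2 + 1))
  (beta * S / (2 * gam)) beta : borelG R d -> R.
pose h z := h0 z - k * \1_good z.
(* Young's parameter is [gam = sqrt a]: the mean of [(gam + ||m|| / gam) / 2] is then at most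
   [gam]. *)
have VT (w : 'cV[R]_d) z : root_norm (affine_map w z) <=
    (gam + opnorm z.1 / gam) / 2 * root_norm w + (1 + eucl z.2) / 2.
  apply: (le_trans (root_norm_affine_map w z)); apply: lerD.
    by apply: ler_wpM2r => //; apply: sqrtr_le_young => //; exact: opnorm_ge0.
  by have := sqrtr_le_young ltr01 (eucl_ge0 z.2); rewrite divr1.
have resP (w : 'cV[R]_d) z : `|f (affine_map w z) - cf| <= res w z.
  apply: (le_trans (fcf _)).
  have := ler_wpM2l (ltW b0) (VT w z).
  rewrite /res /affine_comb /lin_norm /shift_norm.
  have -> : beta * root_norm w / (2 * gam) * opnorm z.1 =
    beta * (opnorm z.1 / gam / 2 * root_norm w) by field; rewrite gt_eqF.
  lra.
have fh z : `|f (affine_map x z) - f (affine_map y z)| <= h z.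
  apply: (le_trans (fcost _ _)); rewrite /cost.
  set sz := N * eucl (affine_map x z - affine_map y z) `^ p.
  have sz0 : 0 <= sz by exact: scale_ge0.
  have szk : satur q sz <= 1 - k * \1_good z.
    rewrite indicE; case: (boolP (z \in good)) => zg; last first.
      by rewrite mulr0 subr0 satur_le1.
    rewrite mulr1; apply: le_trans (satur_le_inv1D _ rs0).
    apply: le_satur => //.
    rewrite /sz /rho /s mulrCA; apply: (ler_wpM2l (ltW N0)).
    rewrite -(powRM _ (ltW a0) (eucl_ge0 _)).
    apply: (ge0_ler_powR (ltW p0)); rewrite ?nnegrE.
    - exact: eucl_ge0.
    - exact: (mulr_ge0 (ltW a0) (eucl_ge0 _)).
    apply: (le_trans (eucl_affine_mapB _ _ _)); apply: ler_wpM2r.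
      exact: eucl_ge0.
    by move: zg; rewrite inE.
  have : satur q sz * (beta * (root_norm (affine_map x z)
      + root_norm (affine_map y z))) <= beta * (root_norm (affine_map x z)
      + root_norm (affine_map y z)).
    apply: ler_piMl; last exact: satur_le1.
    by apply: mulr_ge0; [exact: ltW|exact: addr_ge0].
  have := ler_wpM2l (ltW b0) (VT x z); have := ler_wpM2l (ltW b0) (VT y z).
  rewrite /h /h0 /affine_comb /lin_norm /shift_norm /S -/V -/W.
  have -> : beta * (V + W) / (2 * gam) * opnorm z.1 =
    beta * (opnorm z.1 / gam / 2 * V) + beta * (opnorm z.1 / gam / 2 * W).
    by field; rewrite gt_eqF.
  move: (k * \1_good z) szk => kk szk; lra.
have ik : kappa.-integrable setT (EFin \o (fun z => k * \1_good z)).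
  have := integrableZl measurableT k (@integrable_indic _ _ _ kappa _ measurable_good).
  exact.
have ih0 : kappa.-integrable setT (EFin \o h0).
  exact: (le_measure_integrable kx (aff_int _ _ _ _)).
have ih : kappa.-integrable setT (EFin \o h).
  exact: (integrableB measurableT ih0 ik).
apply: (le_trans (@coupling_bound _ _ _ (mu x) (mu y) kappa
  (f \o affine_map x) (f \o affine_map y) h (res x) (res y) cf kx ky
  (f_int x) (f_int y) ih (aff_int _ _ _ _) (aff_int _ _ _ _) fh (resP x) (resP y))).
have -> : \int[kappa]_z h z = \int[kappa]_z h0 z - k * fine (kappa good).
  rewrite /h RintegralB// RintegralZl//; last exact: integrable_indic.
  by rewrite /Rintegral integral_indic// setIT.
have muE (w : 'cV[R]_d) k0 k1 k2 : \int[mu w]_z affine_comb k0 k1 k2 z =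
    k0 + k1 * \int[mu w]_z lin_norm z + k2 * \int[mu w]_z shift_norm z.
  rewrite (Rintegral_affine_comb (m := mu w)).
  - by rewrite fineP1 mulr1.
  - exact: (opnorm_integrable opnorm_mean).
  - exact: (shift_integrable shift_mean).
rewrite /h0 /res !muE !(Rintegral_affine_comb _ _ _ kU kW) -/V -/W.
(* From [|x - y| <= |x| + |y| = V^2 + W^2 <= S^2]: a large distance forces a large weight, and a
   bounded weight bounds [s]. *)
have sS : s <= N * (S ^+ 2) `^ p.
  apply: (ler_wpM2l (ltW N0)).
  apply: (ge0_ler_powR (ltW p0)); rewrite ?nnegrE; [exact: eucl_ge0|exact: sqr_ge0|].
  apply: (le_trans (ler_euclB x y)).
  have VE : V ^+ 2 = eucl x := sqr_sqrtr (eucl_ge0 x).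
  have WE : W ^+ 2 = eucl y := sqr_sqrtr (eucl_ge0 y).
  by rewrite -VE -WE /S sqrrD addrAC lerDl mulrn_wge0// mulr_ge0.
have := far_cond s1 S0 sS; rewrite -/rho -/k -/gam.
apply: le_trans.
have kd : k * delta <= k * fine (kappa good) by rewrite ler_wpM2l.
have UB (w : 'cV[R]_d) v : 0 <= v ->
    beta * v / (2 * gam) * \int[mu w]_z lin_norm z <= beta * gam * v / 2.
  move=> v0; have -> : beta * gam * v / 2 = beta * v / (2 * gam) * a.
    by rewrite [in RHS]gamE; field; rewrite gt_eqF.
  apply: ler_wpM2l; last exact: Rintegral_opnorm_le.
  apply: divr_ge0; first exact: (mulr_ge0 (ltW b0) v0).
  exact: (mulr_ge0 _ (ltW gam0)).
have WB w := ler_wpM2l (ltW b0) (Rintegral_shift_le shift_mean w).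
have := UB x V V0; have := UB y W W0; have := WB x; have := WB y.
rewrite (_ : beta * S / (2 * gam) = beta * V / (2 * gam) + beta * W / (2 * gam));
  last by rewrite /S; field; rewrite gt_eqF.
rewrite /S.
move: (beta * V / (2 * gam)) (beta * W / (2 * gam)) => bV bW.
move: (\int[mu x]_z lin_norm z) (\int[mu y]_z lin_norm z)
  (\int[mu x]_z shift_norm z) (\int[mu y]_z shift_norm z)
  (\int[kappa]_z lin_norm z) (\int[kappa]_z shift_norm z)
  (fine (kappa setT)) => Ux Uy Wx Wy Uk Wk kT.
move: (k * fine (kappa good)) kd => kg kd; lra.
Qed.

End fixed_pair.

Lemma contraction_step f : Bb f -> (forall u v, `|f u - f v| <= cost u v) ->
  forall x y, `|random_affine_op mu f x - random_affine_op mu f y| <=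
    r * cost x y.
Proof.
move=> bf fcost x y; have r0 : 0 <= r by case/andP : r01 => /ltW.
have [->|xy] := eqVneq x y; first by rewrite subrr normr0 mulr_ge0// cost_ge0.
have t0 : 0 < eucl (x - y).
  rewrite lt_neqAle eucl_ge0 andbT eq_sym; apply: contra xy => /eqP/eucl_eq0.
  by move/eqP; rewrite subr_eq0.
have [kappa [kx ky kmass kgood]] := overlap x y.
have [cf fcf] := exists_center (f := f)
  (A := fun u => 2^-1 + beta * root_norm u) 0
  (fun u v => le_trans (fcost u v) (cost_le u v)).
have [s1|s1] := leP (N * eucl (x - y) `^ p) 1.
  exact: (contraction_near kx ky kmass bf fcost fcf t0 s1).
exact: (contraction_far kx ky kgood bf fcost fcf s1).
Qed.

Lemma contraction_scaled f M : Bb f -> 0 < M ->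
  (forall u v, `|f u - f v| <= M * cost u v) ->
  forall x y, `|random_affine_op mu f x - random_affine_op mu f y| <=
    M * r * cost x y.
Proof.
move=> bf M0 fcost x y; pose g u := M^-1 * f u.
have bg : Bb (g : borelRd R d -> R).
  split; first by apply: measurable_funM => //; exact: bf.1.
  have [K bK] := (bounded_funP _).1 bf.2; apply/bounded_funP.
  by exists (`|M^-1| * K) => w; rewrite normrM ler_wpM2l.
have gcost u v : `|g u - g v| <= cost u v.
  by rewrite -mulrBr normrM gtr0_norm ?invr_gt0// ler_pdivrMl.
have gE w : random_affine_op mu g w = M^-1 * random_affine_op mu f w.
  rewrite /random_affine_op RintegralZl//.
  exact: (@Bb_integrable _ _ _ _ (mu w) f (affine_map w) bf
    (measurable_affine_map w)).
have := contraction_step bg gcost x y.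
rewrite !gE -mulrBr normrM gtr0_norm ?invr_gt0// ler_pdivrMl//.
by rewrite mulrA.
Qed.

End contraction_step.

(** * Bounded Lipschitz functions and inf-convolutions *)

Section bounded_lipschitz.
Context {R : realType} {d : nat}.
Implicit Types (f g : 'cV[R]_d -> R) (x y : 'cV[R]_d).

Definition bounded_lipschitz f := exists K : R,
  (forall x, `|f x| <= K) /\ (forall x y, `|f x - f y| <= K * eucl (x - y)).

Lemma bounded_lipschitz_of f (K L : R) : (forall x, `|f x| <= K) ->
  (forall x y, `|f x - f y| <= L * eucl (x - y)) -> bounded_lipschitz f.
Proof.
move=> fK fL; exists (Num.max K L); split => [x|x y].
  by rewrite (le_trans (fK x))// le_max lexx.
by rewrite (le_trans (fL x y))// ler_wpM2r ?eucl_ge0// le_max lexx orbT.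
Qed.

Lemma bounded_lipschitz_continuous f : bounded_lipschitz f -> continuous f.
Proof.
move=> [K [fK fL]]; apply: (@le_norm_continuous _ _ _ _ (`|K| * d%:R)) => x y.
rewrite (le_trans (fL x y))// -mulrA.
apply: (@le_trans _ _ (`|K| * eucl (x - y))).
  by rewrite ler_wpM2r ?eucl_ge0// ler_norm.
by rewrite ler_wpM2l// eucl_le_norm.
Qed.

Lemma bounded_lipschitz_Cb f : bounded_lipschitz f -> Cb f.
Proof.
move=> bf; split; first exact: bounded_lipschitz_continuous.
by have [K [fK _]] := bf; apply/bounded_funP; exists K.
Qed.

Lemma Cb_Bb f : Cb f -> Bb (f : borelRd R d -> R).
Proof.
move=> [cf bf]; split => //; apply: g_sigma_measurable_real.
by apply/continuousP.
Qed.

Lemma bounded_lipschitz_Bb f :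
  bounded_lipschitz f -> Bb (f : borelRd R d -> R).
Proof. by move=> /bounded_lipschitz_Cb/Cb_Bb. Qed.

Lemma bounded_lipschitz_cst (k : R) : bounded_lipschitz (cst k).
Proof.
apply: (@bounded_lipschitz_of _ `|k| 0) => // x y.
by rewrite subrr normr0 mul0r.
Qed.

Lemma bounded_lipschitzD f g : bounded_lipschitz f -> bounded_lipschitz g ->
  bounded_lipschitz (fun x => f x + g x).
Proof.
move=> [K [fK fL]] [M [gM gL]].
apply: (@bounded_lipschitz_of _ (K + M) (K + M)) => [x|x y].
  by rewrite (le_trans (ler_normD _ _))// lerD.
by rewrite opprD addrACA (le_trans (ler_normD _ _))// mulrDl lerD.
Qed.

Lemma bounded_lipschitzM f g : bounded_lipschitz f -> bounded_lipschitz g ->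
  bounded_lipschitz (fun x => f x * g x).
Proof.
move=> [K [fK fL]] [M [gM gL]].
apply: (@bounded_lipschitz_of _ (K * M) (K * M + K * M)) => [x|x y].
  by rewrite normrM ler_pM.
have -> : f x * g x - f y * g y = f x * (g x - g y) + (f x - f y) * g y.
  by rewrite mulrBr mulrBl addrA subrK.
rewrite (le_trans (ler_normD _ _))// !normrM mulrDl lerD//.
  by rewrite -mulrA ler_pM.
by rewrite mulrAC ler_pM.
Qed.

Lemma bounded_lipschitzZ (k : R) f : bounded_lipschitz f ->
  bounded_lipschitz (fun x => k * f x).
Proof. by move=> bf; exact: (bounded_lipschitzM (bounded_lipschitz_cst k) bf). Qed.

Lemma bounded_lipschitzB f g : bounded_lipschitz f -> bounded_lipschitz g ->
  bounded_lipschitz (fun x => f x - g x).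
Proof.
move=> bf bg; have := bounded_lipschitzD bf (bounded_lipschitzZ (-1) bg).
by under eq_fun do rewrite mulN1r.
Qed.

Lemma bounded_lipschitz_sum (I : Type) (s : seq I) (F : I -> 'cV[R]_d -> R) :
  (forall i, bounded_lipschitz (F i)) ->
  bounded_lipschitz (fun x => \sum_(i <- s) F i x).
Proof.
move=> bF; elim: s => [|i s ih].
  by under eq_fun do rewrite big_nil; exact: bounded_lipschitz_cst.
by under eq_fun do rewrite big_cons; exact: bounded_lipschitzD.
Qed.

Definition clip (t : R) : R := Num.max 0 (Num.min t 1).

Lemma clip_ge0 t : 0 <= clip t.
Proof. by rewrite /clip le_max lexx. Qed.

Lemma clip_le1 t : clip t <= 1.
Proof. by rewrite /clip ge_max ler01 ge_min lexx orbT. Qed.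

Lemma clip_id t : 0 <= t <= 1 -> clip t = t.
Proof. by move=> /andP[t0 t1]; rewrite /clip min_l// max_r. Qed.

Lemma clip_ge1 t : 1 <= t -> clip t = 1.
Proof. by move=> t1; rewrite /clip min_r// max_r. Qed.

Lemma clip_le0 t : t <= 0 -> clip t = 0.
Proof. by move=> t0; rewrite /clip max_l// ge_min t0. Qed.

Lemma clip_lipschitz s t : `|clip s - clip t| <= `|s - t|.
Proof.
wlog st : s t / t <= s.
  move=> h; have [ts|/ltW st] := leP t s; first exact: h.
  by rewrite distrC [leRHS]distrC; exact: h.
have cst0 : clip t <= clip s.
  rewrite /clip ge_max !le_max lexx/=; apply/orP; right.
  by rewrite le_min !ge_min st lexx orbT.
rewrite !ger0_norm ?subr_ge0//.
have clip_cases u : [\/ u <= 0 /\ clip u = 0, [/\ 0 <= u, u <= 1 & clip u = u]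
    | 1 <= u /\ clip u = 1].
  have [u0|u0] := leP u 0; first by constructor 1; rewrite clip_le0.
  have [u1|u1] := leP u 1; last by constructor 3; rewrite clip_ge1 ltW.
  by constructor 2; rewrite clip_id ltW.
have := clip_cases s; have := clip_cases t.
by move=> [[? ->]|[? ? ->]|[? ->]] [[? ->]|[? ? ->]|[? ->]]; lra.
Qed.

Lemma bounded_lipschitz_clip f (K : R) :
  (forall x y, `|f x - f y| <= K * eucl (x - y)) ->
  bounded_lipschitz (fun x => clip (f x)).
Proof.
move=> fK; apply: (@bounded_lipschitz_of _ 1 K) => [x|x y].
  by rewrite ger0_norm ?clip_ge0 ?clip_le1.
exact: le_trans (clip_lipschitz _ _) (fK x y).
Qed.

(** Layer decomposition: [clip (u - m)] is the increment of [min u m] from [m] to [m + 1]. *)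
Lemma sum_clip (n : nat) (u : R) : 0 <= u <= n%:R ->
  \sum_(i < n) clip (u - i%:R) = u.
Proof.
move=> /andP[u0 un]; suff h m : \sum_(i < m) clip (u - i%:R) = Num.min u m%:R.
  by rewrite h min_l.
elim: m => [|m ih]; first by rewrite big_ord0 min_r.
rewrite big_ord_recr/= ih -natr1.
have [um|um] := leP u m%:R.
  rewrite clip_le0 ?subr_le0// addr0 min_l// (le_trans um)// lerDl//.
have [um1|um1] := leP u (m%:R + 1).
  rewrite clip_id; first by rewrite addrC subrK.
  by rewrite subr_ge0 lerBlDl um1 andbT ltW.
by rewrite clip_ge1// lerBrDl ltW.
Qed.

(** The Pasch-Hausdorff envelope: a [k]-Lipschitz minorant of [f], increasing in [k]. It
    approximates indicators of open sets and bounded continuous functions from below by bounded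
    Lipschitz functions. *)
Definition infconv (f : 'cV[R]_d -> R) (k : R) x : R :=
  inf [set f y + k * eucl (x - y) | y in setT].

Section infconv_nonnegative.
Variable f : 'cV[R]_d -> R.
Hypothesis f0 : forall x, 0 <= f x.

Let lb k x : 0 <= k ->
  has_inf [set f y + k * eucl (x - y) | y in setT].
Proof.
move=> k0; split; first by exists (f x + k * eucl (x - x)), x.
by exists 0 => _ [y _ <-]; rewrite addr_ge0// mulr_ge0 ?eucl_ge0.
Qed.

Lemma infconv_ge0 k x : 0 <= k -> 0 <= infconv f k x.
Proof.
move=> k0; apply: lb_le_inf; first by have [] := lb x k0.
by move=> _ [y _ <-]; rewrite addr_ge0// mulr_ge0 ?eucl_ge0.
Qed.

Lemma infconv_le k x y : 0 <= k -> infconv f k x <= f y + k * eucl (x - y).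
Proof. by move=> k0; apply: ge_inf; [have [] := lb x k0|exists y]. Qed.

Lemma infconv_le_id k x : 0 <= k -> infconv f k x <= f x.
Proof.
by move=> k0; have := infconv_le x x k0; rewrite subrr eucl0 mulr0 addr0.
Qed.

Lemma infconv_lipschitz k x y : 0 <= k ->
  `|infconv f k x - infconv f k y| <= k * eucl (x - y).
Proof.
move=> k0; suff h (u v : 'cV[R]_d) :
    infconv f k u - k * eucl (u - v) <= infconv f k v.
  have := h x y; have := h y x; rewrite (eucl_distC y x) ler_norml; lra.
apply: lb_le_inf; first by have [] := lb v k0.
move=> _ [z _ <-]; rewrite lerBlDr (le_trans (infconv_le u z k0))//.
by rewrite -addrA lerD2l -mulrDr ler_wpM2l// [leRHS]addrC ler_eucl_distD.
Qed.

Lemma infconv_bounded_lipschitz k : 0 <= k -> (exists K, forall x, f x <= K) ->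
  bounded_lipschitz (infconv f k).
Proof.
move=> k0 [K fK]; apply: (@bounded_lipschitz_of _ K k) => [x|x y].
  by rewrite ger0_norm ?infconv_ge0// (le_trans (infconv_le_id _ k0)).
exact: infconv_lipschitz.
Qed.

Lemma infconv_homo k k' x : 0 <= k -> k <= k' -> infconv f k x <= infconv f k' x.
Proof.
move=> k0 kk'; apply: lb_le_inf; first by have [] := lb x (le_trans k0 kk').
move=> _ [z _ <-]; rewrite (le_trans (infconv_le x z k0))// lerD2l.
by rewrite ler_wpM2r ?eucl_ge0.
Qed.

(** Near [x] lower semicontinuity bounds [f y] from below; at distance at least [r] the penalty
    [n r] already exceeds [f x] for large [n]. *)
Lemma infconv_cvg x : (forall e, 0 < e -> \forall y \near x, f x - e <= f y) ->
  infconv f n%:R x @[n --> \oo] --> f x.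
Proof.
move=> lsc; apply/cvgrPdist_le => e e0.
have /nbhs_ballP[r /= r0 hr] := lsc e e0.
near=> n.
rewrite ger0_norm ?subr_ge0 ?infconv_le_id// lerBlDl -lerBlDr.
apply: lb_le_inf; first by have [] := @lb n%:R x (ler0n _ _).
move=> _ [y _ <-]; have [xy|xy] := ltP (eucl (x - y)) r.
  have : f x - e <= f y.
    by apply: hr; rewrite -ball_normE/= (le_lt_trans (norm_le_eucl _)).
  move/le_trans; apply; by rewrite lerDl mulr_ge0 ?eucl_ge0.
apply: (@le_trans _ _ (n%:R * r)); last first.
  by rewrite -[leLHS]add0r lerD// ler_wpM2l.
rewrite (@le_trans _ _ (f x))//; first by rewrite gerBl ltW.
rewrite -ler_pdivrMr//.
by near: n; exact: nbhs_infty_ger.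
Unshelve. all: by end_near. Qed.

End infconv_nonnegative.

Lemma open_indic_lsc (U : set 'cV[R]_d) x e : open U -> 0 < e ->
  \forall y \near x, \1_U x - e <= \1_U y :> R.
Proof.
move=> oU e0; have [xU|xU] := pselect (U x).
  have : nbhs x U by exact: open_nbhs_nbhs.
  apply: filterS => y yU; rewrite !indicE !mem_set//.
  by rewrite gerBl ltW.
apply: (@filterE _ (nbhs x)) => y; rewrite !indicE memNset//.
by rewrite sub0r (@le_trans _ _ 0)// oppr_le0 ltW.
Qed.

End bounded_lipschitz.

(** * Representation of tight functionals by probability measures *)

Section measure_from_function.
Local Open Scope ereal_scope.

Lemma outer_measure_of_function {R : realType} {T : Type} (m : set T -> \bar R) :
  m set0 = 0 -> (forall A, 0 <= m A) ->
  {homo m : A B / A `<=` B >-> A <= B} -> sigma_subadditive m ->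
  exists m' : {outer_measure set T -> \bar R}, m' = m :> (set T -> \bar R).
Proof.
move=> m0 mge0 mle msub.
pose X := @isOuterMeasure.Build R T m m0 mge0 mle msub.
by exists (HB.pack_for {outer_measure set T -> \bar R} m X).
Qed.

Lemma probability_of_function {disp} {T : measurableType disp} {R : realType}
    (m : set T -> \bar R) :
  m set0 = 0 -> (forall A, 0 <= m A) -> semi_sigma_additive m -> m setT = 1 ->
  exists P : probability T R, P = m :> (set T -> \bar R).
Proof.
move=> m0 mge0 madd m1.
pose X := @isMeasure.Build disp T R m m0 mge0 madd.
pose M := HB.pack_for {measure set T -> \bar R} m X.
pose Y := @Measure_isProbability.Build disp T R M m1.
by exists (HB.pack_for (probability T R) m X Y).
Qed.

(** One enumeration serves all families [a]: it has to reorder the values of [L] and, at every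
    point, the values of the functions in the same way. *)
Lemma nneseries_nat2 {R : realType} : exists f : nat -> nat * nat,
  forall a : nat -> nat -> \bar R, (forall i j, 0 <= a i j) ->
    \sum_(i <oo) a (f i).1 (f i).2 = \sum_(i <oo) \sum_(j <oo) a i j.
Proof.
have /ppcard_eqP[f] : ([set: nat] #= [set: nat * nat])%card.
  by rewrite card_eq_sym; exact: card_nat2.
exists f => a a0; rewrite nneseries_esumT//.
transitivity (\esum_(p in [set: nat * nat]) a p.1 p.2).
  by rewrite (reindex_esum [set: nat] _ f).
rewrite (_ : setT = setT `*`` (fun=> setT)); last by apply/seteqP; split.
rewrite -(@esum_esum _ _ _ _ _ a)//.
rewrite nneseries_esumT; last by move=> *; exact: nneseries_ge0.
by apply: eq_esum => /= i _; rewrite nneseries_esumT.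
Qed.

End measure_from_function.

Section daniell.
Context {R : realType} {d : nat}.
Local Notation V := 'cV[R]_d.
Local Notation BL := (@bounded_lipschitz R d).
Implicit Types (f : V -> R) (A U X : set V).

Definition increments (h : nat -> R) (j : nat) : R :=
  h j - (if j is i.+1 then h i else 0).

Lemma nneseries_increments (h : nat -> R) (l : R) : h n @[n --> \oo] --> l ->
  (\sum_(j <oo) (increments h j)%:E = l%:E)%E.
Proof.
move=> hl; apply/cvg_lim => //; rewrite -cvg_shiftS/=.
rewrite [X in X @ \oo --> _](_ : _ = EFin \o h).
  by apply/fine_cvgP; split; first exact: nearW.
apply/funext => n /=; rewrite sumEFin; congr (_%:E).
elim: n => [|n ih]; first by rewrite big_nat1 /increments subr0.
by rewrite big_nat_recr//= ih /increments addrC subrK.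
Qed.

Lemma closed_eucl_ball_compact (r : R) : compact [set x : V | eucl x <= r].
Proof.
have ctr : continuous (@trmx R 1 d).
  apply: (@le_norm_continuous _ _ _ _ 1) => x y; rewrite mul1r.
  apply: mx_norm_le => // i j; have := norm_coord_le (x - y) j i.
  by rewrite !mxE.
(* Transposition transfers the claim to row vectors, where bounded closed sets are compact. *)
have -> : [set x : V | eucl x <= r] =
    @trmx R 1 d @` [set v : 'rV[R]_d | eucl v^T <= r].
  apply/seteqP; split => [x xr|_ [v vr <-]//].
  by exists x^T; rewrite /= trmxK.
apply: continuous_compact; first exact: continuous_subspaceT.
apply: bounded_closed_compact.
  exists r; split; first exact: num_real.
  move=> M rM v /= vr; apply: mx_norm_le => [|i j].
    by rewrite (le_trans (eucl_ge0 v^T))// (le_trans vr)// ltW.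
  rewrite (ord1 i); apply: (@le_trans _ _ (eucl v^T)).
    by have := coord_le_eucl v^T j; rewrite mxE.
  by rewrite (le_trans vr)// ltW.
rewrite (_ : [set _ | _] = (fun v : 'rV[R]_d => eucl v^T) @^-1` [set t | t <= r])//.
apply: closed_comp => [v _|]; last exact: closed_le.
apply: (@continuous_comp _ _ _ (@trmx R 1 d) (@eucl R d)); first exact: ctr.
exact: eucl_continuous.
Qed.

Variable L : (V -> R) -> R.
Hypothesis LD : forall f (g : V -> R), BL f -> BL g -> L (fun x => f x + g x) = L f + L g.
Hypothesis LZ : forall k f, BL f -> L (fun x => k * f x) = k * L f.
Hypothesis L_ge0 : forall f, BL f -> (forall x, 0 <= f x) -> 0 <= L f.
Hypothesis L_cst1 : L (cst 1) = 1.
Hypothesis L_tight : forall e : R, 0 < e -> exists chi r,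
  [/\ BL chi, forall x, 0 <= chi x <= 1, forall x, r < eucl x -> chi x = 0 &
      1 - e <= L chi].

Let L_cst0 : L (cst 0) = 0.
Proof.
have h := LZ 0 (bounded_lipschitz_cst 1); rewrite mul0r in h.
by rewrite -[RHS]h; congr L; apply/funext => x; rewrite mul0r.
Qed.

Let LB f (g : V -> R) : BL f -> BL g -> L (fun x => f x - g x) = L f - L g.
Proof.
move=> bf bg; have := LD bf (bounded_lipschitzZ (-1) bg).
rewrite LZ// mulN1r => <-; congr L; apply/funext => x; by rewrite mulN1r.
Qed.

Let le_L f (g : V -> R) : BL f -> BL g -> (forall x, f x <= g x) -> L f <= L g.
Proof.
move=> bf bg fg; rewrite -subr_ge0 -LB//; apply: L_ge0.
  exact: bounded_lipschitzB.
by move=> x; rewrite subr_ge0.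
Qed.

Let L_sum n (F : nat -> V -> R) : (forall i, BL (F i)) ->
  L (fun x => \sum_(0 <= i < n) F i x) = \sum_(0 <= i < n) L (F i).
Proof.
move=> bF; elim: n => [|n ih].
  rewrite [RHS]big_geq// -[RHS]L_cst0; congr L.
  by apply/funext => x; rewrite big_geq.
rewrite big_nat_recr//= -ih -LD//; last exact: bounded_lipschitz_sum.
by congr L; apply/funext => x; rewrite big_nat_recr.
Qed.

(** The functional analogue of a countable cover by sets, with [L] measuring the size of each
    member. No continuity of [L] along monotone sequences is built in; it has to come from
    tightness, when the mass of the whole space is computed. *)
Definition daniell_cover A : set (nat -> V -> R) :=
  [set g | (forall k, BL (g k) /\ forall x, 0 <= g k x) /\
           forall x, A x -> (1 <= \sum_(k <oo) (g k x)%:E)%E].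

Definition daniell_outer A : \bar R :=
  ereal_inf [set (\sum_(k <oo) (L (g k))%:E)%E | g in daniell_cover A].

Local Open Scope ereal_scope.

Let L_pos (g : nat -> V -> R) k A : daniell_cover A g -> 0 <= (L (g k))%:E.
Proof. by move=> [/(_ k)[bg g0] _]; rewrite lee_fin L_ge0. Qed.

Lemma daniell_outer_ge0 A : 0 <= daniell_outer A.
Proof.
apply: le_ereal_inf_tmp => _ [g Ag <-]; apply: nneseries_ge0 => k _ _.
exact: (L_pos k Ag).
Qed.

Lemma le_daniell_outer : {homo daniell_outer : A B / A `<=` B >-> A <= B}.
Proof.
move=> A B AB; apply: ereal_inf_le_tmp => _ [g [g0 gB] <-]; exists g => //.
by split => // x /AB; exact: gB.
Qed.

Lemma daniell_outer_le A (g : nat -> V -> R) : daniell_cover A g ->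
  daniell_outer A <= \sum_(k <oo) (L (g k))%:E.
Proof. by move=> gA; apply: ereal_inf_lbound; exists g. Qed.

Lemma daniell_outer_le2 A (g : nat -> nat -> V -> R) :
  (forall n k, BL (g n k)) -> (forall n k x, (0 <= g n k x)%R) ->
  (forall x, A x -> 1 <= \sum_(n <oo) \sum_(k <oo) (g n k x)%:E) ->
  daniell_outer A <= \sum_(n <oo) \sum_(k <oo) (L (g n k))%:E.
Proof.
move=> bg g0 gA; have [f fE] := @nneseries_nat2 R.
rewrite -fE; last by move=> i j; rewrite lee_fin L_ge0.
apply: (daniell_outer_le (g := fun i => g (f i).1 (f i).2)); split=> [k|x xA].
  by split.
have := fE (fun i j => (g i j x)%:E).
by move=> -> => [|i j]; [exact: gA|rewrite lee_fin].
Qed.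

Lemma daniell_outer0 : daniell_outer set0 = 0.
Proof.
apply/eqP; rewrite eq_le daniell_outer_ge0 andbT.
apply: (le_trans (daniell_outer_le (g := fun=> cst 0%R) _)).
  by split => // k; split => //; exact: bounded_lipschitz_cst.
by rewrite L_cst0 eseries0.
Qed.

Lemma daniell_outer_adherent A (e : R) : (0 < e)%R -> daniell_outer A < +oo ->
  exists2 g, daniell_cover A g &
    \sum_(k <oo) (L (g k))%:E <= daniell_outer A + e%:E.
Proof.
move=> e0 Aoo; have Afin : daniell_outer A \is a fin_num.
  by rewrite ge0_fin_numE ?daniell_outer_ge0.
have [_ [g gA <-] /ltW h] := lb_ereal_inf_adherent e0 Afin.
by exists g.
Qed.

Lemma daniell_outer_sigma_subadditive : sigma_subadditive daniell_outer.
Proof.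
move=> A; have [[i ioo]|] := pselect (exists i, daniell_outer (A i) = +oo).
  rewrite (eseries_pinfty _ _ ioo) ?leey// => n _.
  by rewrite -ltNye (lt_le_trans _ (daniell_outer_ge0 _)).
rewrite -forallNE => Aoo.
apply/lee_addgt0Pr => e e0.
rewrite (le_trans _ (epsilon_trick _ _ (ltW e0)))//; last first.
  by move=> n; exact: daniell_outer_ge0.
have /choice[G PG] n : exists g, daniell_cover (A n) g /\
    \sum_(k <oo) (L (g k))%:E <= daniell_outer (A n) + (e / (2 ^ n.+1)%:R)%:E.
  have [||g gA gE] := @daniell_outer_adherent (A n) (e / (2 ^ n.+1)%:R)%R.
  - by rewrite divr_gt0// ltr0n expn_gt0.
  - by rewrite ltey; apply/eqP; exact: Aoo.
  by exists g.
apply: (@le_trans _ _ (\sum_(n <oo) \sum_(k <oo) (L (G n k))%:E)).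
  apply: daniell_outer_le2 => [n k|n k x|x [n _ xA]].
  - by have [[/(_ k)[]]] := PG n.
  - by have [[/(_ k)[]]] := PG n.
  have [[_ /(_ x xA) h1] _] := PG n; apply: (le_trans h1).
  have G0 m k : 0 <= (G m k x)%:E by have [[/(_ k)[_ g0] _] _] := PG m; rewrite lee_fin.
  have S0 m : 0 <= \sum_(k <oo) (G m k x)%:E by exact: nneseries_ge0.
  rewrite [leRHS](nneseries_split _ n.+1)// add0n.
  rewrite big_nat_recr//= -addeA addeCA leeDl// adde_ge0//.
    by rewrite sume_ge0.
  exact: nneseries_ge0.
apply: lee_nneseries => [n _ _|n _]; last exact: (PG n).2.
by apply: nneseries_ge0 => k _ _; exact: (L_pos _ (PG n).1).
Qed.

(* Multiplying a cover of [X] by functions [h j] increasing to the indicator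
   of [U] splits it into a cover of [X `&` U], through the increments of [h],
   and a cover of [X `\` U]. *)
Lemma daniell_outer_open U X : open U ->
  daniell_outer (X `&` U) + daniell_outer (X `&` ~` U) <= daniell_outer X.
Proof.
move=> oU; have [->|Xoo] := eqVneq (daniell_outer X) +oo; first exact: leey.
apply/lee_addgt0Pr => e e0.
have e20 : (0 < e / 2)%R by rewrite divr_gt0.
have [||g gX gE] := @daniell_outer_adherent X (e / 2)%R => //.
  by rewrite ltey.
have bg k : BL (g k) by have [/(_ k)[]] := gX.
have g0 k x : (0 <= g k x)%R by have [/(_ k)[_ +]] := gX; exact.
pose h (j : nat) := infconv (\1_U : V -> R) j%:R.
have U0 (x : V) : (0 <= \1_U x :> R)%R by rewrite indicE ler0n.
have U1 (x : V) : (\1_U x <= 1 :> R)%R by rewrite indicE lern1 leq_b1.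
have h0 j x : (0 <= h j x)%R by apply: infconv_ge0.
have hU j x : (h j x <= \1_U x)%R by apply: infconv_le_id.
have h1 j x : (h j x <= 1)%R := le_trans (hU j x) (U1 x).
have bh j : BL (h j) by apply: infconv_bounded_lipschitz => //; exists 1%R.
have hS j x : (h j x <= h j.+1 x)%R by apply: infconv_homo => //; rewrite ler_nat.
have hcvg x : h j x @[j --> \oo] --> (\1_U x : R).
  by apply: infconv_cvg => // e' e'0; exact: open_indic_lsc.
pose gh k j x := (g k x * h j x)%R.
have bgh k j : BL (gh k j) by exact: bounded_lipschitzM.
have gh_le k j x : (gh k j x <= g k x)%R by rewrite ler_piMr.
have gh_ge0 k j x : (0 <= gh k j x)%R by exact: mulr_ge0.
(* The increments of [gh k] are themselves used as cover members and their [L] values sum to exactly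
   [l k]; [l k] need not be identified with a value of [L]. *)
have /choice[l lcvg] k : exists l : R, (fun j => L (gh k j)) @ \oo --> l.
  apply/cvg_ex; apply: nondecreasing_is_cvgn.
    apply/nondecreasing_seqP => j; apply: le_L => // x.
    by rewrite ler_wpM2l.
  by exists (L (g k)) => _ [j _ <-]; exact: le_L.
(* On the complement of [U] every [h j] vanishes, so any truncation [J k] gives a cover there. It is
   chosen to lose at most the [k]-th part of [e / 2]; the other [e / 2] pays for the cover [g]. *)
have /choice[J JE] k : exists j,
    (l k <= L (gh k j) + e / 2 / (2 ^ k.+1)%:R)%R.
  have ek : (0 < e / 2 / (2 ^ k.+1)%:R)%R by rewrite divr_gt0// ltr0n expn_gt0.
  have /cvgrPdist_le/(_ _ ek)[j _ /(_ j (leqnn j))] := lcvg k.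
  by move=> hj; exists j; rewrite -lerBlDl (le_trans (ler_norm _)).
have LghJ0 k : (0 <= L (gh k (J k)))%R by exact: L_ge0.
have l0 k : (0 <= l k)%R.
  by apply: (cvgr_to_ge (lcvg k)); apply: nearW => j; exact: L_ge0.
apply: (@le_trans _ _ (\sum_(k <oo) (l k)%:E
    + \sum_(k <oo) (L (g k) - L (gh k (J k)))%:E)).
  apply: leeD.
    apply: (le_trans (daniell_outer_le2
      (g := fun k j x => increments (gh k ^~ x) j) _ _ _)).
    - move=> k [|j]; rewrite /increments.
        by under eq_fun do rewrite subr0; exact: bgh.
      exact: bounded_lipschitzB.
    - move=> k [|j] x; rewrite /increments; first by rewrite subr0.
      by rewrite subr_ge0 ler_wpM2l.
    - move=> x [xX xU]; have [_ /(_ x xX) h1x] := gX; apply: (le_trans h1x).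
      apply: lee_nneseries => [k _ _|k _]; first by rewrite lee_fin.
      rewrite (nneseries_increments (l := g k x))//.
      rewrite -[X in _ --> X]mulr1; apply: cvgMr.
      by have := hcvg x; rewrite indicE mem_set.
    apply: lee_nneseries => [k _ _|k _].
      apply: nneseries_ge0 => j _ _; rewrite lee_fin; apply: L_ge0.
        case: j => [|j]; rewrite /increments.
          by under eq_fun do rewrite subr0; exact: bgh.
        exact: bounded_lipschitzB.
      move=> x; case: j => [|j]; rewrite /increments ?subr0//.
      by rewrite subr_ge0 ler_wpM2l.
    rewrite -(nneseries_increments (lcvg k)).
    rewrite le_eqVlt; apply/orP; left; apply/eqP.
    apply: eq_eseriesr => -[|j] _; rewrite /increments.
      by rewrite subr0; congr (L _)%:E; apply/funext => x; rewrite subr0.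
    by rewrite LB.
  apply: (le_trans (daniell_outer_le
    (g := fun k x => (g k x - gh k (J k) x)%R) _)); last first.
    apply: lee_nneseries => [k _ _|k _]; last by rewrite LB.
    by rewrite lee_fin; apply: L_ge0 => [|x];
      [exact: bounded_lipschitzB|rewrite subr_ge0].
  split=> [k|x [xX xU]].
    by split => [|x]; [exact: bounded_lipschitzB|rewrite subr_ge0].
  have [_ /(_ x xX) h1x] := gX; apply: (le_trans h1x).
  apply: lee_nneseries => [k _ _|k _]; first by rewrite lee_fin.
  have hx0 j : h j x = 0%R.
    apply/eqP; rewrite eq_le h0 andbT (le_trans (hU j x))//.
    by rewrite indicE memNset.
  by rewrite /gh hx0 mulr0 subr0.
rewrite -nneseriesD => [|k _ _|k _ _]; last 2 first.
- by rewrite lee_fin.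
- by rewrite lee_fin subr_ge0 le_L.
have eE : daniell_outer X + e%:E = daniell_outer X + (e / 2)%:E + (e / 2)%:E.
  by rewrite -addeA -EFinD -splitr.
rewrite eE (@le_trans _ _ (\sum_(k <oo) (L (g k))%:E + (e / 2)%:E))//; last first.
  by rewrite leeD2r.
apply: le_trans (epsilon_trick xpredT _ (ltW e20)); last first.
  by move=> k; exact: (L_pos k gX).
apply: lee_nneseries => [k _ _|k _].
  by rewrite -EFinD lee_fin addr_ge0// subr_ge0 le_L.
by rewrite -!EFinD lee_fin; have := JE k; lra.
Qed.

Lemma L_cst (k : R) : L (cst k) = k.
Proof.
rewrite -[RHS]mulr1 -L_cst1 -LZ; last exact: bounded_lipschitz_cst.
by congr L; apply/funext => x; rewrite /cst mulr1.
Qed.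

Lemma daniell_outer_le1 A f : BL f -> (forall x, (0 <= f x)%R) ->
  (forall x, A x -> (1 <= f x)%R) -> daniell_outer A <= (L f)%:E.
Proof.
(* The increments of a constant sequence are that constant followed by zeros, so the one function
   [f] becomes a countable cover. *)
move=> bf f0 fA; pose g k (x : V) := increments (fun=> f x) k.
have gE k : g k = if k is 0%N then f else cst 0%R.
  by apply/funext => x; case: k => [|k]; rewrite /g /increments ?subr0 ?subrr.
have gA : daniell_cover A g.
  split=> [k|x xA]; last first.
    by rewrite (nneseries_increments (cvg_cst (f x))) lee_fin fA.
  rewrite gE; case: k => [|k]; first by split.
  by split => //; exact: bounded_lipschitz_cst.
apply: (le_trans (daniell_outer_le gA)).
rewrite -(nneseries_increments (cvg_cst (L f))) le_eqVlt.
apply/orP; left; apply/eqP; apply: eq_eseriesr => k _.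
by rewrite gE /increments; case: k => [|k]; rewrite ?subr0 ?subrr// L_cst.
Qed.

(* Tightness reduces the claim to a compact ball, where finitely many members
   of the cover already sum to nearly [1]. *)
Lemma daniell_outer_setT : daniell_outer setT = 1.
Proof.
apply/eqP; rewrite eq_le; apply/andP; split.
  have := @daniell_outer_le1 setT (cst 1%R) (bounded_lipschitz_cst 1).
  by rewrite L_cst; apply.
apply: le_ereal_inf_tmp => _ [g gT <-]; apply/lee_addgt0Pr => e e0.
have bg k : BL (g k) by have [/(_ k)[]] := gT.
have g0 k x : (0 <= g k x)%R by have [/(_ k)[_ +]] := gT; exact.
(* With this choice [(1 - e')^2 >= 1 - e]: one factor is lost on the ball, the other in the mass of
   [chi]. The cap at 1 keeps [1 - e'] non-negative. *)
pose e' := Num.min (e / 2)%R 1%R.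
have e'0 : (0 < e')%R by rewrite lt_min ltr01 andbT divr_gt0.
have e'1 : (e' <= 1)%R by rewrite ge_min lexx orbT.
have e'e : (e' <= e / 2)%R by rewrite ge_min lexx.
have [chi [r [bchi chi01 chir Lchi]]] := L_tight e'0.
(* Dini's argument: the partial sums are continuous and nondecreasing in [n], so exceeding [1 - e']
   at a point persists in a neighbourhood and for all larger [n]. *)
have : \forall n \near \oo, [set x : V | (eucl x <= r)%R] `<=`
    [set x | (1 - e' <= \sum_(0 <= k < n) g k x)%R].
  have /compact_near_coveringP := @closed_eucl_ball_compact r.
  move=> /(_ _ \oo (fun n x => (1 - e' <= \sum_(0 <= k < n) g k x)%R)).
  apply => x _.
  have [n0 n0x] : exists n0, (1 - e' < \sum_(0 <= k < n0) g k x)%R.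
    apply: contrapT => /forallNP h.
    have : \sum_(k <oo) (g k x)%:E <= (1 - e')%:E.
      apply: lime_le.
        by apply: is_cvg_nneseries => k _ _; rewrite lee_fin.
      apply: nearW => n; rewrite sumEFin lee_fin leNgt.
      by apply/negP; exact: h.
    apply/negP; rewrite -ltNge; have [_ /(_ x I)] := gT.
    by apply: lt_le_trans; rewrite lte_fin gtrBl.
  have cS : continuous (fun y : V => \sum_(0 <= k < n0) g k y)%R.
    by apply: bounded_lipschitz_continuous; exact: bounded_lipschitz_sum.
  exists ([set y : V | (1 - e' < \sum_(0 <= k < n0) g k y)%R],
          [set n | (n0 <= n)%N]).
    split; last by exists n0.
    exact: (cvgr_gt _ (cS x) _ n0x).
  move=> [y n] /= [/ltW yn0 n0n]; apply: (le_trans yn0).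
  rewrite [leRHS](big_cat_nat (n := n0))//= lerDl.
  exact: sumr_ge0.
move=> [n _ /(_ n (leqnn n)) hn].
have chi_le x : ((1 - e') * chi x <= \sum_(0 <= k < n) g k x)%R.
  have [xr|xr] := leP (eucl x) r.
    rewrite (le_trans _ (hn x xr))// ler_piMr ?subr_ge0//.
    by have /andP[] := chi01 x.
  by rewrite chir// mulr0; exact: sumr_ge0.
have : ((1 - e') * L chi <= \sum_(0 <= k < n) L (g k))%R.
  rewrite -LZ// -L_sum//; apply: le_L => //; first exact: bounded_lipschitzZ.
  exact: bounded_lipschitz_sum.
have : ((1 - e') * (1 - e') <= (1 - e') * L chi)%R.
  by rewrite ler_wpM2l// subr_ge0.
move=> h1 h2.
apply: (@le_trans _ _ ((\sum_(0 <= k < n) L (g k))%:E + e%:E)).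
  rewrite -EFinD lee_fin; have := sqr_ge0 e'; rewrite expr2; lra.
rewrite leeD2r// -sumEFin; apply: nneseries_lim_ge => k *.
exact: (L_pos k gT).
Qed.

Lemma daniell_outer_caratheodory (m : {outer_measure set V -> \bar R}) :
  m = daniell_outer :> (set V -> \bar R) ->
  <<s (@open V) >> `<=` m.-caratheodory.
Proof.
move=> mE; apply: smallest_sub.
  exact: (@sigma_algebra_measurable _ (caratheodory_type m)).
move=> U oU; apply: le_caratheodory_measurable => X.
by rewrite mE; exact: daniell_outer_open.
Qed.

Lemma daniell_probability :
  exists m : probability (borelRd R d) R, m = daniell_outer :> (set V -> \bar R).
Proof.
have [m mE] := outer_measure_of_function daniell_outer0 daniell_outer_ge0
  le_daniell_outer daniell_outer_sigma_subadditive.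
apply: (@probability_of_function _ (borelRd R d) R daniell_outer).
- exact: daniell_outer0.
- exact: daniell_outer_ge0.
- move=> F mF tF mUF; rewrite -mE.
  apply: (@caratheodory_measure_sigma_additive _ _ m) => //.
    by move=> i; apply: (daniell_outer_caratheodory mE); exact: mF.
  exact: (daniell_outer_caratheodory mE).
- exact: daniell_outer_setT.
Qed.

Local Close Scope ereal_scope.

Section representation.
Variable m : probability (borelRd R d) R.
Hypothesis mE : m = daniell_outer :> (set V -> \bar R).

Let int f : BL f -> m.-integrable setT (EFin \o f).
Proof.
move=> /bounded_lipschitz_Bb bf.
exact: (@Bb_integrable _ _ _ _ m f idfun bf (@measurable_id _ _ _)).
Qed.

Let Rint_sum n (F : nat -> V -> R) : (forall i, BL (F i)) ->
  \int[m]_x (\sum_(0 <= i < n) F i x) = \sum_(0 <= i < n) \int[m]_x F i x.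
Proof.
move=> bF; elim: n => [|n ih].
  rewrite big_geq//; under eq_Rintegral do rewrite big_geq//.
  by rewrite Rintegral_cst// mul0r.
rewrite big_nat_recr//= -ih -RintegralD//.
- by apply: eq_Rintegral => x _; rewrite big_nat_recr.
- by apply: int; exact: bounded_lipschitz_sum.
- exact: int.
Qed.

Let Rint_cst (k : R) : \int[m]_x k = k.
Proof.
by rewrite Rintegral_cst// [X in fine X](_ : _ = 1%E) ?mulr1//;
  exact: probability_setT.
Qed.

(* [n f = \sum_(i < n) clip (n f - i)]; each summand vanishes outside
   [n f > i], where the previous summand is [1]. *)
Lemma daniell_integral_le f : BL f -> (forall x, 0 <= f x <= 1) ->
  \int[m]_x f x <= L f.
Proof.
move=> bf f01; apply/ler_addgt0Pr => e e0.
have [n ne] : exists n : nat, e^-1 <= n.+1%:R.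
  have [n _ /(_ n (leqnn n)) h] := nbhs_infty_ger e^-1.
  by exists n; rewrite (le_trans h)// ler_nat.
pose F i x := clip (n.+1%:R * f x - i%:R).
have bF i : BL (F i).
  have [K [_ fK]] := bf.
  apply: (@bounded_lipschitz_clip _ _ _ (n.+1%:R * K)) => x y.
  rewrite (_ : _ - _ - _ = n.+1%:R * (f x - f y)); last by ring.
  by rewrite normrM ger0_norm// -mulrA ler_wpM2l.
have FE x : \sum_(0 <= i < n.+1) F i x = n.+1%:R * f x.
  rewrite big_mkord sum_clip//; have /andP[fx0 fx1] := f01 x.
  by rewrite mulr_ge0// ler_piMr.
have F0 i x : 0 <= F i x by exact: clip_ge0.
have int0 : \int[m]_x F 0%N x <= 1.
  rewrite -[leRHS]Rint_cst; apply: le_Rintegral => //; first exact: int.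
    by apply: int; exact: bounded_lipschitz_cst.
  by move=> x _; exact: clip_le1.
have intS j : \int[m]_x F j.+1 x <= L (F j).
  pose A := [set x | 0 < F j.+1 x].
  have mA : measurable (A : set (borelRd R d)).
    apply: sub_sigma_algebra; rewrite /A.
    have /continuousP/(_ [set t | 0 < t]) := bounded_lipschitz_continuous (bF j.+1).
    by apply; exact: open_gt.
  apply: (@le_trans _ _ (fine (m A))).
    rewrite -[fine (m A)]/(fine (m A)) -(setIT A) -integral_indic//.
    apply: le_Rintegral => //; first exact: int.
      exact: integrable_indic.
    move=> x _; rewrite indicE; case: (boolP (x \in A)) => xA.
      exact: clip_le1.
    by rewrite leNgt; apply: contra xA; rewrite inE.
  rewrite -lee_fin fineK ?fin_num_measure//; rewrite mE.
  apply: daniell_outer_le1 => // x; rewrite /A /= => Fx.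
  rewrite /F clip_ge1// lerBrDl natr1.
  rewrite leNgt; apply/negP => h; move: Fx; rewrite /F clip_le0 ?ltxx//.
  by rewrite subr_le0 ltW.
(* The shift by one index costs only the first summand, whose integral is at most 1; dividing by
   [n + 1] leaves an error below [e]. *)
have : n.+1%:R * \int[m]_x f x <= 1 + n.+1%:R * L f.
  rewrite -LZ// -RintegralZl//; last exact: int.
  under eq_Rintegral do rewrite -FE.
  rewrite Rint_sum// big_nat_recl//= lerD//.
  apply: (@le_trans _ _ (\sum_(0 <= i < n) L (F i))); first exact: ler_sum.
  have -> : L (fun x => n.+1%:R * f x) = \sum_(0 <= i < n.+1) L (F i).
    by rewrite -L_sum//; congr L; apply/funext => x; rewrite FE.
  by rewrite big_nat_recr//= lerDl L_ge0.
rewrite -ler_pdivlMl// mulrDr mulKf ?pnatr_eq0// mulr1 => /le_trans; apply.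
by rewrite addrC lerD2l -[leRHS]invrK lef_pV2 ?posrE ?invr_gt0.
Qed.

(** The inequality for [1 - f] is the reverse inequality for [f]; a general [f] is first rescaled
    into [[0, 1]]. *)
Lemma daniell_integral f : BL f -> \int[m]_x f x = L f.
Proof.
have key g : BL g -> (forall x, 0 <= g x <= 1) -> \int[m]_x g x = L g.
  move=> bg g01; apply/eqP; rewrite eq_le daniell_integral_le//=.
  have b1g : BL (fun x => 1 - g x).
    by apply: bounded_lipschitzB => //; exact: bounded_lipschitz_cst.
  have /(_ _)/wrap[x|] := daniell_integral_le b1g.
    by have := g01 x; rewrite subr_ge0 gerBl andbC.
  have -> : L (fun x => 1 - g x) = 1 - L g.
    by rewrite LB ?L_cst1//; exact: bounded_lipschitz_cst.
  rewrite (RintegralB measurableT (f1 := cst 1))//.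
  - by rewrite Rint_cst lerD2l lerN2.
  - by apply: int; exact: bounded_lipschitz_cst.
  - exact: int.
move=> bf; have [K [fK _]] := bf.
have K0 : 0 <= K := le_trans (normr_ge0 _) (fK 0).
have K1 : 0 < 2 * (K + 1) by rewrite mulr_gt0// ltr_pwDr.
pose g x := (2 * (K + 1))^-1 * (f x + (K + 1)).
have bfK : BL (fun x => f x + (K + 1)).
  by apply: bounded_lipschitzD => //; exact: bounded_lipschitz_cst.
have bg : BL g by exact: bounded_lipschitzZ.
have := key g bg; rewrite /g LZ// RintegralZl//; last exact: int.
move=> /(_ _)/wrap[x|/mulfI].
  have := fK x; rewrite ler_norml => /andP[h1 h2].
  by rewrite ler_pdivlMl// ler_pdivrMl//; apply/andP; split; lra.
rewrite invr_eq0 gt_eqF// => /(_ isT).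
have -> : L (fun x => f x + (K + 1)) = L f + (K + 1).
  by rewrite LD ?L_cst//; exact: bounded_lipschitz_cst.
rewrite (RintegralD measurableT (f2 := cst (K + 1)))//; last 2 first.
- exact: int.
- by apply: int; exact: bounded_lipschitz_cst.
by rewrite Rint_cst => /addIr.
Qed.

End representation.

Theorem daniell_representation :
  exists m : probability (borelRd R d) R, forall f, BL f -> \int[m]_x f x = L f.
Proof.
have [m mE] := daniell_probability.
by exists m => f; exact: daniell_integral.
Qed.

End daniell.

(** * Measures determined by bounded Lipschitz functions *)

Section bounded_convergence.
Context {disp : measure_display} {T : measurableType disp} {R : realType}.
Variable m : {finite_measure set T -> \bar R}.

Lemma EFin_Rintegral (f : T -> R) : m.-integrable setT (EFin \o f) ->
  (\int[m]_x (f x)%:E)%E = (\int[m]_x f x)%:E.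
Proof. by move=> fi; rewrite /Rintegral fineK// integrable_fin_num. Qed.

Lemma bounded_measurable_integrable (f : T -> R) (K : R) :
  measurable_fun setT f -> (forall x, `|f x| <= K) ->
  m.-integrable setT (EFin \o f).
Proof.
move=> mf fK; apply: measurable_bounded_integrable => //.
  by rewrite -ge0_fin_numE// fin_num_measure.
by apply/bounded_funP; exists K.
Qed.

Lemma bounded_cvg_integral (F : nat -> T -> R) (f : T -> R) (K : R) :
  (forall n, measurable_fun setT (F n)) -> (forall n x, `|F n x| <= K) ->
  (forall x, F n x @[n --> \oo] --> f x) ->
  (fun n => \int[m]_x (F n x)%:E)%E @ \oo --> (\int[m]_x (f x)%:E)%E.
Proof.
move=> mF FK Ff.
have mf : measurable_fun setT f by apply: measurable_fun_cvg mF _ => x _.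
have cF : {ae m, forall x, setT x -> (F n x)%:E @[n --> \oo] --> (f x)%:E}.
  apply: aeW => x _; apply/fine_cvgP; split; [exact: nearW|exact: Ff].
have bF : {ae m, forall x n, setT x -> (`|(F n x)%:E| <= cst K%:E x)%E}.
  by apply: aeW => x n _; rewrite /= lee_fin.
by have [] := @dominated_convergence _ _ _ m setT measurableT
  (fun n x => (F n x)%:E) (EFin \o f) (cst K%:E)
  (fun n => (measurable_EFinP _ _).2 (mF n)) ((measurable_EFinP _ _).2 mf) cF
  (finite_measure_integrable_cst m K measurableT) bF.
Qed.

Lemma bounded_cvg_Rintegral (F : nat -> T -> R) (f : T -> R) (K : R) :
  (forall n, measurable_fun setT (F n)) -> (forall n x, `|F n x| <= K) ->
  (forall x, F n x @[n --> \oo] --> f x) ->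
  \int[m]_x F n x @[n --> \oo] --> \int[m]_x f x.
Proof.
move=> mF FK Ff; have h := bounded_cvg_integral mF FK Ff.
have mf : measurable_fun setT f by apply: measurable_fun_cvg mF _ => x _.
have fK x : `|f x| <= K.
  have : `|F n x| @[n --> \oo] --> `|f x| by apply: cvg_norm; exact: Ff.
  by move/cvgr_to_le; apply; apply: nearW => n.
apply: fine_cvg; rewrite fineK//.
exact: (integrable_fin_num measurableT (bounded_measurable_integrable mf fK)).
Qed.

End bounded_convergence.

Section determination.
Context {R : realType} {d : nat}.
Local Notation V := 'cV[R]_d.

Lemma Cb_lsc (f : V -> R) x e : Cb f -> 0 < e -> \forall y \near x, f x - e <= f y.
Proof.
move=> [cf _] e0; have /cvgrPdist_le/(_ _ e0) := cf x.
by apply: filterS => y; rewrite ler_norml => /andP[_]; rewrite lerBlDr lerBlDl.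
Qed.

Lemma infconv_Rintegral_cvg (m : {finite_measure set (borelRd R d) -> \bar R})
    (f : V -> R) (K : R) : (forall x, 0 <= f x <= K) ->
  (forall x e, 0 < e -> \forall y \near x, f x - e <= f y) ->
  \int[m]_x infconv f n%:R x @[n --> \oo] --> \int[m]_x f x.
Proof.
move=> fK lsc; have f0 x : 0 <= f x by case/andP : (fK x).
have fK' x : f x <= K by case/andP : (fK x).
apply: (@bounded_cvg_Rintegral _ _ _ m _ f K) => [n|n x|x].
- apply: (bounded_lipschitz_Bb _).1; apply: infconv_bounded_lipschitz => //.
  by exists K.
- by rewrite ger0_norm ?infconv_ge0// (le_trans (infconv_le_id _ _ _)).
- by apply: infconv_cvg => // e; exact: lsc.
Qed.

(** Open sets form a generating pi-system, and the indicator of an open set is an increasing limit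
    of bounded Lipschitz functions. *)
Lemma probability_determined (m1 m2 : probability (borelRd R d) R) :
  (forall f : V -> R, bounded_lipschitz f -> \int[m1]_x f x = \int[m2]_x f x) ->
  forall A, measurable A -> m1 A = m2 A.
Proof.
move=> h A mA; apply: (@g_sigma_algebra_measure_unique _ R (borelRd R d) (@open V)
  _ (fun=> setT) _ _ m1 m2 _ _ _ A mA).
- by move=> U oU; exact: sub_sigma_algebra.
- by move=> _; exact: openT.
- by apply/seteqP; split => // x _; exists 0%N.
- exact: openI.
- move=> U oU; have mU : measurable (U : set (borelRd R d)).
    exact: sub_sigma_algebra.
  have U1 (x : V) : 0 <= (\1_U x : R) <= 1.
    by rewrite indicE ler0n lern1 leq_b1.
  have lsc (x : V) (e : R) : 0 < e -> \forall y \near x,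
      (\1_U x : R) - e <= \1_U y.
    by move=> e0; exact: open_indic_lsc.
  have E (m : probability (borelRd R d) R) : \int[m]_x \1_U x = fine (m U).
    by rewrite /Rintegral integral_indic// setIT.
  have bU n : bounded_lipschitz (infconv (\1_U : V -> R) n%:R).
    apply: infconv_bounded_lipschitz => [x||]; [|exact: ler0n|exists 1 => x];
      by case/andP : (U1 x).
  have h1 := @infconv_Rintegral_cvg m1 _ _ U1 lsc.
  have h2 := @infconv_Rintegral_cvg m2 _ _ U1 lsc.
  have : \int[m1]_x (\1_U x : R) = \int[m2]_x (\1_U x : R).
    have fE : (fun n => \int[m2]_x infconv (\1_U : V -> R) n%:R x) =
              (fun n => \int[m1]_x infconv (\1_U : V -> R) n%:R x).
      by apply/funext => n; rewrite h.
    by move: h2; rewrite fE; exact: (cvg_unique (@Rhausdorff R) h1).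
  rewrite !E => e; rewrite -[LHS]fineK ?fin_num_measure//.
  by rewrite -[RHS]fineK ?fin_num_measure// [in LHS]e.
- by move=> _; rewrite -ge0_fin_numE// fin_num_measure.
Qed.

End determination.

(** * The random affine operator and its dual *)

Section random_affine_operator.
Context {R : realType} {d : nat}.
Local Notation V := 'cV[R]_d.
Variable mu : V -> probability (borelG R d) R.
Local Notation P := (random_affine_op mu).
Implicit Types (f : borelRd R d -> R) (x y : V).

Lemma affine_map_integrable f x : Bb f ->
  (mu x).-integrable setT (EFin \o (f \o affine_map x)).
Proof. by move=> bf; apply: Bb_integrable => //; exact: measurable_affine_map. Qed.

Lemma Bb_cst (k : R) : Bb (cst k : borelRd R d -> R).
Proof. by apply: bounded_lipschitz_Bb; exact: bounded_lipschitz_cst. Qed.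

Lemma BbD f g : Bb f -> Bb g -> Bb (fun x => f x + g x).
Proof.
move=> [mf /bounded_funP[K fK]] [mg /bounded_funP[M gM]]; split.
  exact: measurable_funD.
apply/bounded_funP; exists (K + M) => x.
by rewrite (le_trans (ler_normD _ _))// lerD.
Qed.

Lemma BbZ (k : R) f : Bb f -> Bb (fun x => k * f x).
Proof.
move=> [mf /bounded_funP[K fK]]; split; first exact: measurable_funM.
by apply/bounded_funP; exists (`|k| * K) => x; rewrite normrM ler_wpM2l.
Qed.

Lemma random_affine_opD f g x : Bb f -> Bb g ->
  P (fun y => f y + g y) x = P f x + P g x.
Proof.
by move=> bf bg; rewrite /random_affine_op RintegralD//; exact: affine_map_integrable.
Qed.

Lemma random_affine_opZ (k : R) f x : Bb f -> P (fun y => k * f y) x = k * P f x.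
Proof.
by move=> bf; rewrite /random_affine_op RintegralZl//; exact: affine_map_integrable.
Qed.

Lemma random_affine_op_cst (k : R) x : P (cst k) x = k.
Proof.
rewrite /random_affine_op Rintegral_cst// [X in fine X](_ : _ = 1%E) ?mulr1//.
exact: probability_setT.
Qed.

Lemma le_random_affine_op f g x : Bb f -> Bb g -> (forall y, f y <= g y) ->
  P f x <= P g x.
Proof.
by move=> bf bg fg; apply: le_Rintegral => //; exact: affine_map_integrable.
Qed.

Lemma random_affine_op_indic (A : set (borelRd R d)) x : measurable A ->
  (P (\1_A) x)%:E = mu x (affine_map x @^-1` A).
Proof.
move=> mA; have mT : measurable (affine_map x @^-1` A).
  by rewrite -[X in measurable X]setTI; exact: measurable_affine_map.
rewrite /random_affine_op -EFin_Rintegral; last first.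
  by apply: (@affine_map_integrable (\1_A) x); split => //;
    apply/bounded_funP; exists 1 => y; rewrite indicE ger0_norm ?ler0n// lern1 leq_b1.
by rewrite (@integral_indic _ _ _ (mu x) setT _ (affine_map x @^-1` A))// setIT.
Qed.

Lemma norm_random_affine_op_le f (K : R) x : Bb f -> (forall y, `|f y| <= K) ->
  `|P f x| <= K.
Proof.
move=> bf fK; rewrite ler_norml -{1}(random_affine_op_cst (- K) x).
rewrite -{2}(random_affine_op_cst K x).
by apply/andP; split; apply: le_random_affine_op => //; try exact: Bb_cst;
  move=> y; have := fK y; rewrite ler_norml => /andP[].
Qed.

Hypothesis P_continuous : forall f, bounded_lipschitz f -> continuous (P f : V -> R).

(** Dynkin induction from open sets [U], for which [P (\1_U)] is a pointwise limit of the functions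
    [P (infconv (\1_U) n)], continuous by hypothesis. *)
Lemma measurable_random_affine_op_indic (A : set (borelRd R d)) : measurable A ->
  measurable_fun setT (fun x : borelRd R d => mu x (affine_map x @^-1` A)).
Proof.
have mT x B : measurable B -> measurable (affine_map x @^-1` B).
  by move=> mB; rewrite -[X in measurable X]setTI; exact: measurable_affine_map.
move: A; apply: (@dynkin_induction _ (borelRd R d) (@open V)
  [set A | measurable_fun setT (fun x : borelRd R d => mu x (affine_map x @^-1` A))]).
- by [].
- exact: openI.
- rewrite /= (_ : (fun _ => _) = cst 1%E); first exact: measurable_cst.
  by apply/funext => x; rewrite preimage_setT; exact: probability_setT.
- move=> U oU /=; have mU : measurable (U : set (borelRd R d)).
    exact: sub_sigma_algebra.
  have U1 (x : V) : 0 <= (\1_U x : R) <= 1.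
    by rewrite indicE ler0n lern1 leq_b1.
  have lsc (x : V) (e : R) : 0 < e -> \forall y \near x,
      (\1_U x : R) - e <= \1_U y.
    by move=> e0; exact: open_indic_lsc.
  have bU n : bounded_lipschitz (infconv (\1_U : V -> R) n%:R).
    apply: infconv_bounded_lipschitz => [x||]; [|exact: ler0n|exists 1 => x];
      by case/andP : (U1 x).
  rewrite (_ : (fun _ => _) = (fun x => (P (\1_U) x)%:E)); last first.
    by apply/funext => x; rewrite random_affine_op_indic.
  apply/measurable_EFinP.
  apply: (@measurable_fun_cvg _ _ _ _ (fun n => P (infconv (\1_U : V -> R) n%:R))).
    by move=> n; apply: g_sigma_measurable_real; apply/continuousP; exact: P_continuous.
  move=> x _; apply: (@bounded_cvg_Rintegral _ _ _ (mu x) _ _ 1) => [n|n z|z].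
  - apply: (measurableT_comp (bounded_lipschitz_Bb (bU n)).1).
    exact: measurable_affine_map.
  - have /andP[h0 h1] := U1 (affine_map x z).
    have f0 y : 0 <= (\1_U y : R) by case/andP : (U1 y).
    rewrite ger0_norm ?infconv_ge0//.
    exact: (le_trans (infconv_le_id f0 _ (ler0n _ _))).
  - by apply: infconv_cvg => [y|e]; [case/andP : (U1 y)|exact: lsc].
- move=> B mB PB /=.
  rewrite (_ : (fun _ => _) = (fun x => 1 - mu x (affine_map x @^-1` B))%E).
    by apply: emeasurable_funB => //; exact: measurable_cst.
  by apply/funext => x; rewrite preimage_setC probability_setC//; exact: mT.
- move=> F mF tF PF /=.
  rewrite (_ : (fun _ => _) =
      (fun x => \sum_(n <oo) mu x (affine_map x @^-1` F n))%E).
    by apply: ge0_emeasurable_sum => // n _; exact: PF.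
  apply/funext => x; rewrite preimage_bigcup measure_bigcup//.
  - by rewrite eseries_mkcond; apply: eq_eseriesr => n _; rewrite in_setT.
  - by move=> n _; exact: mT.
  - apply/trivIsetP => i j _ _ ij; rewrite -preimage_setI.
    by move/trivIsetP : tF => ->//; rewrite preimage_set0.
Qed.

(** The law of [m x + q] under [mu x], as a point of the Giry space; measurability in [x] then
    yields the dual measure as a [giry_bind]. *)
Definition transition (x : borelRd R d) : giry (borelRd R d) R :=
  giry_map (measurable_affine_map x) (mu x : giry (borelG R d) R).

Lemma measurable_transition : measurable_fun setT transition.
Proof.
apply: measurable_giry_codensity => // B mB.
exact: measurable_random_affine_op_indic.
Qed.

Lemma integral_transition f x : Bb f -> (forall y, 0 <= f y) ->
  (\int[transition x]_y (f y)%:E = (P f x)%:E)%E.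
Proof.
move=> bf f0; have := giry_int_map (measurable_affine_map x) (mu x) (h := EFin \o f).
rewrite /giry_int => ->//.
- by rewrite /random_affine_op -EFin_Rintegral//; exact: affine_map_integrable.
- by apply/measurable_EFinP; exact: bf.1.
Qed.

Lemma Bb_random_affine_op f : Bb f -> Bb (P f).
Proof.
move=> bf; have [K fK] := (bounded_funP _).1 bf.2; split; last first.
  by apply/bounded_funP; exists K => x; exact: norm_random_affine_op_le.
have bfK : Bb (fun x => f x + K) by apply: BbD => //; exact: Bb_cst.
have fK0 x : 0 <= f x + K.
  by have := fK x; rewrite ler_norml -subr_ge0 opprK => /andP[].
have -> : P f = (fun x => P (fun x => f x + K) x - K).
  apply/funext => x; rewrite (random_affine_opD _ bf (Bb_cst K)).
  by rewrite random_affine_op_cst addrK.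
apply: measurable_funB; last exact: measurable_cst.
apply/measurable_EFinP.
rewrite (_ : EFin \o _ = (fun x => \int[transition x]_y (f y + K)%:E)%E); last first.
  by apply/funext => x; rewrite integral_transition.
apply: (measurable_fun_integral_kernel (l := transition)).
- move=> U mU; exact: measurable_random_affine_op_indic.
- by move=> z; rewrite lee_fin.
- by apply/measurable_EFinP; exact: bfK.1.
Qed.

Lemma Bb_iter_random_affine_op f n : Bb f -> Bb (iter n P f).
Proof. by move=> bf; elim: n => //= n ih; exact: Bb_random_affine_op. Qed.

(** The measure [giry_bind] agrees with [dual_op P nu] on measurable sets only. The probability is
    rebuilt on [dual_op P nu] itself, so that the equality holds as set functions and can be
    rewritten under [iter]. *)
Lemma dual_op_probability (nu : probability (borelRd R d) R) :
  exists nu' : probability (borelRd R d) R,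
    nu' = dual_op P nu :> (set (borelRd R d) -> \bar R) /\
    forall f, Bb f -> \int[nu']_x f x = \int[nu]_x P f x.
Proof.
pose B := giry_bind (nu : giry (borelRd R d) R) measurable_transition.
have dualE A : measurable A -> dual_op P nu A = B A.
  move=> mA; have -> : B A = giry_int B (EFin \o \1_A).
    by rewrite /giry_int integral_indic// setIT.
  rewrite /B giry_int_bind//; first last.
    by move=> x; rewrite /= lee_fin indicE.
    by apply/measurable_EFinP; exact: measurable_indic.
  apply: eq_integral => x _; rewrite /giry_int integral_indic// setIT.
  by rewrite random_affine_op_indic.
have [nu' nu'E] : exists nu' : probability (borelRd R d) R,
    nu' = dual_op P nu :> (set (borelRd R d) -> \bar R).
  apply: probability_of_function.
  - by rewrite dualE// measure0.
  - move=> A; apply: integral_ge0 => x _; rewrite lee_fin.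
    by apply: Rintegral_ge0 => z _; rewrite indicE.
  - move=> F mF tF mUF; rewrite dualE//.
    rewrite (_ : (fun _ => _) = (fun n => \sum_(0 <= i < n) B (F i))%E).
      exact: measure_semi_sigma_additive.
    by apply/funext => n; apply: eq_bigr => i _; rewrite dualE.
  - rewrite /dual_op (eq_integral (cst 1%E)).
      by rewrite integral_cst// mul1e; exact: probability_setT.
    by move=> x _; rewrite indicT random_affine_op_cst.
exists nu'; split => //.
have pos f : Bb f -> (forall x, 0 <= f x) -> \int[nu']_x f x = \int[nu]_x P f x.
  move=> bf f0; rewrite /Rintegral (eq_measure_integral B); last first.
    move=> A mA _; exact: (etrans (congr1 (fun m => m A) nu'E) (dualE A mA)).
  congr fine; rewrite -[LHS]/(giry_int B (EFin \o f)) /B giry_int_bind.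
  - by apply: eq_integral => x _; exact: integral_transition.
  - by apply/measurable_EFinP; exact: bf.1.
  - by move=> x; rewrite /= lee_fin.
move=> f bf; have [K fK] := (bounded_funP _).1 bf.2.
have fK0 x : 0 <= f x + K.
  by have := fK x; rewrite ler_norml -subr_ge0 opprK => /andP[].
have int (m : probability (borelRd R d) R) g : Bb g ->
    m.-integrable setT (EFin \o g).
  move=> bg; exact: (@Bb_integrable _ _ _ _ m g idfun bg (@measurable_id _ _ _)).
have cstE (m : probability (borelRd R d) R) : \int[m]_x cst K x = K.
  rewrite Rintegral_cst// [X in fine X](_ : _ = 1%E) ?mulr1//.
  exact: probability_setT.
have := pos (fun x => f x + K) (BbD bf (Bb_cst K)) fK0.
rewrite (RintegralD measurableT (int nu' _ bf) (int nu' _ (Bb_cst K))) cstE.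
under [in RHS]eq_Rintegral do rewrite (random_affine_opD _ bf (Bb_cst K)).
rewrite (RintegralD measurableT (int nu _ (Bb_random_affine_op bf))
  (int nu _ (Bb_random_affine_op (Bb_cst K)))).
under [X in _ = _ + X]eq_Rintegral do rewrite random_affine_op_cst.
by rewrite cstE => /addIr.
Qed.

Lemma iter_dual_op_probability (nu : probability (borelRd R d) R) n :
  exists nu' : probability (borelRd R d) R,
    nu' = iter n (dual_op P) nu :> (set (borelRd R d) -> \bar R) /\
    forall f, Bb f -> \int[nu']_x f x = \int[nu]_x iter n P f x.
Proof.
elim: n => [|n [nu1 [nu1E nu1f]]]; first by exists nu.
have [nu2 [nu2E nu2f]] := dual_op_probability nu1.
exists nu2; split; first by rewrite nu2E nu1E.
by move=> f bf; rewrite nu2f// nu1f ?iterSr//; exact: Bb_random_affine_op.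
Qed.

Lemma invariant_Rintegral (nu : probability (borelRd R d) R) f n :
  invariant_measure P nu -> Bb f -> \int[nu]_x iter n P f x = \int[nu]_x f x.
Proof.
move=> inv bf; elim: n => // n <-.
have [nu' [nu'E nu'f]] := dual_op_probability nu.
have bn := Bb_iter_random_affine_op n bf.
rewrite /= -nu'f// /Rintegral (eq_measure_integral nu)// => A mA _.
exact: (etrans (congr1 (fun m => m A) nu'E) (inv A mA)).
Qed.

End random_affine_operator.

(** * Ergodicity *)

(** With [e n] the tail of the geometric series, [u n - e n] increases and [u n + e n] decreases;
    the supremum of the former lies within [e n] of every [u n]. *)
Lemma geometric_limit {R : realType} (u : nat -> R) (C r : R) :
  0 <= C -> 0 < r < 1 -> (forall n, `|u n.+1 - u n| <= C * r ^+ n) ->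
  exists l, forall n, `|u n - l| <= C * r ^+ n / (1 - r).
Proof.
move=> C0 /andP[r0 r1] h; have r1' : 0 < 1 - r by rewrite subr_gt0.
pose e n := C * r ^+ n / (1 - r).
have e0 n : 0 <= e n by rewrite divr_ge0 ?mulr_ge0 ?exprn_ge0// ltW.
have eS n : e n - e n.+1 = C * r ^+ n.
  by rewrite /e exprS; field; rewrite subr_eq0 gt_eqF.
have lo : {homo (fun n => u n - e n) : n m / (n <= m)%N >-> n <= m}.
  apply/nondecreasing_seqP => n; have := h n; rewrite -(eS n) ler_norml.
  by move=> /andP[+ _]; lra.
have hi : {homo (fun n => u n + e n) : n m / (n <= m)%N >-> m <= n}.
  apply/nonincreasing_seqP => n; have := h n; rewrite -(eS n) ler_norml.
  by move=> /andP[_ +]; lra.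
have lohi n m : u n - e n <= u m + e m.
  have := lo _ _ (leq_maxl n m); have := hi _ _ (leq_maxr n m).
  by have := e0 (maxn n m); lra.
exists (sup (range (fun n => u n - e n))) => n; rewrite ler_norml.
have : u n - e n <= sup (range (fun n => u n - e n)).
  apply: ub_le_sup; last by exists n.
  by exists (u 0%N + e 0%N) => _ [m _ <-].
have : sup (range (fun n => u n - e n)) <= u n + e n.
  by apply: ge_sup; [exists (u 0%N - e 0%N), 0%N|move=> _ [m _ <-]].
by rewrite -/(e n); lra.
Qed.

Lemma continuous_near_dist {R : realType} {T : topologicalType} (g : T -> R) :
  (forall x (e : R), 0 < e -> \forall y \near x, `|g x - g y| <= e) ->
  continuous g.
Proof. by move=> h x; apply/cvgrPdist_le => e; exact: h. Qed.

Section ergodicity.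
Context {R : realType} {d : nat}.
Local Notation V := 'cV[R]_d.
Variable mu : V -> probability (borelG R d) R.
Local Notation P := (random_affine_op mu).
Variables (a c r C1 : R) (D : V -> V -> R).
Hypotheses (a01 : 0 < a < 1) (c0 : 0 <= c) (r01 : 0 < r < 1) (C10 : 0 < C1).
Hypothesis opnorm_mean : forall x, (\int[mu x]_z (opnorm z.1)%:E <= a%:E)%E.
Hypothesis shift_mean : forall x, (\int[mu x]_z (eucl z.2)%:E <= c%:E)%E.
Hypothesis D_le : forall x y, D x y <= 1 + root_norm x + root_norm y.
Hypothesis D_small : forall x (e : R), 0 < e -> \forall y \near x, D x y <= e.
Hypothesis D_lipschitz : forall (f : V -> R) (K : R), 0 < K ->
  (forall x, `|f x| <= K) -> (forall x y, `|f x - f y| <= K * eucl (x - y)) ->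
  forall x y, `|f x - f y| <= K * C1 * D x y.
Hypothesis D_contraction : forall (f : V -> R) (M : R), Bb f -> 0 < M ->
  (forall x y, `|f x - f y| <= M * D x y) ->
  forall x y, `|P f x - P f y| <= M * r * D x y.

Let r0 : 0 < r. Proof. by case/andP : r01. Qed.
Let r1 : r < 1. Proof. by case/andP : r01. Qed.

Let bounded_lipschitz_pos (f : V -> R) : bounded_lipschitz f -> exists K,
  [/\ 0 < K, forall x, `|f x| <= K & forall x y, `|f x - f y| <= K * eucl (x - y)].
Proof.
move=> [K [fK fL]]; have K0 : 0 <= K := le_trans (normr_ge0 _) (fK 0).
exists (K + 1); split => [|x|x y]; first by rewrite ltr_wpDl.
  by rewrite (le_trans (fK x))// lerDl.
by rewrite (le_trans (fL x y))// ler_wpM2r ?eucl_ge0// lerDl.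
Qed.

Lemma contraction_continuous (f : V -> R) :
  bounded_lipschitz f -> continuous (P f : V -> R).
Proof.
move=> bf; have [K [K0 fK fL]] := bounded_lipschitz_pos bf.
apply: continuous_near_dist => x e e0.
have M0 : 0 < K * C1 by exact: mulr_gt0.
have := D_small x (divr_gt0 e0 (mulr_gt0 M0 r0)).
apply: (@filterS _ (nbhs x)) => y Dy.
rewrite (le_trans (D_contraction (bounded_lipschitz_Bb bf) M0
  (D_lipschitz K0 fK fL) x y))//.
by rewrite mulrC -ler_pdivlMr// mulr_gt0.
Qed.

Let BbP (f : V -> R) : Bb f -> Bb (P f).
Proof. exact: Bb_random_affine_op contraction_continuous _. Qed.

Let Bbn (f : V -> R) n : Bb f -> Bb (iter n P f).
Proof. by move=> bf; elim: n => //= n; exact: BbP. Qed.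

Lemma random_affine_op_moment (f : V -> R) (k k' : R) x : Bb f -> 0 <= k ->
  (forall x, f x <= k * eucl x + k') ->
  P f x <= k * (a * eucl x + c) + k'.
Proof.
move=> bf k0 fk.
apply: (@le_trans _ _ (\int[mu x]_z affine_comb k' (k * eucl x) k z)).
  apply: le_Rintegral => //; first exact: affine_map_integrable.
    exact: (affine_comb_integrable opnorm_mean shift_mean).
  move=> z _; rewrite (le_trans (fk _))// /affine_comb /lin_norm /shift_norm.
  have := ler_wpM2l k0 (eucl_affine_map x z); lra.
rewrite (Rintegral_affine_comb (m := mu x)).
- rewrite [X in k' * fine X](_ : _ = 1%E); last exact: probability_setT.
  have kx : 0 <= k * eucl x by rewrite mulr_ge0 ?eucl_ge0.
  have := ler_wpM2l kx (Rintegral_opnorm_le opnorm_mean x).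
  by have := ler_wpM2l k0 (Rintegral_shift_le shift_mean x); rewrite /=; lra.
- exact: (opnorm_integrable opnorm_mean).
- exact: (shift_integrable shift_mean).
Qed.

Lemma iter_random_affine_op_moment (f : V -> R) (k k' : R) n x :
  Bb f -> 0 <= k -> (forall x, f x <= k * eucl x + k') ->
  iter n P f x <= k * (a ^+ n * eucl x + c / (1 - a)) + k'.
Proof.
move=> bf k0 fk; have /andP[a0 a1] := a01.
have a1' : 0 < 1 - a by rewrite subr_gt0.
have h y : iter n P f y <=
    (k * a ^+ n) * eucl y + (k * (c * (1 - a ^+ n) / (1 - a)) + k').
  elim: n y => [|n ih] y /=; first by rewrite expr0 subrr !(mulr0, mul0r) mulr1 add0r.
  apply: le_trans (random_affine_op_moment _ (Bbn n bf) _ ih) _.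
    by rewrite mulr_ge0// exprn_ge0// ltW.
  rewrite le_eqVlt; apply/orP; left; apply/eqP; rewrite exprS.
  by field; rewrite subr_eq0 gt_eqF.
apply: (le_trans (h x)).
have : k * (c * (1 - a ^+ n) / (1 - a)) <= k * (c / (1 - a)).
  rewrite ler_wpM2l// ler_wpM2r ?invr_ge0 ?(ltW a1')// ler_piMr//.
  by rewrite gerBl exprn_ge0// ltW.
lra.
Qed.

Lemma iter_contraction (f : V -> R) K n : 0 < K -> (forall x, `|f x| <= K) ->
  (forall x y, `|f x - f y| <= K * eucl (x - y)) ->
  forall x y, `|iter n P f x - iter n P f y| <= K * C1 * r ^+ n * D x y.
Proof.
move=> K0 fK fL; have bf := bounded_lipschitz_Bb (bounded_lipschitz_of fK fL).
elim: n => [|n ih] x y /=; first by rewrite expr0 mulr1; exact: D_lipschitz.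
rewrite exprSr mulrA; apply: D_contraction => //; first exact: Bbn.
by rewrite !mulr_gt0// exprn_gt0.
Qed.

Let root_norm0 : root_norm (0 : V) = 0.
Proof. by rewrite /root_norm eucl0 sqrtr0. Qed.

(** One more step from the origin moves it to [q], and [D q 0 <= 1 + |q|^(1/2) <= 3/2 + |q|/2],
    whose mean is at most [2 + c]. *)
Lemma iter_step0 (f : V -> R) K n : 0 < K -> (forall x, `|f x| <= K) ->
  (forall x y, `|f x - f y| <= K * eucl (x - y)) ->
  `|iter n.+1 P f 0 - iter n P f 0| <= K * C1 * (2 + c) * r ^+ n.
Proof.
move=> K0 fK fL; have bf := bounded_lipschitz_Bb (bounded_lipschitz_of fK fL).
have := iter_contraction n K0 fK fL; have := Bbn n bf.
rewrite /=; move: (iter n P f) => g bg gD.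
pose M := K * C1 * r ^+ n.
have M0 : 0 < M by rewrite !mulr_gt0// exprn_gt0.
have gz z : `|g (affine_map 0 z) - g 0| <= M * (3 / 2 + shift_norm z / 2).
  apply: (le_trans (gD _ _)); rewrite -/M ler_pM2l//.
  apply: (le_trans (D_le _ _)); rewrite root_norm0 addr0.
  have := root_norm_affine_map 0 z; rewrite root_norm0 mulr0 add0r /shift_norm.
  have := sqrtr_le_young ltr01 (eucl_ge0 z.2); rewrite divr1; lra.
have iU := opnorm_integrable opnorm_mean 0.
have iW := shift_integrable shift_mean 0.
have affE (k0 k2 : R) : \int[mu 0]_z affine_comb k0 0 k2 z =
    k0 + k2 * \int[mu 0]_z shift_norm z.
  rewrite (Rintegral_affine_comb (m := mu 0))// mul0r addr0.
  by rewrite [X in k0 * fine X](_ : _ = 1%E) ?mulr1//; exact: probability_setT.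
have up : P g 0 <= \int[mu 0]_z affine_comb (g 0 + M * (3 / 2)) 0 (M / 2) z.
  apply: le_Rintegral => //; first exact: affine_map_integrable.
    exact: (affine_comb_integrable opnorm_mean shift_mean).
  move=> z _; have := gz z; rewrite ler_norml => /andP[_].
  by rewrite /affine_comb mul0r addr0; lra.
have dn : \int[mu 0]_z affine_comb (g 0 - M * (3 / 2)) 0 (- (M / 2)) z <= P g 0.
  apply: le_Rintegral => //; last first.
  - move=> z _; have := gz z; rewrite ler_norml => /andP[+ _].
    by rewrite /affine_comb mul0r addr0; lra.
  - exact: affine_map_integrable.
  - exact: (affine_comb_integrable opnorm_mean shift_mean).
move: up dn; rewrite !affE.
have := ler_wpM2l (ltW M0) (Rintegral_shift_le shift_mean 0).
rewrite (_ : K * C1 * (2 + c) * r ^+ n = M * (2 + c)); last by rewrite /M; ring.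
by have := mulr_ge0 (ltW M0) c0; rewrite ler_norml; lra.
Qed.

(** The 1 accounts for comparing [x] with the origin, the fraction for the geometric tail at the
    origin. *)
Let C2 : R := C1 * (1 + (2 + c) / (1 - r)).

Let C20 : 0 < C2.
Proof.
apply: mulr_gt0 => //; apply: ltr_pwDl => //.
by apply: divr_ge0; [exact: addr_ge0|rewrite subr_ge0 ltW].
Qed.

Lemma iter_limit (f : V -> R) K : 0 < K -> (forall x, `|f x| <= K) ->
  (forall x y, `|f x - f y| <= K * eucl (x - y)) ->
  exists l, forall n x, `|iter n P f x - l| <= K * C2 * r ^+ n * (1 + root_norm x).
Proof.
move=> K0 fK fL.
have [|l lP] := @geometric_limit _ (fun n => iter n P f 0) (K * C1 * (2 + c)) r _ r01
  (fun n => iter_step0 n K0 fK fL).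
  by rewrite !mulr_ge0 ?addr_ge0// ltW.
exists l => n x.
have M0 : 0 < K * C1 * r ^+ n by rewrite !mulr_gt0// exprn_gt0.
have h1 : `|iter n P f x - iter n P f 0| <= K * C1 * r ^+ n * (1 + root_norm x).
  apply: (le_trans (iter_contraction n K0 fK fL x 0)); rewrite ler_pM2l//.
  by have := D_le x 0; rewrite root_norm0 addr0.
have h2 : K * C1 * (2 + c) * r ^+ n / (1 - r) <=
    K * C1 * r ^+ n * ((2 + c) / (1 - r)) * (1 + root_norm x).
  have -> : K * C1 * (2 + c) * r ^+ n / (1 - r) =
    K * C1 * r ^+ n * ((2 + c) / (1 - r)) by ring.
  rewrite ler_peMr ?lerDl ?sqrtr_ge0// mulr_ge0 ?(ltW M0)//.
  by apply: divr_ge0; [exact: addr_ge0|rewrite subr_ge0 ltW].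
rewrite -(subrK (iter n P f 0) (iter n P f x)) -addrA.
apply: (le_trans (ler_normD _ _)).
apply: (le_trans (lerD h1 (le_trans (lP n) h2))).
by rewrite /C2 le_eqVlt; apply/orP; left; apply/eqP; ring.
Qed.

Definition ergodic_limit (f : V -> R) : R := limn (fun n => iter n P f 0).

Lemma ergodic_limit_rate (f : V -> R) K n x : 0 < K -> (forall x, `|f x| <= K) ->
  (forall x y, `|f x - f y| <= K * eucl (x - y)) ->
  `|iter n P f x - ergodic_limit f| <= K * C2 * r ^+ n * (1 + root_norm x).
Proof.
move=> K0 fK fL; have [l lP] := iter_limit K0 fK fL.
suff -> : ergodic_limit f = l by [].
apply/cvg_lim => //; apply/cvgrPdist_le => e e0.
have h : K * C2 * r ^+ n @[n --> \oo] --> 0.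
  rewrite -(mulr0 (K * C2)); apply: cvgM; [exact: cvg_cst|apply: cvg_expr].
  by rewrite ger0_norm ?(ltW r0).
move/cvgrPdist_le : h => /(_ _ e0); apply: filterS => m.
rewrite sub0r normrN distrC => hm; apply: (le_trans (lP m 0)).
by rewrite root_norm0 addr0 mulr1 (le_trans (ler_norm _)).
Qed.

Lemma ergodic_limit_cvg (f : V -> R) x : bounded_lipschitz f ->
  iter n P f x @[n --> \oo] --> ergodic_limit f.
Proof.
move=> /bounded_lipschitz_pos[K [K0 fK fL]]; apply/cvgrPdist_le => e e0.
have h : K * C2 * (1 + root_norm x) * r ^+ n @[n --> \oo] --> 0.
  rewrite -(mulr0 (K * C2 * (1 + root_norm x))); apply: cvgM; [exact: cvg_cst|apply: cvg_expr].
  by rewrite ger0_norm ?(ltW r0).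
move/cvgrPdist_le : h => /(_ _ e0); apply: filterS => m.
rewrite sub0r normrN distrC => hm.
apply: (le_trans (ergodic_limit_rate m x K0 fK fL)); rewrite mulrAC.
exact: le_trans (ler_norm _) hm.
Qed.

Let iterD (f g : V -> R) n : Bb f -> Bb g ->
  iter n P (fun x => f x + g x) = (fun x => iter n P f x + iter n P g x).
Proof.
move=> bf bg; elim: n => //= n ->; apply/funext => x.
by rewrite random_affine_opD//; exact: Bbn.
Qed.

Let iterZ (k : R) (f : V -> R) n : Bb f ->
  iter n P (fun x => k * f x) = (fun x => k * iter n P f x).
Proof.
move=> bf; elim: n => //= n ->; apply/funext => x.
by rewrite random_affine_opZ//; exact: Bbn.
Qed.

Let iter_cst (k : R) n : iter n P (cst k) = cst k.
Proof.
by elim: n => //= n ->; apply/funext => x; rewrite random_affine_op_cst.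
Qed.

Let iter_le (f g : V -> R) n x : Bb f -> Bb g -> (forall x, f x <= g x) ->
  iter n P f x <= iter n P g x.
Proof.
move=> bf bg fg; elim: n x => //= n ih x.
by apply: le_random_affine_op => //; exact: Bbn.
Qed.

Let iter_bound (f : V -> R) K n x : Bb f -> (forall x, `|f x| <= K) ->
  `|iter n P f x| <= K.
Proof.
move=> bf fK; elim: n x => //= n ih x.
by apply: norm_random_affine_op_le => //; exact: Bbn.
Qed.

Lemma ergodic_limitD (f g : V -> R) : bounded_lipschitz f -> bounded_lipschitz g ->
  ergodic_limit (fun x => f x + g x) = ergodic_limit f + ergodic_limit g.
Proof.
move=> bf bg; apply/cvg_lim => //.
under eq_fun do rewrite (iterD _ (bounded_lipschitz_Bb bf) (bounded_lipschitz_Bb bg)).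
by apply: cvgD; exact: ergodic_limit_cvg.
Qed.

Lemma ergodic_limitZ k (f : V -> R) : bounded_lipschitz f ->
  ergodic_limit (fun x => k * f x) = k * ergodic_limit f.
Proof.
move=> bf; apply/cvg_lim => //.
under eq_fun do rewrite (iterZ _ _ (bounded_lipschitz_Bb bf)).
by apply: cvgM; [exact: cvg_cst|exact: ergodic_limit_cvg].
Qed.

Lemma ergodic_limit_ge0 (f : V -> R) : bounded_lipschitz f ->
  (forall x, 0 <= f x) -> 0 <= ergodic_limit f.
Proof.
move=> bf f0; apply: (cvgr_to_ge (ergodic_limit_cvg 0 bf)).
apply: nearW => n; rewrite -[leLHS](congr1 (fun g => g (0 : V)) (iter_cst 0 n)).
by apply: iter_le => //; [exact: Bb_cst|exact: bounded_lipschitz_Bb].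
Qed.

Lemma ergodic_limit_cst1 : ergodic_limit (cst 1) = 1.
Proof.
apply/cvg_lim => //; under eq_fun do rewrite iter_cst.
exact: cvg_cst.
Qed.

Lemma ergodic_limit_moment (f : V -> R) k k' : bounded_lipschitz f -> 0 <= k ->
  (forall x, f x <= k * eucl x + k') -> ergodic_limit f <= k * (c / (1 - a)) + k'.
Proof.
move=> bf k0 fk; apply: (cvgr_to_le (ergodic_limit_cvg 0 bf)).
apply: nearW => n.
have := iter_random_affine_op_moment n 0 (bounded_lipschitz_Bb bf) k0 fk.
by rewrite eucl0 mulr0 add0r.
Qed.

Lemma ergodic_limit_tight (e : R) : 0 < e -> exists (chi : V -> R) s,
  [/\ bounded_lipschitz chi, forall x, 0 <= chi x <= 1,
      forall x, s < eucl x -> chi x = 0 & 1 - e <= ergodic_limit chi].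
Proof.
move=> e0; have a1 : 0 < 1 - a by case/andP : a01; rewrite subr_gt0.
(* Markov's inequality: [1 - chi <= k |x|], and [c / (1 - a)] bounds the limiting first moment. The
   added 1 keeps the denominator positive when [c = 0]. *)
pose k := e / (c / (1 - a) + 1).
have k1 : 0 < c / (1 - a) + 1.
  by rewrite ltr_wpDl// divr_ge0// ltW.
have k0 : 0 < k by rewrite divr_gt0.
pose chi (x : V) := clip (1 + k^-1 - eucl x).
have bchi : bounded_lipschitz chi.
  apply: (@bounded_lipschitz_clip _ _ _ 1) => x y; rewrite mul1r.
  rewrite opprB addrA addrAC (_ : _ - _ + _ = eucl y - eucl x); last by ring.
  by rewrite distrC eucl_dist_dist.
exists chi, (1 + k^-1); split => //.
- by move=> x; rewrite clip_ge0 clip_le1.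
- by move=> x sx; rewrite /chi clip_le0// subr_le0 ltW.
have b1 : bounded_lipschitz (fun x => 1 + -1 * chi x).
  apply: bounded_lipschitzD; first exact: bounded_lipschitz_cst.
  exact: bounded_lipschitzZ.
have chi_le x : 1 + -1 * chi x <= k * eucl x + 0.
  rewrite addr0; have [xk|xk] := leP (eucl x) k^-1.
    rewrite /chi clip_ge1; last by lra.
    by rewrite mulr1 subrr mulr_ge0 ?eucl_ge0// ltW.
  apply: (@le_trans _ _ 1); first by rewrite mulN1r gerBl clip_ge0.
  by rewrite mulrC -ler_pdivrMr// div1r ltW.
have := ergodic_limit_moment b1 (ltW k0) chi_le.
rewrite ergodic_limitD//; first last.
- exact: bounded_lipschitzZ.
- exact: bounded_lipschitz_cst.
rewrite ergodic_limit_cst1 ergodic_limitZ// addr0 mulN1r.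
have : k * (c / (1 - a)) <= e.
  rewrite /k mulrAC ler_pdivrMr// ler_wpM2l// ?(ltW e0)//.
  by rewrite lerDl.
by lra.
Qed.


Theorem ergodic_limit_measure : exists m : probability (borelRd R d) R,
  forall f : V -> R, bounded_lipschitz f -> \int[m]_x f x = ergodic_limit f.
Proof.
apply: daniell_representation.
- exact: ergodic_limitD.
- by move=> k f; exact: ergodic_limitZ.
- exact: ergodic_limit_ge0.
- exact: ergodic_limit_cst1.
- exact: ergodic_limit_tight.
Qed.

Section stationary.
Variable mustar : probability (borelRd R d) R.
Hypothesis mustarE : forall f : V -> R, bounded_lipschitz f ->
  \int[mustar]_x f x = ergodic_limit f.
Implicit Types (m : probability (borelRd R d) R).

Let Rintegral_cst1 m (k : R) : \int[m]_x cst k x = k.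
Proof.
by rewrite Rintegral_cst// [X in fine X](_ : _ = 1%E) ?mulr1//; exact: probability_setT.
Qed.

Let Bb_integ m f : Bb f -> m.-integrable setT (EFin \o f).
Proof.
move=> [mf /bounded_funP[K fK]]; exact: bounded_measurable_integrable mf fK.
Qed.

Lemma bounded_lipschitz_attracted m (f : V -> R) : bounded_lipschitz f ->
  \int[m]_x iter n P f x @[n --> \oo] --> \int[mustar]_x f x.
Proof.
move=> bf; have [K [K0 fK _]] := bounded_lipschitz_pos bf.
rewrite mustarE// -(Rintegral_cst1 m (ergodic_limit f)).
apply: (@bounded_cvg_Rintegral _ _ _ m (fun n => iter n P f) _ K) => [n|n x|x].
- by have [] := Bbn n (bounded_lipschitz_Bb bf).
- by apply: iter_bound => //; exact: bounded_lipschitz_Bb.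
- exact: ergodic_limit_cvg.
Qed.

(** [P] is positive, so a Lipschitz minorant of [f] with almost the same [mustar] integral transfers
    its limit to [f] as a lower bound. *)
Lemma lsc_attracted_below m (f : V -> R) (K e : R) : Cb f ->
  (forall x, 0 <= f x <= K) -> 0 < e ->
  \forall n \near \oo, \int[mustar]_x f x - e <= \int[m]_x iter n P f x.
Proof.
move=> cf fK e0.
have f0 x : 0 <= f x by case/andP : (fK x).
have fK' x : f x <= K by case/andP : (fK x).
have e20 : 0 < e / 2 by rewrite divr_gt0.
have lsc x e' : 0 < e' -> \forall y \near x, f x - e' <= f y by exact: Cb_lsc.
have /cvgrPdist_le/(_ _ e20)[k _ hk] := @infconv_Rintegral_cvg _ _ mustar f K fK lsc.
have := hk k (leqnn k); rewrite /= ler_norml => /andP[_ {}hk].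
have bg : bounded_lipschitz (infconv f k%:R).
  by apply: infconv_bounded_lipschitz => //; exists K.
have /cvgrPdist_le/(_ _ e20) := bounded_lipschitz_attracted m bg.
apply: filterS => n; rewrite ler_norml => /andP[_ hn].
have bg' := bounded_lipschitz_Bb bg; have bf := Cb_Bb cf.
have : \int[m]_x iter n P (infconv f k%:R) x <= \int[m]_x iter n P f x.
  apply: le_Rintegral => //; [exact: (Bb_integ _ (Bbn n bg'))|exact: (Bb_integ _ (Bbn n bf))|].
  by move=> x _; apply: iter_le => // y; exact: infconv_le_id.
lra.
Qed.

(** The lower bound is applied to [K + f] and to [K - f], both non-negative; the second gives the
    upper bound. *)
Lemma Cb_attracted m (f : V -> R) : Cb f ->
  \int[m]_x iter n P f x @[n --> \oo] --> \int[mustar]_x f x.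
Proof.
move=> cf; have [K fK] := (bounded_funP _).1 cf.2; have bf := Cb_Bb cf.
have affine m' (s : R) n : \int[m']_x iter n P (fun y => s * f y + K) x =
    s * \int[m']_x iter n P f x + K.
  rewrite (iterD _ (BbZ s bf) (Bb_cst K)) (iterZ _ _ bf) iter_cst.
  rewrite RintegralD//; last 2 first.
  - exact: Bb_integ (BbZ _ (Bbn n bf)).
  - exact: Bb_integ (Bb_cst K).
  by rewrite RintegralZl// ?Rintegral_cst1//; exact: Bb_integ (Bbn n bf).
have Caff (s : R) : Cb (fun y => s * f y + K).
  split; last by have [] := BbD (BbZ s bf) (Bb_cst K).
  by move=> x; exact: (cvgD (cvgM (cvg_cst s) (cf.1 x)) (cvg_cst K)).
have bound (s : R) : `|s| = 1 -> forall x, 0 <= s * f x + K <= K + K.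
  by move=> s1 x; have := fK x; rewrite -[`|f x|]mul1r -s1 -normrM ler_norml; lra.
apply/cvgrPdist_le => e e0.
have n1 : `|1 : R| = 1 by exact: normr1.
have n1' : `|-1 : R| = 1 by rewrite normrN1.
have := lsc_attracted_below m (Caff 1) (bound _ n1) e0.
have := lsc_attracted_below m (Caff (-1)) (bound _ n1') e0.
apply: filterS2 => n; rewrite !affine.
rewrite (affine mustar (-1) 0%N) (affine mustar 1 0%N) /= ler_norml; lra.
Qed.

Lemma ergodic_attractive : attractive P mustar.
Proof.
move=> f m cf; have bf := Cb_Bb cf.
rewrite EFin_Rintegral; last exact: Bb_integ.
under eq_fun do rewrite (EFin_Rintegral (Bb_integ m (Bbn _ bf))).
by apply/fine_cvgP; split; [exact: nearW|exact: Cb_attracted].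
Qed.

(** The integrals of [P^n (P f)] against [mustar] tend to the integral of [P f], which is bounded
    and continuous; being a shift of the sequence for [f], they also tend to the integral of [f]. *)
Lemma ergodic_invariant : invariant_measure P mustar.
Proof.
have [nu' [nu'E nu'f]] := dual_op_probability contraction_continuous mustar.
move=> A mA; rewrite -nu'E; apply: probability_determined A mA => f bf.
have bf' := bounded_lipschitz_Bb bf; rewrite nu'f//.
have CPf : Cb (P f) by split; [exact: contraction_continuous|exact: (BbP bf').2].
have h1 := Cb_attracted mustar CPf.
have h2 := bounded_lipschitz_attracted mustar bf.
apply: (cvg_unique _ h1) => //.
move: h2; rewrite -(cvg_shiftS (fun n => \int[mustar]_x iter n P f x)).
by under eq_fun do under eq_fun do rewrite iterSr.
Qed.

Lemma ergodic_unique m : invariant_measure P m ->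
  forall A, measurable A -> m A = mustar A.
Proof.
move=> inv; apply: probability_determined => f bf.
have := bounded_lipschitz_attracted m bf.
under eq_fun do rewrite (invariant_Rintegral contraction_continuous _ inv
  (bounded_lipschitz_Bb bf)).
by move=> h; apply: cvg_unique h => //; exact: cvg_cst.
Qed.

(** The truncations [min |x| n] are bounded Lipschitz with integrals at most [c / (1 - a)]; monotone
    convergence removes the truncation. *)
Lemma ergodic_first_moment : (first_moment mustar < +oo)%E.
Proof.
pose g n (x : V) := Num.min (eucl x) n%:R.
have bg n : bounded_lipschitz (g n).
  apply: (@bounded_lipschitz_of _ _ _ n%:R 1) => [x|x y].
    by rewrite ger0_norm ?le_min ?eucl_ge0 ?ler0n// ge_min lexx orbT.
  rewrite mul1r; apply: le_trans (eucl_dist_dist x y); rewrite /g.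
  have [h|h] := leP (eucl x) n%:R; have [h'|h'] := leP (eucl y) n%:R; rewrite ?subrr ?normr0//.
    by rewrite !ler0_norm; lra.
  by rewrite !ger0_norm; lra.
have mg n : measurable_fun setT (fun x : borelRd R d => (g n x)%:E).
  by apply/measurable_EFinP; exact: (bounded_lipschitz_Bb (bg n)).1.
have g0 n (x : borelRd R d) : setT x -> (0 <= (g n x)%:E)%E.
  by move=> _; rewrite lee_fin le_min eucl_ge0 ler0n.
have gn (x : borelRd R d) : setT x ->
    {homo (fun n => (g n x)%:E) : i j / (i <= j)%N >-> (i <= j)%E}.
  move=> _ i j ij; rewrite lee_fin le_min ge_min lexx/=.
  by rewrite ge_min ler_nat ij orbT.
have limE (x : borelRd R d) : limn (fun n => (g n x)%:E) = (eucl x)%:E.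
  apply/cvg_lim => //; apply/fine_cvgP; split; first exact: nearW.
  apply: cvg_near_cst; near=> n; rewrite /= /g min_l//.
  by near: n; exact: nbhs_infty_ger.
have := cvg_monotone_convergence measurableT mg g0 gn (mu := mustar).
under eq_integral do rewrite limE.
move=> h; apply: (@le_lt_trans _ _ (c / (1 - a))%:E); last exact: ltry.
rewrite /first_moment -(cvg_lim _ h)//; apply: lime_le.
  by apply/cvg_ex; exists (\int[mustar]_x (eucl x)%:E)%E.
apply: nearW => n; rewrite EFin_Rintegral; last exact: Bb_integ (bounded_lipschitz_Bb (bg n)).
rewrite lee_fin mustarE// -[leRHS]mul1r -[leRHS]addr0.
by apply: ergodic_limit_moment => // x; rewrite mul1r addr0 ge_min lexx.
Unshelve. all: by end_near. Qed.

(** The pointwise rate with [K = 1] is integrated against [m]; the factor 2 comes from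
    [1 + |x|^(1/2) <= 2 (1 + |x|)]. *)
Lemma ergodic_rate m n : (FM_dist (iter n (dual_op P) m) mustar <=
  (r ^+ n * (2 * C2))%:E * (1 + first_moment m))%E.
Proof.
have [m' [m'E m'f]] := iter_dual_op_probability contraction_continuous m n.
rewrite -m'E; apply: ge_ereal_sup => _ [f [cf fL f1] <-].
have bf := Cb_Bb cf.
have bl : bounded_lipschitz f.
  by apply: (@bounded_lipschitz_of _ _ _ 1 1) => // x y; rewrite mul1r.
have fL' x y : `|f x - f y| <= 1 * eucl (x - y) by rewrite mul1r.
pose h x := iter n P f x - ergodic_limit f.
have bh : Bb h by apply: BbD; [exact: Bbn|exact: (Bb_cst (- ergodic_limit f))].
have -> : (\int[m']_x (f x)%:E - \int[mustar]_x (f x)%:E = \int[m]_x (h x)%:E)%E.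
  rewrite !EFin_Rintegral; [|exact: Bb_integ..].
  rewrite m'f// mustarE// -EFinB; congr _%:E.
  by rewrite /h RintegralB//; [rewrite Rintegral_cst1|exact: Bb_integ (Bbn n bf)|
    exact: Bb_integ (Bb_cst _)].
have mh : measurable_fun setT (EFin \o h) by apply/measurable_EFinP; exact: bh.1.
apply: (le_trans (le_abse_integral m measurableT mh)).
have k0 : 0 <= r ^+ n * (2 * C2).
  exact: (mulr_ge0 (exprn_ge0 n (ltW r0)) (mulr_ge0 (ler0n _ 2) (ltW C20))).
have mE : measurable_fun setT (fun x : borelRd R d => (eucl x)%:E).
  by apply/measurable_EFinP; exact: measurable_eucl.
apply: (@le_trans _ _ (\int[m]_x ((r ^+ n * (2 * C2))%:E * (1 + (eucl x)%:E)))%E).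
  apply: ge0_le_integral => //.
  - by apply: measurableT_comp.
  - by apply: measurable_funeM; exact: emeasurable_funD.
  move=> x _; rewrite /= lee_fin; apply: (le_trans (ergodic_limit_rate n x ltr01 f1 fL')).
  have := sqrtr_le_young ltr01 (eucl_ge0 x); rewrite -/(root_norm x) divr1.
  rewrite mul1r (_ : r ^+ n * _ * _ = C2 * r ^+ n * (2 * (1 + eucl x))); last by ring.
  have e0 := eucl_ge0 x; move=> yo; rewrite ler_wpM2l//; last by lra.
  exact: (mulr_ge0 (ltW C20) (exprn_ge0 n (ltW r0))).
rewrite ge0_integralZl//; last 2 first.
- exact: emeasurable_funD.
- by move=> x _; rewrite adde_ge0// lee_fin eucl_ge0.
rewrite ge0_integralD//; last by move=> x _; rewrite lee_fin eucl_ge0.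
by rewrite integral_cst// mul1e [X in (_ * (X + _))%E](_ : _ = 1%E)//; exact: probability_setT.
Qed.

End stationary.

Theorem contraction_ergodic :
  (forall f, Bb f -> Bb (P f)) /\
  exists mustar : probability (borelRd R d) R,
    [/\ invariant_measure P mustar,
        (first_moment mustar < +oo)%E,
        (forall nu : probability (borelRd R d) R, invariant_measure P nu ->
           forall A, measurable A -> nu A = mustar A),
        attractive P mustar &
        exists s C : R, [/\ 0 < s < 1, 0 < C &
          forall (nu : probability (borelRd R d) R) (n : nat),
            (first_moment nu < +oo)%E ->
            (FM_dist (iter n (dual_op P) nu) mustar
              <= (s ^+ n * C)%:E * (1 + first_moment nu))%E]].
Proof.
split; first exact: BbP.
have [mustar mustarE] := ergodic_limit_measure; exists mustar; split.
- exact: ergodic_invariant.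
- exact: ergodic_first_moment.
- by move=> nu; exact: ergodic_unique.
- exact: ergodic_attractive.
- exists r, (2 * C2); split=> [//||nu n _]; last exact: ergodic_rate.
  exact: mulr_gt0.
Qed.

End ergodicity.

(** * The cost as a distance *)

Section cost_metric.
Context {R : realType} {d : nat}.
Variables (p : R) (q : nat) (N beta : R).
Hypotheses (p01 : 0 < p <= 2^-1) (N1 : 1 <= N) (beta01 : 0 < beta <= 1).
Local Notation D := (@cost R d p q N beta).

Let p0 : 0 < p. Proof. by case/andP : p01. Qed.
Let p1 : p <= 1.
Proof. by case/andP : p01 => _ h; rewrite (le_trans h)// invf_le1// ler1n. Qed.
Let N0 : 0 < N. Proof. exact: lt_le_trans ltr01 N1. Qed.
Let b0 : 0 <= beta. Proof. by case/andP : beta01 => /ltW. Qed.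

Let scale_ge0 (x y : 'cV[R]_d) : 0 <= N * eucl (x - y) `^ p.
Proof. by rewrite mulr_ge0 ?powR_ge0// ltW. Qed.

Let weight_le (x y : 'cV[R]_d) : 1 <= 1 + beta * (root_norm x + root_norm y)
  <= 1 + root_norm x + root_norm y.
Proof.
have w0 : 0 <= root_norm x + root_norm y by rewrite addr_ge0 ?sqrtr_ge0.
rewrite lerDl mulr_ge0//= -addrA lerD2l ler_piMl//.
by case/andP : beta01.
Qed.

Lemma cost_le_root_norm x y : D x y <= 1 + root_norm x + root_norm y.
Proof.
have /andP[w1 w2] := weight_le x y; apply: le_trans w2.
by rewrite ler_piMl ?satur_le1// (le_trans _ w1).
Qed.

Lemma cost_near x (e : R) : 0 < e -> \forall y \near x, D x y <= e.
Proof.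
(* [W] bounds the weight at all [y] within distance 1 of [x], which is why the radius is capped at
   1. *)
move=> e0; pose W := 3 + eucl x.
have W0 : 0 < W by rewrite ltr_pwDl ?eucl_ge0.
have k0 : 0 < e / (N * W) by rewrite divr_gt0// mulr_gt0.
have t0 : 0 < Num.min 1 ((e / (N * W)) `^ p^-1) by rewrite lt_min ltr01 powR_gt0.
have cx : continuous (fun y : 'cV[R]_d => eucl (x - y)).
  apply: (@le_norm_continuous _ _ _ _ d%:R) => y z.
  rewrite (le_trans (eucl_dist_dist _ _))// opprB addrC subrKA.
  by rewrite -opprB euclN eucl_le_norm.
have /cvgrPdist_le/(_ _ t0) := cx x.
apply: (@filterS _ (nbhs x)) => y; rewrite subrr eucl0 sub0r normrN.
rewrite ger0_norm ?eucl_ge0// le_min => /andP[y1 yk].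
have wW : 1 + beta * (root_norm x + root_norm y) <= W.
  have /andP[_ w] := weight_le x y; apply: (le_trans w).
  have := sqrtr_le_young ltr01 (eucl_ge0 x).
  have := sqrtr_le_young ltr01 (eucl_ge0 y).
  have := ler_norm (eucl y - eucl x); have := eucl_dist_dist y x.
  by rewrite eucl_distC /root_norm /W !divr1; lra.
have tk : eucl (x - y) `^ p <= e / (N * W).
  rewrite (le_trans (ge0_ler_powR (ltW p0) _ _ yk)) ?nnegrE ?eucl_ge0 ?powR_ge0//.
  by rewrite -powRrM mulVf ?gt_eqF// powRr1// ltW.
apply: (@le_trans _ _ (N * eucl (x - y) `^ p * W)).
  apply: ler_pM => //; first exact: satur_ge0.
    by have /andP[w _] := weight_le x y; rewrite (le_trans _ w).
  exact: satur_le_id.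
by rewrite mulrAC mulrC -ler_pdivlMr// mulr_gt0.
Qed.

Hypothesis q1 : 2^-1 ^+ q < (1 : R).

(** For [s <= 1] the distance is at most 1, so [|x - y| <= |x - y|^p <= s] by [N >= 1], and [satur]
    is [(1 - 2^-q) s]. For [s > 1] the bound [2 K] is compared with [satur >= 1 - 2^-q]. *)
Lemma bounded_lipschitz_cost (f : 'cV[R]_d -> R) (K : R) : 0 < K ->
  (forall x, `|f x| <= K) -> (forall x y, `|f x - f y| <= K * eucl (x - y)) ->
  forall x y, `|f x - f y| <= K * (2 / (1 - 2^-1 ^+ q)) * D x y.
Proof.
move=> K0 fK fL x y; have k0 : 0 < 1 - (2^-1 : R) ^+ q by rewrite subr_gt0.
suff h : `|f x - f y| <= K * (2 / (1 - 2^-1 ^+ q)) * satur q (N * eucl (x - y) `^ p).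
  apply: (le_trans h); rewrite /cost mulrA ler_peMr//; last by case/andP : (weight_le x y).
  by rewrite mulr_ge0 ?satur_ge0// mulr_ge0 ?(ltW K0)// divr_ge0// ltW.
rewrite -mulrA; have [s1|s1] := leP (N * eucl (x - y) `^ p) 1.
  apply: (le_trans (fL x y)); rewrite ler_pM2l// /satur s1 mulrA divfK ?gt_eqF//.
  have [->|t0] := eqVneq (eucl (x - y)) 0; first by rewrite powR0 ?gt_eqF// !mulr0.
  have {}t0 : 0 < eucl (x - y) by rewrite lt_neqAle eq_sym t0 eucl_ge0.
  have t1 : eucl (x - y) <= 1.
    rewrite leNgt; apply/negP => t1; move: s1; apply/negP; rewrite -ltNge.
    rewrite (lt_le_trans _ (ler_peMl (powR_ge0 _ _) N1))//.
    rewrite -[ltLHS](congr1 (fun g => g p) (powR1 R)); apply: gt0_ltr_powR => //; rewrite nnegrE//.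
    exact: ltW.
  have tp : eucl (x - y) <= eucl (x - y) `^ p by apply: ger1_powR => //; rewrite t0.
  have tN := ler_peMl (powR_ge0 (eucl (x - y)) p) N1; lra.
apply: (@le_trans _ _ (K * 2)).
  rewrite (le_trans (ler_normB _ _))//; have := fK x; have := fK y; lra.
by rewrite ler_pM2l// -mulrA ler_peMr// ler_pdivlMl// mulr1 satur_ge_far// ltW.
Qed.

End cost_metric.

(** * Choice of the constants and conclusion *)

Section random_affine.
Context {R : realType} {d : nat}.
Variables (mu : 'cV[R]_d -> probability (borelG R d) R) (a c l p delta : R).
Hypotheses (a01 : 0 < a < 1) (c0 : 0 <= c) (l0 : 0 < l) (p01 : 0 < p <= 2^-1)
  (delta0 : 0 < delta).
Hypothesis opnorm_mean : forall x, (\int[mu x]_z (opnorm z.1)%:E <= a%:E)%E.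
Hypothesis shift_mean : forall x, (\int[mu x]_z (eucl z.2)%:E <= c%:E)%E.
Hypothesis overlap : forall x y : 'cV[R]_d,
  exists kappa : {finite_measure set (borelG R d) -> \bar R},
    [/\ measure_le kappa (mu x), measure_le kappa (mu y),
        1 - fine (kappa setT) <= l * eucl (x - y) `^ (p * 2) &
        delta <= fine (kappa [set z | opnorm z.1 <= a])].

Theorem random_affine_ergodic :
  (forall f, Bb f -> Bb (random_affine_op mu f)) /\
  exists mustar : probability (borelRd R d) R,
    [/\ invariant_measure (random_affine_op mu) mustar,
        (first_moment mustar < +oo)%E,
        (forall nu : probability (borelRd R d) R,
           invariant_measure (random_affine_op mu) nu ->
           forall A, measurable A -> nu A = mustar A),
        attractive (random_affine_op mu) mustar &
        exists s C : R, [/\ 0 < s < 1, 0 < C &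
          forall (nu : probability (borelRd R d) R) (n : nat),
            (first_moment nu < +oo)%E ->
            (FM_dist (iter n (dual_op (random_affine_op mu)) nu) mustar
              <= (s ^+ n * C)%:E * (1 + first_moment nu))%E]].
Proof.
have /andP[a0 a1] := a01; have /andP[p0 ph] := p01.
have rho01 : 0 < a `^ p < 1.
  rewrite powR_gt0//= -[ltRHS](congr1 (fun g => g p) (powR1 R)).
  by apply: gt0_ltr_powR; rewrite ?nnegrE// ltW.
have gam01 : 0 < Num.sqrt a < 1.
  by rewrite sqrtr_gt0 a0/= -[ltRHS]sqrtr1 ltr_sqrt.
have de01 : 0 < Num.min delta 1 <= 1 by rewrite lt_min delta0 ltr01 ge_min lexx orbT.
have overlap' x y : exists kappa : {finite_measure set (borelG R d) -> \bar R},
    [/\ measure_le kappa (mu x), measure_le kappa (mu y),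
        1 - fine (kappa setT) <= l * eucl (x - y) `^ (p * 2) &
        Num.min delta 1 <= fine (kappa [set z | opnorm z.1 <= a])].
  have [kappa [kx ky kT kd]] := overlap x y; exists kappa; split => //.
  by rewrite ge_min kd.
have [q [N [beta [r [N1 beta01 r01 [q1 near_cond far_cond]]]]]] :=
  contraction_constants rho01 gam01 de01 c0 (sqrtr_ge0 l) (ltW p0).
have N0 : 0 < N := lt_le_trans ltr01 N1.
have C10 : 0 < 2 / (1 - 2^-1 ^+ q) :> R by rewrite divr_gt0// subr_gt0.
exact: (contraction_ergodic a01 c0 r01 C10 opnorm_mean shift_mean
  (cost_le_root_norm p q N1 beta01) (cost_near q p01 N1 beta01)
  (bounded_lipschitz_cost p01 N1 beta01 q1)
  (contraction_scaled a01 c0 l0 p01 opnorm_mean shift_mean overlap' N0 beta01 r01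
    near_cond far_cond)).
Qed.

End random_affine.

Local Open Scope ereal_scope.

Theorem corollary4p1 (R : realType) (d : nat) (d_gt0 : (0 < d)%N)
    (mu : 'cV[R]_d -> probability (borelG R d) R)
    (alpha c : \bar R)
    (alphaE : alpha =
       ereal_sup (range (fun x : 'cV[R]_d => \int[mu x]_z (opnorm z.1)%:E)))
    (alpha_lt1 : alpha < 1)
    (cE : c =
       ereal_sup (range (fun x : 'cV[R]_d => \int[mu x]_z (eucl z.2)%:E)))
    (c_fin : c < +oo)
    (mu_holder : exists l nu : R, [/\ (0 < l)%R, (0 < nu <= 1)%R &
       forall x y : 'cV[R]_d,
         tv_norm (measure_diff (mu x) (mu y)) <= (l * eucl (x - y) `^ nu)%:E])
    (mu_overlap : exists delta : R, (0 < delta)%R /\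
       forall x y : 'cV[R]_d,
         exists kappa : {finite_measure set (borelG R d) -> \bar R},
           is_meet (mu x) (mu y) kappa /\
           delta%:E < kappa [set z | (opnorm z.1)%:E <= alpha]) :
  let P := random_affine_op mu in
  (forall f, Bb f -> Bb (P f)) /\
  exists mustar : probability (borelRd R d) R,
    [/\ invariant_measure P mustar,
        first_moment mustar < +oo,
        (forall nu : probability (borelRd R d) R, invariant_measure P nu ->
           forall A, measurable A -> nu A = mustar A),
        attractive P mustar &
        exists r C : R, [/\ (0 < r < 1)%R, (0 < C)%R &
          forall (nu : probability (borelRd R d) R) (n : nat),
            first_moment nu < +oo ->
            FM_dist (iter n (dual_op P) nu) mustar
              <= (r ^+ n * C)%:E * (1 + first_moment nu)]].
Proof.
have [l [nu [l0 /andP[nu0 nu1] holder]]] := mu_holder.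
have [delta [delta0 overlap]] := mu_overlap.
have alpha_ub x : \int[mu x]_z (opnorm z.1)%:E <= alpha.
  by rewrite alphaE; apply: ereal_sup_ubound; exists x.
have c_ub x : \int[mu x]_z (eucl z.2)%:E <= c.
  by rewrite cE; apply: ereal_sup_ubound; exists x.
have alpha_ge0 : 0 <= alpha.
  by apply: le_trans (alpha_ub 0%R); apply: integral_ge0 => z _; rewrite lee_fin opnorm_ge0.
have c_ge0 : 0 <= c.
  by apply: le_trans (c_ub 0%R); apply: integral_ge0 => z _; rewrite lee_fin eucl_ge0.
have alpha_fin : alpha \is a fin_num.
  by rewrite ge0_fin_numE// (lt_trans alpha_lt1)// ltry.
have cfin : c \is a fin_num by rewrite ge0_fin_numE.
(* The lower bound [1/2] keeps [a] positive, as the tangents at [a] and the divisions by [sqrt a]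
   require; the set [||m|| <= a] only grows. *)
pose a := Num.max (fine alpha) 2^-1%R.
have a01 : (0 < a < 1)%R.
  rewrite lt_max invr_gt0 ltr0n orbT/= gt_max -lte_fin fineK// alpha_lt1/=.
  by rewrite invf_lt1// ltr1n.
have alpha_a : alpha <= a%:E by rewrite -[leLHS]fineK// lee_fin le_max lexx.
have opnorm_mean x : \int[mu x]_z (opnorm z.1)%:E <= a%:E := le_trans (alpha_ub x) alpha_a.
have shift_mean x : \int[mu x]_z (eucl z.2)%:E <= (fine c)%:E by rewrite fineK.
have c0 : (0 <= fine c)%R by exact: fine_ge0.
have p01 : (0 < nu / 2 <= 2^-1)%R.
  by rewrite divr_gt0//= ler_pdivrMr// mulVf.
apply: (random_affine_ergodic a01 c0 l0 p01 delta0 opnorm_mean shift_mean) => x y.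
have [kappa [meet kd]] := overlap x y; have [kx ky _] := meet; exists kappa; split => //.
- rewrite divfK// -lee_fin EFinB fineK ?fin_num_measure//.
  exact: le_trans (is_meet_mass meet) (holder x y).
rewrite -lee_fin fineK ?fin_num_measure//; last first.
  rewrite -[X in measurable X]setTI; apply: (measurable_fun_le measurableT) => //.
  exact: measurable_opnorm_fst.
apply: (le_trans (ltW kd)); apply: le_measure; rewrite ?inE.
- have -> : [set z : borelG R d | (opnorm z.1)%:E <= alpha] =
      setT `&` [set z | (opnorm z.1 <= fine alpha)%R].
    by rewrite setTI -{1}(fineK alpha_fin).
  apply: (measurable_fun_le measurableT) => //; exact: measurable_opnorm_fst.
- rewrite -[X in measurable X]setTI; apply: (measurable_fun_le measurableT) => //.
  exact: measurable_opnorm_fst.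
- by move=> z /= h; rewrite -lee_fin (le_trans h).
Qed.
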